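(* Let $k\ge 2$ be an integer. Given an $n$-node $m$-edge undirected weighted graph $G$ (non-negative weights) and vertex pairs $(s_i,t_i)$ for $1\le i\le O(n)$, there is a randomized algorithm that computes estimates $\hat d(s_i,t_i)$ such that $d(s_i,t_i)\le \hat d(s_i,t_i)\le (2k-3)\,d(s_i,t_i)+2\lceil d(s_i,t_i)/2\rceil$ for all $i$, in $\tilde O(mn^{1/k})$ time with high probability.
   Context: $d(\cdot,\cdot)$ is the shortest-path distance in $G$. $\tilde O$ hides polylogarithmic factors; ''with high probability'' means with probability $1-1/\mathrm{poly}(n)$.
   Formalization: The time proved is Õ((m+n)n^{1/k}) instead of Õ(mn^{1/k}); the stated bound fails for very sparse graphs (with m = 0 it leaves no time to output n estimates), and the two bounds agree when m = Ω(n), e.g. for connected graphs with n ≥ 2. *)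

(* Defs.v *)
From HB Require Import structures.
From mathcomp Require Import all_boot all_order all_algebra.
From mathcomp Require Import all_classical all_reals all_analysis.

Set Implicit Arguments.
Unset Strict Implicit.
Unset Printing Implicit Defensive.

Import Order.TTheory GRing.Theory Num.Theory.

Local Open Scope ring_scope.

Record wgraph (R : realType) (n : nat) := WGraph {
  adj : rel 'I_n;
  wt : 'I_n -> 'I_n -> R;
  adj_sym : symmetric adj;
  adj_irr : irreflexive adj;
  wt_sym : forall x y, adj x y -> wt x y = wt y x;
  wt_ge0 : forall x y, adj x y -> 0 <= wt x y
}.

Definition edges (R : realType) (n : nat) (G : wgraph R n) : {set {set 'I_n}} :=
  [set a : {set 'I_n} | [exists x, exists y, adj G x y && (a == [set x; y])]]%SET.

(* The walk [x :: p]; [zip (x :: p) p] lists its consecutive pairs. *)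
Definition walk_weight (R : realType) (n : nat) (G : wgraph R n)
    (x : 'I_n) (p : seq 'I_n) : R :=
  \sum_(e <- zip (x :: p) p) wt G e.1 e.2.

(* Equal to [+oo] when [x] and [y] are not connected. *)
Definition dist (R : realType) (n : nat) (G : wgraph R n) (x y : 'I_n) : \bar R :=
  ereal_inf [set (walk_weight G x p)%:E | p in
    [set p : seq 'I_n | path (adj G) x p /\ last x p = y]]%classic.

(* (2k-3) d + 2 ceil(d/2), with value [+oo] at [d = +oo]. *)
Definition stretch (R : realType) (k : nat) (d : \bar R) : \bar R :=
  if d is r%:E then
    ((2 * k%:R - 3) * r + 2 * (Num.ceil (r / 2))%:~R)%:E
  else d.

(* The computation model is a randomized word RAM whose memory consists of
   arrays of [w]-bit words and arrays of weights.  Weights may only be copied,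
   added and compared, so that no information other than the outcome of
   comparisons flows from weights to words.  Arrays are named by constants of
   the program, hence any given program uses finitely many of them; a scalar
   variable is cell 0 of an array. *)

Inductive wexp :=                    (* word expressions *)
| Cst of nat
| Get of nat & wexp                  (* [Get a e] is cell [e] of array [a] *)
| Add of wexp & wexp
| Sub of wexp & wexp
| Mul of wexp & wexp
| Div of wexp & wexp.

Inductive rexp :=                    (* weight expressions *)
| RZero
| RInfty
| RGet of nat & wexp
| RAdd of rexp & rexp.

Inductive bexp :=
| Leq of wexp & wexp
| RLeq of rexp & rexp
| Not of bexp
| And of bexp & bexp.

Inductive cmd :=
| Skip
| Put of nat & wexp & wexp           (* [Put a i e] stores [e] in a[i] *)
| RPut of nat & wexp & rexp
| Flip of nat & wexp                 (* stores a fair random bit *)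
| Seq of cmd & cmd
| If of bexp & cmd & cmd
| While of bexp & cmd.

Record mem (R : realType) := Mem {
  words : nat -> nat -> nat;
  weights : nat -> nat -> \bar R
}.

Definition upd (T : Type) (f : nat -> nat -> T) (a i : nat) (v : T) :=
  fun a' i' => if (a' == a) && (i' == i) then v else f a' i'.

(* Arithmetic is modulo 2 ^ w, except that subtraction is truncated at 0 and
   division by 0 yields 0. *)
Fixpoint weval (R : realType) (w : nat) (s : mem R) (e : wexp) : nat :=
  match e with
  | Cst c => c %% 2 ^ w
  | Get a i => words s a (weval w s i)
  | Add e1 e2 => (weval w s e1 + weval w s e2) %% 2 ^ w
  | Sub e1 e2 => weval w s e1 - weval w s e2
  | Mul e1 e2 => (weval w s e1 * weval w s e2) %% 2 ^ w
  | Div e1 e2 => weval w s e1 %/ weval w s e2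
  end%N.

Fixpoint reval (R : realType) (w : nat) (s : mem R) (e : rexp) : \bar R :=
  match e with
  | RZero => 0
  | RInfty => +oo
  | RGet a i => weights s a (weval w s i)
  | RAdd e1 e2 => reval w s e1 + reval w s e2
  end%E.

Fixpoint beval (R : realType) (w : nat) (s : mem R) (b : bexp) : bool :=
  match b with
  | Leq e1 e2 => (weval w s e1 <= weval w s e2)%N
  | RLeq e1 e2 => (reval w s e1 <= reval w s e2)%E
  | Not b1 => ~~ beval w s b1
  | And b1 b2 => beval w s b1 && beval w s b2
  end.

(* A configuration is a stack of commands still to be executed, and a memory;
   the machine has halted when the stack is empty. *)
Definition config (R : realType) := (seq cmd * mem R)%type.

(* One unit of time; the expressions evaluated in a step have size bounded by
   that of the program.  The bit [r] is a fresh coin, read only by [Flip]. *)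
Definition step (R : realType) (w : nat) (c : config R) (r : bool) : config R :=
  let: (K, s) := c in
  match K with
  | [::] => c
  | Skip :: K' => (K', s)
  | Put a i e :: K' =>
      (K', Mem (upd (words s) a (weval w s i) (weval w s e)) (weights s))
  | RPut a i e :: K' =>
      (K', Mem (words s) (upd (weights s) a (weval w s i) (reval w s e)))
  | Flip a i :: K' =>
      (K', Mem (upd (words s) a (weval w s i) (r %% 2 ^ w)%N) (weights s))
  | Seq c1 c2 :: K' => (c1 :: c2 :: K', s)
  | If b c1 c2 :: K' => ((if beval w s b then c1 else c2) :: K', s)
  | While b c1 :: K' =>
      (if beval w s b then c1 :: While b c1 :: K' else K', s)
  end.

Definition run (R : realType) (w : nat) (P : cmd) (s : mem R)
    (coins : seq bool) : config R :=
  foldl (step w) ([:: P], s) coins.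

Definition halted (R : realType) (c : config R) : bool := nilp c.1.

(* A run of [T] steps reads at most [T] coins. *)
Definition halt_prob (R : realType) (w : nat) (P : cmd) (s : mem R)
    (T : nat) : R :=
  #|[pred coins : T.-tuple bool | halted (run w P s coins)]|%:R / 2 ^+ T.

(* [l] lists every edge once, in either orientation, in arbitrary order. *)
Definition edge_list (R : realType) (n : nat) (G : wgraph R n)
    (l : seq ('I_n * 'I_n)) : bool :=
  perm_eq [seq [set e.1; e.2]%SET | e <- l] (enum (edges G)).

(* Input convention: word array 0 holds the numbers of nodes, edges and query
   pairs; word arrays 1 and 2 and weight array 0 hold the endpoints and the
   weights of the edges; word arrays 3 and 4 hold the query pairs.  All other
   cells are 0. *)
Definition input (R : realType) (n : nat) (G : wgraph R n)
    (l st : seq ('I_n * 'I_n)) : mem R :=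
  Mem (fun a i =>
         nth 0%N (nth [::] [:: [:: n; size l; size st];
                               [seq val e.1 | e <- l]; [seq val e.2 | e <- l];
                               [seq val e.1 | e <- st]; [seq val e.2 | e <- st]]
                  a) i)
      (fun a i =>
         nth 0%E (nth [::] [:: [seq (wt G e.1 e.2)%:E | e <- l]] a) i).

(* The estimate for the [i]-th pair is left in cell [i] of weight array 1. *)
Definition estimate (R : realType) (c : config R) (i : nat) : \bar R :=
  weights c.2 1%N i.

(* [b.+1] times the number of bits of the input size, so that every word of
   the input fits. *)
Definition word_length (b size : nat) : nat := b.+1 * (trunc_log 2 size).+1.

(* Main.v *)
(* The algorithm is a deterministic Thorup-Zwick oracle with a sharper bottom
   level, so no coin is flipped and the halting probability is 1.

   Let rho = ceil(n^(1/k)), lam = O(log n), L = 6 lam rho and del = m/n + 1.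
   There are levels V = A_0, A_1, ..., A_(k-1).  At level i every vertex keeps a
   list of its nearest members of A_i, cut off once the total weight of the list
   reaches del * L, where a member weighs del, plus its degree if i = 0.  The
   lists of a level are found by one Dijkstra search over pairs (vertex, source);
   since a list has at most L entries, the search relaxes O(m L) arcs.  A_(i+1)
   is a set that hits every full list, found by a greedy procedure with
   thresholds n, n/2, n/4, ...; averaging over the weights gives
   |A_i| rho^i <= n, so no list is full at level k-1.

   The estimate for (s, t) is the least length of a walk through a common entry
   of the lists of s and t at some level, or through an edge that joins an entry
   of the level-0 list of s to one of t; by the choice of the weights, all these
   edges are scanned in time O(del * L).  Given a walk of length d from s to t,
   consider its edge at distance d/2 from s.  Either this edge is found, or a
   list of s or t is full before reaching it, and then it contains a member of
   A_1 at distance at most d/2.  From level i to level i+1 the distance to a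
   suitable member grows by at most d, until a common entry is reached.  The
   estimate is therefore at most 2 (d/2 + (k-2) d) + d = (2k-2) d. *)
Require Import Defs.
From mathcomp Require Import all_boot all_order all_algebra.
From mathcomp Require Import all_classical all_reals all_analysis.
From mathcomp Require Import zify ring lra.

Set Implicit Arguments.
Unset Strict Implicit.
Unset Printing Implicit Defensive.

Import Order.TTheory GRing.Theory Num.Theory.

Local Open Scope nat_scope.

(** The degree charge makes the edge scan of a query affordable: a list cut off by its length alone
    could contain vertices of huge degree, whereas the budget [del * L] controls length and scanned
    edges at once. Then [O(n)] queries of cost [del * L] fit, because [n * del] is at most [m + n].
    The charge costs only a constant, since the total weight at level 0 is [n * del + 2 * m], at
    most [3 * n * del]. The constant 6 in [L] is this 3 times the 2 lost by halving thresholds. The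
    factor [lam] in [L] is the number of thresholds; a second one in the running time is the height
    of the priority queue. The bound [(2 * k - 2) * d] suffices because [2 * ceil (d / 2) >= d]. The
    formal obstacle is arithmetic modulo [2 ^ w]. Programs are therefore verified with unbounded
    words, every stored word being bounded by a polynomial cap. As the program is fixed, a word
    length that is a constant multiple of the bit length of the input size then rules out wraparound
    in all its expressions. *)

Notation memory := Defs.mem.

(** * Cost logic for programs without coin flips *)

Section Machine.
Variable R : realType.
Implicit Types (s : memory R) (e : wexp) (x : rexp) (b : bexp) (c : cmd).

Fixpoint ieval s e : nat :=
  match e with
  | Cst c => c
  | Get a i => words s a (ieval s i)
  | Add e1 e2 => ieval s e1 + ieval s e2
  | Defs.Sub e1 e2 => ieval s e1 - ieval s e2
  | Mul e1 e2 => ieval s e1 * ieval s e2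
  | Div e1 e2 => ieval s e1 %/ ieval s e2
  end.

Fixpoint ireval s x : \bar R :=
  match x with
  | RZero => 0
  | RInfty => +oo
  | RGet a i => weights s a (ieval s i)
  | RAdd x1 x2 => ireval s x1 + ireval s x2
  end%E.

Fixpoint ibeval s b : bool :=
  match b with
  | Leq e1 e2 => ieval s e1 <= ieval s e2
  | RLeq x1 x2 => (ireval s x1 <= ireval s x2)%E
  | Not b1 => ~~ ibeval s b1
  | And b1 b2 => ibeval s b1 && ibeval s b2
  end.

Definition wput s a i v := Defs.Mem (upd (words s) a i v) (weights s).
Definition rput s a i v := Defs.Mem (words s) (upd (weights s) a i v).

Definition bounded V s := forall a i, words s a i <= V.

(** Chosen so that [V.+2 ^ wsize e] exceeds the value of [e] when all words are at most [V]:
    exponents add up under products, the extra 1 pays for the factor 2 of a sum, and a constant [c]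
    is below [2 ^ c.+1]. *)
Fixpoint wsize e : nat :=
  match e with
  | Cst c => c.+1
  | Get a i => (wsize i).+1
  | Add e1 e2 | Defs.Sub e1 e2 | Mul e1 e2 | Div e1 e2 => (wsize e1 + wsize e2).+1
  end.

Fixpoint rsize x : nat :=
  match x with
  | RZero | RInfty => 0
  | RGet a i => wsize i
  | RAdd x1 x2 => rsize x1 + rsize x2
  end.

Fixpoint bsize b : nat :=
  match b with
  | Leq e1 e2 => wsize e1 + wsize e2
  | RLeq x1 x2 => rsize x1 + rsize x2
  | Not b1 => bsize b1
  | And b1 b2 => bsize b1 + bsize b2
  end.

(** A sum over the whole command, so that the single inequality [V.+2 ^ csize c <= 2 ^ w] excludes
    wraparound in each of its expressions. *)
Fixpoint csize c : nat :=
  match c with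
  | Skip => 0
  | Put a i e => wsize i + wsize e
  | RPut a i x => wsize i + rsize x
  | Flip a i => wsize i
  | Seq c1 c2 => csize c1 + csize c2
  | If b c1 c2 => bsize b + csize c1 + csize c2
  | While b c1 => bsize b + csize c1
  end.

Lemma ieval_lt V s e : bounded V s -> ieval s e < V.+2 ^ wsize e.
Proof.
move=> Vs; elim: e => /=.
- move=> c; apply: (@leq_trans (2 ^ c.+1)); last by rewrite leq_exp2r.
  by rewrite expnS (leq_trans (ltn_expl c (isT : 1 < 2))) // leq_pmull.
- move=> a i _; rewrite expnS; apply: (@leq_trans V.+2).
    by rewrite ltnS (leq_trans (Vs _ _)).
  by rewrite leq_pmulr // expn_gt0.
- move=> e1 h1 e2 h2; rewrite expnS expnD.
  have : 0 < V.+2 ^ wsize e1 by rewrite expn_gt0.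
  have : 0 < V.+2 ^ wsize e2 by rewrite expn_gt0.
  set X := _ ^ _ in h2 *; set Y := _ ^ _ in h1 * => X0 Y0; nia.
- move=> e1 h1 e2 h2; apply: (@leq_trans (V.+2 ^ wsize e1)).
    by apply: leq_ltn_trans h1; exact: leq_subr.
  by rewrite leq_pexp2l // -addnS leq_addr.
- move=> e1 h1 e2 h2; rewrite expnS expnD.
  have : 0 < V.+2 ^ wsize e1 by rewrite expn_gt0.
  have : 0 < V.+2 ^ wsize e2 by rewrite expn_gt0.
  set X := _ ^ _ in h2 *; set Y := _ ^ _ in h1 * => X0 Y0; nia.
- move=> e1 h1 e2 h2; apply: (@leq_trans (V.+2 ^ wsize e1)).
    by apply: leq_ltn_trans h1; exact: leq_div.
  by rewrite leq_pexp2l // -addnS leq_addr.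
Qed.

Lemma leq_expD2 V p q M : V.+2 ^ (p + q) <= M -> V.+2 ^ p <= M /\ V.+2 ^ q <= M.
Proof.
by move=> h; split; apply: leq_trans h; rewrite leq_pexp2l // (leq_addr, leq_addl).
Qed.

Lemma weval_ieval V w s e :
  bounded V s -> V.+2 ^ wsize e <= 2 ^ w -> weval w s e = ieval s e.
Proof.
move=> Vs; elim: e => /=.
- move=> c h; rewrite modn_small //; apply: leq_trans h.
  exact: (@ieval_lt V s (Cst c)).
- move=> a i IH h; rewrite IH //; apply: leq_trans h.
  by rewrite leq_pexp2l.
- move=> e1 h1 e2 h2 h.
  have /leq_expD2[a1 a2] : V.+2 ^ (wsize e1 + wsize e2) <= 2 ^ w.
    by apply: leq_trans h; rewrite leq_pexp2l.
  rewrite h1 // h2 // modn_small //; apply: leq_trans h.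
  exact: (@ieval_lt V s (Add e1 e2)).
- move=> e1 h1 e2 h2 h.
  have /leq_expD2[a1 a2] : V.+2 ^ (wsize e1 + wsize e2) <= 2 ^ w.
    by apply: leq_trans h; rewrite leq_pexp2l.
  by rewrite h1 // h2.
- move=> e1 h1 e2 h2 h.
  have /leq_expD2[a1 a2] : V.+2 ^ (wsize e1 + wsize e2) <= 2 ^ w.
    by apply: leq_trans h; rewrite leq_pexp2l.
  rewrite h1 // h2 // modn_small //; apply: leq_trans h.
  exact: (@ieval_lt V s (Mul e1 e2)).
- move=> e1 h1 e2 h2 h.
  have /leq_expD2[a1 a2] : V.+2 ^ (wsize e1 + wsize e2) <= 2 ^ w.
    by apply: leq_trans h; rewrite leq_pexp2l.
  by rewrite h1 // h2.
Qed.

Lemma reval_ireval V w s x :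
  bounded V s -> V.+2 ^ rsize x <= 2 ^ w -> reval w s x = ireval s x.
Proof.
move=> Vs; elim: x => //= [a i h|x1 h1 x2 h2 /leq_expD2[a1 a2]].
  by rewrite (weval_ieval Vs).
by rewrite h1 // h2.
Qed.

Lemma beval_ibeval V w s b :
  bounded V s -> V.+2 ^ bsize b <= 2 ^ w -> beval w s b = ibeval s b.
Proof.
move=> Vs; elim: b => /= [e1 e2|x1 x2|b h|b1 h1 b2 h2].
- by move=> /leq_expD2[a1 a2]; rewrite !(weval_ieval Vs).
- by move=> /leq_expD2[a1 a2]; rewrite !(reval_ireval Vs).
- by move=> /h ->.
- by move=> /leq_expD2[a1 a2]; rewrite h1 // h2.
Qed.

(* Execution with unbounded words, allowed to store only values up to [V];
   the last index is the number of steps. *)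
Inductive iexec (V : nat) : cmd -> memory R -> memory R -> nat -> Prop :=
| ISkip s : iexec V Skip s s 1
| IPut a i e s : ieval s e <= V ->
    iexec V (Put a i e) s (wput s a (ieval s i) (ieval s e)) 1
| IRPut a i x s : iexec V (RPut a i x) s (rput s a (ieval s i) (ireval s x)) 1
| ISeq c1 c2 s1 s2 s3 t1 t2 : iexec V c1 s1 s2 t1 -> iexec V c2 s2 s3 t2 ->
    iexec V (Seq c1 c2) s1 s3 (t1 + t2).+1
| IIf b c1 c2 s s' t : iexec V (if ibeval s b then c1 else c2) s s' t ->
    iexec V (If b c1 c2) s s' t.+1
| IWhileF b c s : ~~ ibeval s b -> iexec V (While b c) s s 1
| IWhileT b c s1 s2 s3 t1 t2 : ibeval s1 b -> iexec V c s1 s2 t1 ->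
    iexec V (While b c) s2 s3 t2 -> iexec V (While b c) s1 s3 (t1 + t2).+1.

Lemma iexec_bounded V c s s' t : iexec V c s s' t -> bounded V s -> bounded V s'.
Proof.
elim=> {c s s' t} //=.
- move=> a i e s ev Vs a' i' /=; rewrite /upd; by case: ifP.
- by move=> c1 c2 s1 s2 s3 t1 t2 _ h1 _ h2 /h1 /h2.
- by move=> b c s1 s2 s3 t1 t2 _ _ h1 _ h2 /h1 /h2.
Qed.

(** The rest [K] of the stack is arbitrary because [Seq] and [While] push their continuation onto
    it. No rule of [iexec] covers [Flip], so only the number of coins matters. *)
Lemma iexec_run V w c s s' t : iexec V c s s' t -> bounded V s ->
  V.+2 ^ csize c <= 2 ^ w -> forall K coins, size coins = t ->
  foldl (step w) (c :: K, s) coins = (K, s').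
Proof.
elim=> {c s s' t} /=.
- by move=> s _ _ K [|r []].
- move=> a i e s _ Vs /leq_expD2[h1 h2] K [|r []] //= _.
  by rewrite !(weval_ieval Vs).
- move=> a i x s Vs /leq_expD2[h1 h2] K [|r []] //= _.
  by rewrite !(weval_ieval Vs, reval_ireval Vs).
- move=> c1 c2 s1 s2 s3 t1 t2 e1 h1 e2 h2 Vs /leq_expD2[a1 a2] K [|r cs] //= [sz].
  have lt1 : t1 <= size cs by rewrite sz leq_addr.
  rewrite -(cat_take_drop t1 cs) foldl_cat h1 ?size_takel //.
  rewrite h2 //; first exact: (iexec_bounded e1 Vs).
  by rewrite size_drop sz addKn.
- move=> b c1 c2 s s' t e h Vs /leq_expD2[/leq_expD2[a1 a2] a3] K [|r cs] //= [sz].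
  by rewrite (beval_ibeval Vs) // h //; case: ifP.
- move=> b c s /negbTE bF Vs /leq_expD2[a1 a2] K [|r []] //= _.
  by rewrite (beval_ibeval Vs) // bF.
- move=> b c s1 s2 s3 t1 t2 bT e1 h1 e2 h2 Vs a K [|r cs] //= [sz].
  case/leq_expD2: (a) => a1 a2; rewrite (beval_ibeval Vs) // bT.
  have lt1 : t1 <= size cs by rewrite sz leq_addr.
  rewrite -(cat_take_drop t1 cs) foldl_cat h1 ?size_takel //.
  rewrite h2 //; first exact: (iexec_bounded e1 Vs).
  by rewrite size_drop sz addKn.
Qed.

Lemma run_halted (w : nat) K s coins :
  nilp K -> foldl (@step R w) (K, s) coins = (K, s).
Proof. by case: K => // _; elim: coins. Qed.

Lemma iexec_halts V w c s s' t coins : iexec V c s s' t -> bounded V s ->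
  V.+2 ^ csize c <= 2 ^ w -> t <= size coins -> run w c s coins = ([::], s').
Proof.
move=> e Vs h sz; rewrite /run -(cat_take_drop t coins) foldl_cat.
by rewrite (iexec_run e Vs h) ?size_takel // run_halted.
Qed.

(** A halted configuration is a fixed point of [step]: appending [t] coins does not change it, yet
    makes the run long enough for [iexec_halts]. *)
Lemma iexec_halted V w c s s' t coins : iexec V c s s' t -> bounded V s ->
  V.+2 ^ csize c <= 2 ^ w -> halted (run w c s coins) ->
  run w c s coins = ([::], s').
Proof.
move=> e Vs h hlt.
have := iexec_halts (coins := coins ++ nseq t false) e Vs h.
rewrite size_cat size_nseq leq_addl => /(_ isT).
rewrite /run foldl_cat -/(run w c s coins); move: hlt.
by case: (run w c s coins) => K s1 hK; rewrite run_halted.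
Qed.

Lemma iexec_halt_prob V w c s s' t T : iexec V c s s' t -> bounded V s ->
  V.+2 ^ csize c <= 2 ^ w -> t <= T -> halt_prob w c s T = 1%R.
Proof.
move=> e Vs h tT; rewrite /halt_prob (eq_card (B := {: T.-tuple bool})).
  rewrite card_tuple card_bool natrX divff // expf_neq0.
by move=> cs; rewrite !inE (iexec_halts e Vs h) ?size_tuple.
Qed.

Fixpoint wmods c : seq nat :=
  match c with
  | Put a _ _ | Flip a _ => [:: a]
  | Seq c1 c2 | If _ c1 c2 => wmods c1 ++ wmods c2
  | While _ c1 => wmods c1
  | _ => [::]
  end.

Fixpoint rmods c : seq nat :=
  match c with
  | RPut a _ _ => [:: a]
  | Seq c1 c2 | If _ c1 c2 => rmods c1 ++ rmods c2
  | While _ c1 => rmods c1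
  | _ => [::]
  end.

(** Frame condition. Array names are constants, so whether an invariant survives a command is
    decided by computation; hence the many [isT] arguments below. *)
Definition agree (ws rs : seq nat) s s' :=
  (forall a i, a \notin ws -> words s' a i = words s a i) /\
  (forall a i, a \notin rs -> weights s' a i = weights s a i).

Lemma agree_wput s a (i v : nat) : agree [:: a] [::] s (wput s a i v).
Proof. by split=> // a' i'; rewrite inE /= /upd => /negbTE->. Qed.

Lemma agree_trans ws rs s1 s2 s3 :
  agree ws rs s1 s2 -> agree ws rs s2 s3 -> agree ws rs s1 s3.
Proof.
move=> [h1 g1] [h2 g2]; split=> a i ai; first by rewrite h2 // h1.
by rewrite g2 // g1.
Qed.

Lemma agree_sub ws rs ws' rs' s s' : {subset ws <= ws'} -> {subset rs <= rs'} ->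
  agree ws rs s s' -> agree ws' rs' s s'.
Proof.
move=> sw sr [h g]; split=> a i ai; rewrite (h, g) //.
  by apply: contra ai => /sw.
by apply: contra ai => /sr.
Qed.

Lemma iexec_agree V c s s' t : iexec V c s s' t -> agree (wmods c) (rmods c) s s'.
Proof.
elim=> {c s s' t} //=.
- by move=> a i e s _; split=> // a' i'; rewrite inE /= /upd => /negbTE->.
- by move=> a i e s; split=> // a' i'; rewrite inE /= /upd => /negbTE->.
- move=> c1 c2 s1 s2 s3 t1 t2 _ h1 _ h2; apply: agree_trans.
    by apply: agree_sub h1 => x xi; rewrite mem_cat xi.
  by apply: agree_sub h2 => x xi; rewrite mem_cat xi orbT.
- move=> b c1 c2 s s' t _.
  by case: ifP => _; apply: agree_sub => x xi; rewrite mem_cat xi ?orbT.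
- by move=> b c s1 s2 s3 t1 t2 _ _ h1 _; exact: agree_trans.
Qed.

(** Total correctness with a time budget [T], in weakest-precondition form. *)
Definition twp V c s T (Q : memory R -> Prop) :=
  exists s' t, [/\ iexec V c s s' t, t <= T & Q s'].

Lemma twp_agree V c s T Q : twp V c s T Q ->
  twp V c s T (fun s' => agree (wmods c) (rmods c) s s' /\ Q s').
Proof.
move=> [s' [t [e tT q]]]; exists s', t; split=> //; split=> //.
exact: iexec_agree e.
Qed.

Lemma twp_bounded V c s T Q : bounded V s -> twp V c s T Q ->
  twp V c s T (fun s' => bounded V s' /\ Q s').
Proof.
move=> bs [s' [t [e tT q]]]; exists s', t; split=> //; split=> //.
exact: iexec_bounded e bs.
Qed.

Lemma twp_wk V c s T T' (Q Q' : memory R -> Prop) : twp V c s T Q -> T <= T' ->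
  (forall s', agree (wmods c) (rmods c) s s' -> Q s' -> Q' s') ->
  twp V c s T' Q'.
Proof.
move=> [s' [t [e tT q]]] TT h; exists s', t; split=> //.
  exact: leq_trans TT.
by apply: h => //; exact: iexec_agree e.
Qed.

Lemma twp_skip V s T (Q : memory R -> Prop) : 0 < T -> Q s -> twp V Skip s T Q.
Proof. by move=> T0 q; exists s, 1; split=> //; exact: ISkip. Qed.

Lemma twp_put V s a i e T (Q : memory R -> Prop) : 0 < T -> ieval s e <= V ->
  Q (wput s a (ieval s i) (ieval s e)) -> twp V (Put a i e) s T Q.
Proof. by move=> T0 eV q; do 2!eexists; split; [exact: IPut|exact: T0|]. Qed.

Lemma twp_rput V s a i x T (Q : memory R -> Prop) : 0 < T ->
  Q (rput s a (ieval s i) (ireval s x)) -> twp V (RPut a i x) s T Q.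
Proof. by move=> T0 q; do 2!eexists; split; [exact: IRPut|exact: T0|]. Qed.

Lemma twp_seq V c1 c2 s T1 T2 T Q : twp V c1 s T1 (fun s1 => twp V c2 s1 T2 Q) ->
  (T1 + T2).+1 <= T -> twp V (Seq c1 c2) s T Q.
Proof.
move=> [s1 [t1 [e1 l1 [s2 [t2 [e2 l2 q]]]]]] lT; do 2!eexists; split.
- exact: ISeq e1 e2.
- by apply: leq_trans lT; rewrite ltnS leq_add.
- exact: q.
Qed.

Lemma twp_if V b c1 c2 s T (Q : memory R -> Prop) :
  (ibeval s b -> twp V c1 s T Q) -> (~~ ibeval s b -> twp V c2 s T Q) ->
  twp V (If b c1 c2) s T.+1 Q.
Proof.
move=> h1 h2.
have [s' [t [e tT q]]] : twp V (if ibeval s b then c1 else c2) s T Q.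
  by case: ifP => [/h1|/negbT/h2].
by exists s', t.+1; split=> //; exact: IIf.
Qed.

(** Amortized analysis: the strict decrease of the potential [Phi] pays for the body and for one
    test, and [Phi s0 < T] leaves one unit for the last test. The cost [t] may differ from one turn
    to the next. *)
Lemma twp_while V b c s0 (I : memory R -> Prop) (Phi : memory R -> nat) T
    (Q : memory R -> Prop) :
  (forall s, I s -> agree (wmods c) (rmods c) s0 s -> ibeval s b ->
     exists t, twp V c s t (fun s' => I s' /\ t + Phi s' < Phi s)) ->
  I s0 -> Phi s0 < T ->
  (forall s, I s -> agree (wmods c) (rmods c) s0 s -> ~~ ibeval s b -> Q s) ->
  twp V (While b c) s0 T Q.
Proof.
move=> hb I0 ltT0 hQ.
suff H p s U : agree (wmods c) (rmods c) s0 s -> Phi s < p -> I s ->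
    Phi s < U -> twp V (While b c) s U Q.
  exact: (H (Phi s0).+1).
elim: p s U => // p IH s U As ltp Is ltT.
have [bT|bF] := boolP (ibeval s b); last first.
  exists s, 1; split; [exact: IWhileF|by rewrite (leq_trans _ ltT)|].
  exact: hQ.
have [t /twp_agree[s1 [t1 [e1 l1 [A1 [I1 lt1]]]]]] := hb _ Is As bT.
have As1 := agree_trans As A1.
have [] // := IH s1 (Phi s1).+1 As1.
  by apply: (@leq_trans (Phi s)) => //; apply: leq_ltn_trans lt1; rewrite leq_addl.
move=> s2 [t2 [e2 l2 q2]]; exists s2, (t1 + t2).+1; split=> //.
  exact: IWhileT e1 e2.
lia.
Qed.

Definition For (x : nat) bnd body :=
  Seq (Put x (Cst 0) (Cst 0))
    (While (Leq (Add (Get x (Cst 0)) (Cst 1)) bnd)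
       (Seq body (Put x (Cst 0) (Add (Get x (Cst 0)) (Cst 1))))).

(** The overhead of 3 per turn is the test, the [Seq] and the increment; the final 3 is the outer
    [Seq], the initialisation and the failing test. The invariant has to tolerate writes to the
    counter. *)
Lemma twp_for V (x : nat) bnd body s0 N (B : nat -> nat) (I : nat -> memory R -> Prop)
    T (Q : memory R -> Prop) :
  x \notin wmods body -> N <= V ->
  (forall s, agree (x :: wmods body) (rmods body) s0 s -> ieval s bnd = N) ->
  (forall i s v, v <= V -> I i s -> I i (wput s x 0 v)) ->
  I 0 s0 ->
  (forall i s, i < N -> words s x 0 = i ->
     agree (x :: wmods body) (rmods body) s0 s -> I i s ->
     twp V body s (B i) (I i.+1)) ->
  \sum_(0 <= i < N) (B i + 3) + 3 <= T ->
  (forall s, agree (x :: wmods body) (rmods body) s0 s -> words s x 0 = N ->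
     I N s -> Q s) ->
  twp V (For x bnd body) s0 T Q.
Proof.
move=> xb NV hbnd Ix I0 hbody leT hQ.
apply: (@twp_seq _ _ _ _ 1 (\sum_(0 <= i < N) (B i + 3) + 1)); last by lia.
apply: twp_put => //=.
set s1 := wput _ _ _ _.
have A1 : agree (x :: wmods body) (rmods body) s0 s1.
  by split=> // a i; rewrite inE negb_or /= /upd => /andP[/negbTE->].
have sub : forall s s', agree (wmods (Seq body (Put x (Cst 0) (Add (Get x (Cst 0)) (Cst 1)))))
    (rmods (Seq body (Put x (Cst 0) (Add (Get x (Cst 0)) (Cst 1))))) s s' ->
    agree (x :: wmods body) (rmods body) s s'.
  move=> s s'; apply: agree_sub => y /=; rewrite mem_cat !inE ?orbF; first by rewrite orbC.
  by [].
pose J s := words s x 0 <= N /\ I (words s x 0) s.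
apply: (twp_while (I := J) (Phi := fun s => \sum_(words s x 0 <= i < N) (B i + 3))).
- move=> s [le Is] /sub A /=; have As := agree_trans A1 A.
  rewrite hbnd // addn1 => lt; set i := words s x 0 in le lt Is *.
  exists (B i).+2; apply: (@twp_seq _ _ _ _ (B i) 1); last by lia.
  apply: (twp_wk (hbody _ _ lt erefl As Is)) => // s' [A' _] I'.
  have e : words s' x 0 = i by rewrite A'.
  apply: twp_put => //=; rewrite e addn1 ?(leq_trans lt) //.
  rewrite /J /= /upd !eqxx /=; split; first by split=> //; apply: Ix => //; exact: leq_trans NV.
  rewrite [leqRHS]big_ltn //; lia.
- by split; rewrite /= /upd !eqxx /=; [|exact: Ix].
- by rewrite /= /upd !eqxx /=; lia.
- move=> s [le Is] /sub A /=; have As := agree_trans A1 A.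
  rewrite hbnd // addn1 -leqNgt => ge.
  have e : words s x 0 = N by apply/eqP; rewrite eqn_leq le ge.
  by apply: hQ => //; rewrite -e.
Qed.

Lemma twp_for_bounded V (x : nat) bnd body s0 N (B : nat -> nat)
    (I : nat -> memory R -> Prop) T (Q : memory R -> Prop) :
  x \notin wmods body -> N <= V -> bounded V s0 ->
  (forall s, agree (x :: wmods body) (rmods body) s0 s -> ieval s bnd = N) ->
  (forall i s v, v <= V -> I i s -> I i (wput s x 0 v)) ->
  I 0 s0 ->
  (forall i s, i < N -> words s x 0 = i ->
     agree (x :: wmods body) (rmods body) s0 s -> bounded V s -> I i s ->
     twp V body s (B i) (I i.+1)) ->
  \sum_(0 <= i < N) (B i + 3) + 3 <= T ->
  (forall s, agree (x :: wmods body) (rmods body) s0 s -> words s x 0 = N ->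
     I N s -> Q s) ->
  twp V (For x bnd body) s0 T Q.
Proof.
move=> xb NV bs hbnd Ix I0 hbody leT hQ.
apply: (twp_for (I := fun i s => bounded V s /\ I i s)) hbnd _ _ _ leT _ => //.
- move=> i s v vV [bs1 I1]; split; last exact: Ix.
  by move=> a j; rewrite /wput /= /upd; case: ifP.
- by move=> i s iN si A [bs1 I1]; exact/twp_bounded/hbody.
by move=> s A sx [_]; exact: hQ.
Qed.

End Machine.

(** * Walks and source detection *)

Section Walks.
Variables (R : realType) (adjl : nat -> seq (nat * R)).

Inductive walk : nat -> nat -> R -> Prop :=
| walk_nil x : walk x x 0%R
| walk_cons x y z w om :
    (y, w) \in adjl x -> walk y z om -> walk x z (w + om)%R.

Record undirected (n : nat) : Prop := Undirected {
  und_lt : forall x y w, (y, w) \in adjl x -> x < n /\ y < n;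
  und_ge0 : forall x y w, (y, w) \in adjl x -> (0 <= w)%R;
  und_sym : forall x y w, (y, w) \in adjl x -> (x, w) \in adjl y }.

Lemma walk_cat x y z w1 w2 : walk x y w1 -> walk y z w2 -> walk x z (w1 + w2)%R.
Proof.
elim=> {x y w1} [x|x y z' w om xy _ IH] h; first by rewrite add0r.
by rewrite -addrA; apply: walk_cons xy (IH h).
Qed.

Lemma walk1 x y w : (y, w) \in adjl x -> walk x y w.
Proof. by move=> xy; rewrite -[w]addr0; apply: walk_cons xy (walk_nil _). Qed.

Variables (n : nat) (U : undirected n).

Lemma walk_rev x y om : walk x y om -> walk y x om.
Proof.
elim=> {x y om} [x|x y z w om xy _ IH]; first exact: walk_nil.
by rewrite addrC; apply: walk_cat IH (walk1 (und_sym U xy)).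
Qed.

Lemma walk_ge0 x y om : walk x y om -> (0 <= om)%R.
Proof.
by elim=> {x y om} // x y z w om /(und_ge0 U) w0 _ om0; rewrite addr_ge0.
Qed.

Lemma walk_lt x y om : walk x y om -> x < n -> y < n.
Proof. by elim=> {x y om} // x y z w om /(und_lt U)[_ yn] _ IH _; exact: IH. Qed.

(* The edge (or the end) of a walk that straddles its midpoint. *)
Lemma walk_mid x y om h : walk x y om -> (0 <= h <= om)%R ->
  (exists2 w, walk x y w & (w = om /\ w <= h)%R) \/
  (exists u v w1 w w2, [/\ walk x u w1, (v, w) \in adjl u, walk v y w2 &
     [/\ (w1 <= h)%R, (h < w1 + w)%R & (w1 + w + w2 = om)%R]]).
Proof.
move=> W; elim: W h => {x y om} [x h /andP[h0 _]|x y z w om xy W IH h /andP[h0 hle]].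
  by left; exists 0%R => //; exact: walk_nil.
have w0 := und_ge0 U xy.
have [hw|wh] := ltP h w.
  right; exists x, y, 0%R, w, om; split=> //; first exact: walk_nil.
  by split=> //; rewrite add0r.
have [|[w' W' [-> le']]|[u [v [w1 [w' [w2 [W1 uv W2 [le1 lt1 e1]]]]]]]] := IH (h - w)%R.
- by rewrite subr_ge0 wh /= lerBlDl.
- left; exists (w + om)%R; last by split=> //; rewrite -lerBrDl.
  exact: walk_cons xy W.
- right; exists u, v, (w + w1)%R, w', w2; split=> //; first exact: walk_cons xy W1.
  split; [lra|lra|by rewrite -e1; ring].
Qed.

End Walks.

(** * Dijkstra search from many sources with lists of bounded weight *)

Section SourceDetection.
Variables (R : realType) (adjl : nat -> seq (nat * R)) (n : nat).
Variables (U : undirected adjl n) (A : pred nat) (W : nat -> nat) (L0 : nat).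

Implicit Types (lst : nat -> seq nat) (D : nat -> nat -> R)
  (pend : nat -> nat -> R -> Prop).

Definition wsum (l : seq nat) := \sum_(a <- l) W a.

(** What the search owes to a walk of length [d] from [v] to [a]: the list of [v] may omit [a] only
    if it is full of entries that are at least as near. *)
Definition good lst D v a (d : R) :=
  (a \in lst v /\ (D v a <= d)%R) \/
  (L0 <= wsum (lst v) /\ forall b, b \in lst v -> (D v b <= d)%R).

(** Sorted by [f], with light proper prefixes. The last entry may carry the list beyond [L0] by any
    amount, as happens with a vertex of large degree. *)
Definition ordered (f : nat -> R) (l : seq nat) :=
  forall l1 z l2, l = l1 ++ z :: l2 ->
    wsum l1 < L0 /\ forall y, y \in l1 -> (f y <= f z)%R.

(* Invariant of the search that settles pairs (vertex, source) in the order of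
   their distance; a vertex settles no more sources once the total weight of
   its list has reached [L0]. *)
Record sd_inv lst D pend : Prop := SDInv {
  sd_lst : forall v a, a \in lst v ->
    [/\ v < n, a < n, A a & walk adjl v a (D v a)];
  sd_uniq : forall v, uniq (lst v);
  sd_ord : forall v, ordered (D v) (lst v);
  sd_pend : forall v a k, pend v a k -> [/\ v < n, a < n, A a & walk adjl v a k];
  sd_mono : forall v a k u b, pend v a k -> b \in lst u -> (D u b <= k)%R;
  sd_arc : forall v a x w, a \in lst v -> (x, w) \in adjl v ->
    good lst D x a (D v a + w) \/ exists2 k, pend x a k & (k <= D v a + w)%R;
  sd_src : forall a, a < n -> A a -> good lst D a a 0 \/ exists2 k, pend a a k & (k <= 0)%R
}.

Definition no_pend : nat -> nat -> R -> Prop := fun _ _ _ => False.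

Definition ins lst v a : nat -> seq nat :=
  fun x => if x == v then rcons (lst v) a else lst x.

Definition insD D v a k : nat -> nat -> R :=
  fun x b => if (x == v) && (b == a) then k else D x b.

Lemma wsum_rcons l a : wsum (rcons l a) = wsum l + W a.
Proof. by rewrite /wsum -cats1 big_cat big_seq1. Qed.

Lemma wsum_sub l l' : uniq l -> {subset l <= l'} -> wsum l <= wsum l'.
Proof.
elim: l l' => [|a l IH] l' /=; first by rewrite /wsum big_nil.
move=> /andP[al ul] sl.
have al' : a \in l' by apply: sl; rewrite inE eqxx.
rewrite /wsum big_cons (perm_big _ (perm_to_rem al')) big_cons leq_add2l.
apply: IH => // x xl.
have := sl x; rewrite inE xl orbT => /(_ isT); rewrite (perm_mem (perm_to_rem al')) inE.
by case: eqP => [xa|//]; rewrite -xa xl in al.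
Qed.

Lemma ordered_rcons f l a : ordered f l -> wsum l < L0 ->
  (forall y, y \in l -> (f y <= f a)%R) -> ordered f (rcons l a).
Proof.
move=> ol lt fa l1 z l2.
elim/last_ind: l2 => [|l2 b _].
  by rewrite cats1 => /rcons_inj[<- <-].
by rewrite -rcons_cons -rcons_cat => /rcons_inj[/ol].
Qed.

Lemma ordered_ext f g l : {in l, f =1 g} -> ordered f l -> ordered g l.
Proof.
move=> fg ol l1 z l2 e; have [h1 h2] := ol _ _ _ e; split=> // y yl.
rewrite -!fg ?h2 //; last by rewrite e mem_cat yl.
by rewrite e mem_cat inE eqxx orbT.
Qed.

Lemma good_le lst D v a d d' : (d <= d')%R -> good lst D v a d -> good lst D v a d'.
Proof.
move=> dd [[h1 h2]|[h1 h2]]; [left|right]; split=> //.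
  exact: le_trans dd.
by move=> b /h2 h; exact: le_trans dd.
Qed.

(** By [sd_mono] the popped key [k] bounds every distance recorded so far, so a list that is full or
    already contains [a] is [good] for it. [pend'] may still contain the popped triple, since a
    queue can hold equal entries. *)
Lemma sd_skip lst D pend pend' v a k : sd_inv lst D pend ->
  pend v a k -> a \in lst v \/ L0 <= wsum (lst v) ->
  (forall x b d, pend' x b d -> pend x b d) ->
  (forall x b d, pend x b d -> pend' x b d \/ [/\ x = v, b = a & d = k]) ->
  sd_inv lst D pend'.
Proof.
case=> i1 i2 i3 i4 i5 i6 i7 pk hv hs hi.
have gk : good lst D v a k.
  case: hv => hv; [left|right]; split=> //; first exact: i5 pk hv.
  by move=> b; exact: i5 pk.
split=> //.
- by move=> x b d /hs/i4.
- by move=> x b d u c /hs; exact: i5.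
- move=> x b y w bx xy; have [|[d p le]] := i6 _ _ _ _ bx xy; first by left.
  have [|[e1 e2 e3]] := hi _ _ _ p; first by right; exists d.
  by left; subst; apply: good_le gk.
- move=> b bn bA; have [|[d p le]] := i7 _ bn bA; first by left.
  have [|[e1 e2 e3]] := hi _ _ _ p; first by right; exists d.
  by left; apply: good_le le _; have := gk; rewrite -e1 -e2 -e3.
Qed.

(** As for Dijkstra's algorithm: the remaining keys are at least [k], and so are the new keys
    [k + w], whence settled distances never exceed pending ones. The second case of [good] cannot
    concern [v], whose list was not full. *)
Lemma sd_accept lst D pend pend' v a k : sd_inv lst D pend ->
  pend v a k -> (forall x b d, pend x b d -> (k <= d)%R) ->
  a \notin lst v -> wsum (lst v) < L0 ->
  (forall x b d, pend' x b d ->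
     pend x b d \/ b = a /\ exists2 w, (x, w) \in adjl v & d = (k + w)%R) ->
  (forall x b d, pend x b d -> pend' x b d \/ [/\ x = v, b = a & d = k]) ->
  (forall x w, (x, w) \in adjl v -> pend' x a (k + w)%R) ->
  sd_inv (ins lst v a) (insD D v a k) pend'.
Proof.
case=> i1 i2 i3 i4 i5 i6 i7 pk hmin hv lt hs hi hn.
have [vn an aA Wva] := i4 _ _ _ pk.
have memi x b : (b \in ins lst v a x) = (x == v) && (b == a) || (b \in lst x).
  by rewrite /ins; case: eqP => [->|//]; rewrite mem_rcons inE.
have Dold x b : b \in lst x -> insD D v a k x b = D x b.
  rewrite /insD; case: eqP => [->|//]; case: eqP => [->|//].
  by rewrite (negbTE hv).
have gold x b d : good lst D x b d -> good (ins lst v a) (insD D v a k) x b d.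
  move=> [[h1 h2]|[h1 h2]].
    by left; rewrite memi h1 orbT Dold.
  have xv : (x == v) = false by apply/negP => /eqP e; move: lt; rewrite -e; lia.
  right; rewrite /ins xv; split=> // c cl; rewrite Dold //; exact: h2.
have gk : good (ins lst v a) (insD D v a k) v a k.
  by left; rewrite memi /insD !eqxx.
have conv x b d : pend x b d -> good (ins lst v a) (insD D v a k) x b d \/ pend' x b d.
  by move=> /hi[p|[-> -> ->]]; [right|left].
split.
- move=> x b; rewrite memi => /orP[/andP[/eqP -> /eqP ->]|bx].
    by split=> //; rewrite /insD !eqxx.
  by rewrite Dold //; exact: i1.
- by move=> x; rewrite /ins; case: eqP => [_|//]; rewrite rcons_uniq hv i2.
- move=> x; have h : ordered (insD D v a k x) (lst x).
    by apply: ordered_ext (i3 x) => b bx; rewrite Dold.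
  rewrite /ins; case: eqP => [xv|//]; rewrite xv in h *.
  apply: ordered_rcons => // y yl; rewrite Dold // /insD !eqxx /=.
  exact: i5 pk yl.
- move=> x b d /hs[/i4//|[-> [w vx ->]]]; have [_ xn] := und_lt U vx.
  by split=> //; rewrite addrC; apply: (walk_cons _ Wva); exact: (und_sym U vx).
- move=> x b d u c /hs p.
  have kd : (k <= d)%R.
    by case: p => [/hmin//|[_ [w /(und_ge0 U) w0 ->]]]; rewrite lerDl.
  rewrite memi => /orP[/andP[/eqP-> /eqP->]|cu]; first by rewrite /insD !eqxx.
  by rewrite Dold //; apply: le_trans kd; exact: i5 pk cu.
- move=> x b y w; rewrite memi => /orP[/andP[/eqP-> /eqP->] vy|bx xy].
    by rewrite /insD !eqxx /=; right; exists (k + w)%R => //; exact: hn.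
  rewrite Dold //; have [/gold|[d p le]] := i6 _ _ _ _ bx xy; first by left.
  have [g|p'] := conv _ _ _ p; first by left; exact: good_le g.
  by right; exists d.
- move=> b bn bA; have [/gold|[d p le]] := i7 _ bn bA; first by left.
  have [g|p'] := conv _ _ _ p; first by left; exact: good_le g.
  by right; exists d.
Qed.

(** Induction on the walk. In the hard case the list of the next vertex [y] is full. Each of its
    entries reaches [x] within [w + om]. If [x] refused one of them, its list is full of entries at
    least as near. Otherwise it contains the full list of [y], so it is full too, and its farthest
    entry turns out to be one of those of [y]. *)
Lemma sd_good lst D v b om : sd_inv lst D no_pend -> walk adjl v b om ->
  b < n -> A b -> good lst D v b om.
Proof.
case=> i1 i2 i3 _ _ i6 i7; elim=> {v b om} [x|x y z w om xy _ IH] zn zA.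
  by have [//|[]] := i7 _ zn zA.
have yx := und_sym U xy.
have step a d : a \in lst y -> (D y a <= d)%R -> good lst D x a (w + d).
  move=> ay le; have [g|[]//] := i6 _ _ _ _ ay yx.
  by apply: good_le g; rewrite addrC lerD2l.
have [[zy le]|[full le]] := IH zn zA; first exact: step le.
have [/existsP[] |] := boolP [exists i : 'I_(size (lst y)),
   (nth 0 (lst y) i \notin lst x) || (w + om < D x (nth 0 (lst y) i))%R].
  move=> i; have ay : nth 0 (lst y) i \in lst y by exact: mem_nth.
  move: (nth _ _ _) ay => a ay h.
  have [[ax le']|//] := step a om ay (le _ ay); last by move=> g; right.
  by move: h; rewrite ax /= ltNge le'.
rewrite negb_exists => /forallP h.
have sub a : a \in lst y -> a \in lst x /\ (D x a <= w + om)%R.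
  move=> /(nthP 0)[i lti <-]; have := h (Ordinal lti).
  by rewrite negb_or negbK -leNgt => /andP[].
right; split.
  apply: leq_trans full _; apply: wsum_sub => // a /sub[] //.
move=> c; have := i3 x; move: sub; case/lastP: (lst x) => // l1 t sub ol ct.
(* Without its last entry [t] the list of [x] is light, so it cannot contain the full list of [y];
   hence [t] is an entry of [y], and its distance bounds all others. *)
have [lt1 let_] := ol l1 t [::] (esym (cats1 l1 t)).
have ct' : (D x c <= D x t)%R.
  by move: ct; rewrite mem_rcons inE => /orP[/eqP->|/let_].
apply: le_trans ct' _.
have [/allP s1|/allPn[a ay al]] := boolP (all (fun a => a \in l1) (lst y)).
  by have := wsum_sub (i2 y) s1; lia.
have [] := sub a ay; rewrite mem_rcons inE (negbTE al) orbF => /eqP-> //.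
Qed.

End SourceDetection.

(** * Stretch and hitting sets *)

Section Query.
Variables (R : realType) (adjl : nat -> seq (nat * R)) (n k : nat).
Variables (U : undirected adjl n) (A : nat -> pred nat) (W : nat -> nat -> nat).
Variables (L0 : nat) (lst : nat -> nat -> seq nat) (D : nat -> nat -> nat -> R).
Hypothesis k2 : 2 <= k.
Hypothesis sd : forall lev, lev < k ->
  sd_inv adjl n (A lev) (W lev) L0 (lst lev) (D lev) (@no_pend R).
Hypothesis A0 : forall a, a < n -> A 0 a.
Hypothesis hitting : forall lev v, lev.+1 < k -> v < n ->
  L0 <= wsum (W lev) (lst lev v) -> exists2 a, a \in lst lev v & A lev.+1 a.
Hypothesis last_level : forall v, wsum (W k.-1) (lst k.-1 v) < L0.

(** A vertex of weight at least [L0] lies in no light prefix, so it can only be the last entry,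
    which is the farthest. *)
Lemma heavy_last f V l u b : ordered V L0 f l -> u \in l -> b \in l ->
  L0 <= V u -> (f b <= f u :> R)%R.
Proof.
move=> ol ul; case/splitPr: ul ol => m1 m2 ol.
rewrite mem_cat inE => /orP[bm|/orP[/eqP->//|bm]] hu.
  by have [_] := ol m1 u m2 erefl; exact.
case/splitPr: bm ol => p q ol.
have [] := ol (m1 ++ u :: p) b q; first by rewrite -catA.
by rewrite /wsum big_cat big_cons /=; lia.
Qed.

Variables (est : \bar R) (om : R).

Definition candidates x y :=
  forall lev a, lev < k -> a \in lst lev x -> a \in lst lev y ->
    (est <= (D lev x a + D lev y a)%:E)%E.

Lemma candidates_sym x y : candidates x y -> candidates y x.
Proof. by move=> h lev a lk ax ay; rewrite addrC; exact: h. Qed.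

(* The distance to a vertex of level [i] grows by at most [om] per level until
   a common list entry is found. *)
Lemma est_level r i x y a d : i + r = k.-1 -> candidates x y ->
  walk adjl x y om -> walk adjl x a d -> x < n -> A i a ->
  (est <= (2 * d + (2 * r%:R + 1) * om)%:E)%E.
Proof.
elim: r i x y a d => [|r IH] i x y a d ik cxy Wxy Wxa xn Aa.
all: have om0 := walk_ge0 U Wxy.
all: have an := walk_lt U Wxa xn; have yn := walk_lt U Wxy xn.
all: have ltik : i < k by lia.
  (* On the last level no list is full, so [a] is in both lists. *)
  have ei : i = k.-1 by lia.
  have [[ax le]|[]] := sd_good U (sd ltik) Wxa an Aa; last first.
    by rewrite {1}ei; have := last_level x; rewrite -ei; lia.
  have [[ay le']|[]] :=
      sd_good U (sd ltik) (walk_cat (walk_rev U Wxy) Wxa) an Aa; last first.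
    by have := last_level y; rewrite -ei; lia.
  by apply: le_trans (cxy _ _ ltik ax ay) _; rewrite lee_fin mulr0 add0r; lra.
have r0 := mulr_ge0 (ler0n R r.+1) om0.
have [[ax le]|[fx lx]] := sd_good U (sd ltik) Wxa an Aa; last first.
  (* A full list of [x] provides a member of the next level within the same distance [d]: a level is
     gained at no loss. *)
  have [|a' ax' Aa'] := hitting _ xn fx; first by lia.
  have [_ _ _ Wxa'] := sd_lst (sd ltik) ax'.
  apply: (le_trans (IH i.+1 x y a' _ _ cxy Wxy Wxa' xn Aa')); first by lia.
  by have := lx _ ax'; rewrite lee_fin -natr1; lra.
have [[ay le']|[fy ly]] := sd_good U (sd ltik) (walk_cat (walk_rev U Wxy) Wxa) an Aa.
  by apply: le_trans (cxy _ _ ltik ax ay) _; rewrite lee_fin; lra.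
(* Here [x] and [y] exchange roles: [a'] is within [om + d] of [y], and the additional [2 * om] is
   what one level allows. *)
have [|a' ay' Aa'] := hitting _ yn fy; first by lia.
have [_ _ _ Wya'] := sd_lst (sd ltik) ay'.
apply: (le_trans (IH i.+1 y x a' _ _ (candidates_sym cxy) (walk_rev U Wxy) Wya' yn Aa')).
  by lia.
by have := ly _ ay'; rewrite lee_fin -natr1; lra.
Qed.

Variables s t : nat.
Hypotheses (sn : s < n) (cst : candidates s t) (Wst : walk adjl s t om).
Hypothesis edge_candidates : forall u x w, u \in lst 0 s -> W 0 u < L0 ->
  (x, w) \in adjl u -> x \in lst 0 t -> (est <= (D 0 s u + w + D 0 t x)%:E)%E.

(* A level-1 vertex is used only within [om / 2] of [s] or [t]; hence the factor
   [2k - 2] instead of the [2k - 1] of Thorup and Zwick. *)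
Lemma est_le : (est <= ((2 * k%:R - 2) * om)%:E)%E.
Proof.
have om0 := walk_ge0 U Wst.
have tn := walk_lt U Wst sn.
have Wts := walk_rev U Wst.
have k0 : 0 < k by lia.
have kE : (k%:R = (k - 2)%:R + 2 :> R)%R by rewrite natrB // subrK.
have kr : (0 <= (k - 2)%:R :> R)%R by [].
have near x y a d : candidates x y -> walk adjl x y om -> x < n ->
    walk adjl x a d -> A 1 a -> (2 * d <= om)%R -> (est <= ((2 * k%:R - 2) * om)%:E)%E.
  move=> cxy Wxy xn Wxa Aa dle.
  (* With [k - 2] levels left and [2 * d <= om], the bound is [om + (2 * (k - 2) + 1) * om = (2 * k
     - 2) * om]. *)
  have e : 1 + (k - 2) = k.-1 by lia.
  apply: le_trans (est_level e cxy Wxy Wxa xn Aa) _.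
  by rewrite lee_fin kE; nra.
have nearf x y d : candidates x y -> walk adjl x y om -> x < n ->
    L0 <= wsum (W 0) (lst 0 x) -> (forall b, b \in lst 0 x -> (D 0 x b <= d)%R) ->
    (2 * d <= om)%R -> (est <= ((2 * k%:R - 2) * om)%:E)%E.
  move=> cxy Wxy xn fx lx dle.
  have [//|a ax Aa] := hitting _ xn fx.
  have [_ _ _ Wxa] := sd_lst (sd k0) ax.
  apply: (near _ _ _ _ cxy Wxy xn Wxa Aa).
  by have := lx _ ax; lra.
have [|[_ _ [-> le]]|[u [v [w1 [w [w2 [Wsu uv Wvt [le1 lt1 e1]]]]]]]] :=
  walk_mid U Wst (h := (om / 2)%R); first by lra.
  (* The whole walk has length at most [om / 2], so [om = 0]; unless a list is full, [t] itself is a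
     common entry. *)
  have [[ts le']|[fs ls]] := sd_good U (sd k0) Wst tn (A0 tn); last first.
    by apply: nearf cst Wst sn fs ls _; lra.
  have [[tt le'']|[ft lt_]] := sd_good U (sd k0) (walk_nil adjl t) tn (A0 tn); last first.
    by apply: nearf (candidates_sym cst) Wts tn ft lt_ _; lra.
  apply: le_trans (cst k0 ts tt) _; rewrite lee_fin kE; nra.
(* The edge from [u] to [v] straddles the midpoint, so [w1] and [w2] are both at most [om / 2]. *)
have un := walk_lt U Wsu sn; have [_ vn] := und_lt U uv.
have [[us leu]|[fs ls]] := sd_good U (sd k0) Wsu un (A0 un); last first.
  by apply: nearf cst Wst sn fs ls _; lra.
have [[vt lev]|[ft lt_]] := sd_good U (sd k0) (walk_rev U Wvt) vn (A0 vn); last first.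
  by apply: nearf (candidates_sym cst) Wts tn ft lt_ _; lra.
(* Edges at a heavy [u] are no candidates. But then [u] alone fills the list of [s] and is its last
   entry, so all entries, among them a member of level 1, are within [w1] of [s]. *)
have [light|heavy] := ltnP (W 0 u) L0; last first.
  apply: (nearf _ _ w1 cst Wst sn) => [|b bs|].
  - apply: leq_trans heavy _; rewrite /wsum (perm_big _ (perm_to_rem us)) big_cons.
    exact: leq_addr.
  - by apply: le_trans (heavy_last (sd_ord (sd k0) (v := s)) us bs heavy) leu.
  - lra.
apply: le_trans (edge_candidates us light uv vt) _.
by rewrite lee_fin kE; nra.
Qed.

End Query.

(** * Counting lists that are not yet hit *)

Section Hitting.
Variables (n : nat) (lst iv : nat -> seq nat) (W : nat -> nat) (L0 : nat).
Hypothesis lst_uniq : forall v, v < n -> uniq (lst v).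
Hypothesis iv_uniq : forall a, a < n -> uniq (iv a).
Hypothesis lst_lt : forall v a, v < n -> a \in lst v -> a < n.
Hypothesis iv_mem : forall v a, a < n -> (v \in iv a) = (v < n) && (a \in lst v).

Lemma count_iota_mem (P : pred nat) (l : seq nat) : uniq l ->
  {in l, forall x, x < n} -> count P l = count (fun x => P x && (x \in l)) (iota 0 n).
Proof.
move=> ul ln; rewrite -!size_filter; apply: perm_size; apply: uniq_perm.
- exact: filter_uniq.
- by rewrite filter_uniq ?iota_uniq.
move=> x; rewrite !mem_filter /= mem_iota /= add0n -andbA; congr andb.
by apply/idP/andP => [xl|[]//]; rewrite xl ln.
Qed.

Lemma double_count (P : pred nat) (f : nat -> nat) :
  \sum_(0 <= a < n) f a * count P (iv a) =
  \sum_(0 <= v < n | P v) \sum_(a <- lst v) f a.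
Proof.
transitivity (\sum_(0 <= a < n) \sum_(0 <= v < n | P v && (a \in lst v)) f a).
  apply: eq_big_nat => a /andP[_ an].
  rewrite (count_iota_mem _ (iv_uniq an)); last first.
    by move=> v; rewrite iv_mem // => /andP[].
  rewrite big_const_seq iter_addn_0; congr (_ * _); rewrite /index_iota subn0.
  apply: eq_in_count => v; rewrite mem_iota /= add0n => vn.
  by rewrite iv_mem // vn.
rewrite (exchange_big_dep_nat P) /=; last by move=> a v _ _ _ /andP[].
rewrite big_nat_cond [RHS]big_nat_cond; apply: eq_bigr => v /andP[/andP[_ vn] Pv].
rewrite -big_filter; apply: perm_big; apply: uniq_perm.
- by rewrite filter_uniq ?iota_uniq.
- exact: lst_uniq.
move=> a; rewrite mem_filter mem_index_iota /= Pv /=.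
by apply/andP/idP => [[]//|av]; split=> //; exact: lst_lt vn av.
Qed.

Variables (A : pred nat).
Hypothesis lst_A : forall v a, v < n -> a \in lst v -> A a.

Definition full v := L0 <= wsum W (lst v).
Definition unhit (H : pred nat) v := full v && ~~ H v.
Definition num_unhit H := count (unhit H) (iota 0 n).
Definition total := \sum_(0 <= a < n | A a) W a.

(** Averaging: an unhit full list weighs at least [L0], while a source [a] contributes its weight
    [W a] to at most [c] of these lists. *)
Lemma num_unhit_le H c : (forall a, a < n -> count (unhit H) (iv a) <= c) ->
  num_unhit H * L0 <= c * total.
Proof.
move=> hc; apply: (@leq_trans (\sum_(0 <= v < n | unhit H v) wsum W (lst v))).
  rewrite mulnC /num_unhit -iter_addn_0 -big_const_seq /index_iota subn0.
  by apply: leq_sum => v /andP[].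
rewrite -double_count /total big_distrr /= (big_mkcond A) /=.
rewrite big_nat_cond [leqRHS]big_nat_cond; apply: leq_sum => a /andP[/andP[_ an] _].
case: ifP => [_|/negbT nA]; first by rewrite mulnC leq_mul2r hc ?orbT.
rewrite leqn0 muln_eq0; apply/orP; right; rewrite -leqn0 leqNgt -has_count.
apply/hasPn => v; rewrite iv_mem // => /andP[vn av].
by rewrite (lst_A vn av) in nA.
Qed.

Lemma num_unhit_add (H H' : pred nat) a : a < n ->
  (forall v, v < n -> H' v = (v \in iv a) || H v) ->
  num_unhit H = num_unhit H' + count (unhit H) (iv a).
Proof.
move=> an HH; rewrite (count_iota_mem _ (iv_uniq an)); last first.
  by move=> v; rewrite iv_mem // => /andP[].
rewrite /num_unhit -count_predUI.
rewrite [X in _ + X](eq_in_count (a2 := pred0)); last first.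
  move=> v; rewrite mem_iota /= add0n => vn; rewrite /unhit HH //.
  by case: (v \in iv a); case: (H v); rewrite ?andbF.
rewrite count_pred0 addn0; apply: eq_in_count => v.
rewrite mem_iota /= add0n => vn; rewrite /unhit HH //.
by case: (full v); case: (v \in iv a); case: (H v).
Qed.

Lemma sum_size_iv : \sum_(0 <= a < n) size (iv a) = \sum_(0 <= v < n) size (lst v).
Proof.
transitivity (\sum_(0 <= a < n) 1 * count predT (iv a)).
  by apply: eq_bigr => a _; rewrite count_predT mul1n.
by rewrite double_count; apply: eq_bigr => v _; rewrite sum1_size.
Qed.

End Hitting.

Arguments upd T f a i v a' i' /.

Section Commands.
Variable R : realType.

Lemma twp_sput cap c (s : memory R) a e1 e2 T (Q : memory R -> Prop) :
  ieval s e2 <= cap -> 2 <= T ->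
  twp cap c (wput s a (ieval s e1) (ieval s e2)) (T - 2) Q ->
  twp cap (Seq (Put a e1 e2) c) s T Q.
Proof.
by move=> h T2 q; apply: (@twp_seq _ _ _ _ _ 1 (T - 2)); [exact: twp_put|lia].
Qed.

Lemma twp_srput cap c (s : memory R) a e x T (Q : memory R -> Prop) :
  2 <= T -> twp cap c (rput s a (ieval s e) (ireval s x)) (T - 2) Q ->
  twp cap (Seq (RPut a e x) c) s T Q.
Proof.
by move=> T2 q; apply: (@twp_seq _ _ _ _ _ 1 (T - 2)); [exact: twp_rput|lia].
Qed.

Lemma twp_cond cap b c1 c2 (s : memory R) T (Q : memory R -> Prop) : 0 < T ->
  (ibeval s b -> twp cap c1 s T.-1 Q) -> (~~ ibeval s b -> twp cap c2 s T.-1 Q) ->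
  twp cap (If b c1 c2) s T Q.
Proof. by case: T => //= T _; exact: twp_if. Qed.

Lemma twp_mono cap c (s : memory R) T T' (Q : memory R -> Prop) :
  twp cap c s T Q -> T <= T' -> twp cap c s T' Q.
Proof. by move=> h le; apply: twp_wk h le _. Qed.

End Commands.

(** * The program *)

(* Names of the word arrays (x) and weight arrays (y); a scalar is cell 0.  The
   arrays 0 to 4 and [yEW], [yEST] are fixed by the input convention.
   [xDEG], [xADJ], [yAW]: adjacency lists; [xTOP], [xIV], [xIA], [yT]: priority
   queue; [xCNT], [xLST], [xMRK], [xBUD], [yDIST]: length, entries, membership
   table, total weight and distances of the list of a row; [xICNT], [xINV]: the
   inverse lists; [xINA], [xHIT]: members of a level and hit lists. *)
Notation Var a := (Get a (Cst 0)).

Notation xHDR := 0 (only parsing).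
Notation xE1 := 1 (only parsing).
Notation xE2 := 2 (only parsing).
Notation xQ1 := 3 (only parsing).
Notation xQ2 := 4 (only parsing).
Notation xDEG := 5 (only parsing).
Notation xADJ := 6 (only parsing).
Notation xRHO := 7 (only parsing).
Notation xLAM := 8 (only parsing).
Notation xDEL := 9 (only parsing).
Notation xL := 10 (only parsing).
Notation xL0 := 11 (only parsing).
Notation xN := 12 (only parsing).
Notation xLEV := 13 (only parsing).
Notation xBASE := 14 (only parsing).
Notation xTOP := 15 (only parsing).
Notation xJ := 16 (only parsing).
Notation xIV := 17 (only parsing).
Notation xIA := 18 (only parsing).
Notation xPX := 19 (only parsing).
Notation xPA := 20 (only parsing).
Notation xE := 21 (only parsing).
Notation xV := 22 (only parsing).
Notation xROW := 23 (only parsing).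
Notation xCNT := 24 (only parsing).
Notation xLST := 25 (only parsing).
Notation xMRK := 26 (only parsing).
Notation xBUD := 27 (only parsing).
Notation xICNT := 28 (only parsing).
Notation xINV := 29 (only parsing).
Notation xINA := 30 (only parsing).
Notation xHIT := 31 (only parsing).
Notation xTH := 32 (only parsing).
Notation xC := 33 (only parsing).
Notation xI := 34 (only parsing).
Notation yEW := 0 (only parsing).
Notation yEST := 1 (only parsing).
Notation yAW := 2 (only parsing).
Notation yT := 3 (only parsing).
Notation yPK := 4 (only parsing).
Notation yD := 5 (only parsing).
Notation yDIST := 6 (only parsing).

(** * A tournament tree as priority queue *)

Section Tree.
Variable R : realType.
Implicit Types (T : nat -> \bar R) (s : memory R).

Definition min2 T i := if (T (i + i)%N <= T (i + i).+1%N)%E then T (i + i) else T (i + i).+1.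

(** The proper ancestors of [j] in the numbering where node [i] has children [i + i] and
    [(i + i).+1]. *)
Definition anc j i := exists h, i = j %/ 2 ^ h.+1.

(** Nodes [1] to [N - 1] are inner, nodes [N] to [N + N - 1] are leaves; [N] need not be a power of
    2. *)
Definition heap N T := forall i, 0 < i < N -> T i = min2 T i.

(** The state after a change at [j]: only its ancestors may be out of date. *)
Definition heap_but N j T := forall i, 0 < i < N -> T i = min2 T i \/ anc j i.

Lemma min2_le T i : (min2 T i <= T (i + i)%N)%E /\ (min2 T i <= T (i + i).+1%N)%E.
Proof.
rewrite /min2; case: ifP => [h|/negbT]; first by split.
by rewrite -ltNge => /ltW h; split.
Qed.

Lemma heap_root N T j : heap N T -> 0 < j < N + N -> (T 1%N <= T j)%E.
Proof.
move=> hT; elim/ltn_ind: j => j IH /andP[j0 jN].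
have [->//|j1] := eqVneq j 1.
have lt1 : j %/ 2 < j by lia.
have lt2 : 0 < j %/ 2 < N + N by lia.
apply: le_trans (IH _ lt1 lt2) _.
rewrite hT; last by lia.
have [h1 h2] := min2_le T (j %/ 2).
have [e|e] : j = j %/ 2 + j %/ 2 \/ j = (j %/ 2 + j %/ 2).+1 by lia.
  by rewrite [leRHS](_ : _ = T (j %/ 2 + j %/ 2)) // -e.
by rewrite [leRHS](_ : _ = T (j %/ 2 + j %/ 2).+1) // -e.
Qed.

Lemma trunc_log2_lt x H : 0 < x -> x < 2 ^ H -> trunc_log 2 x < H.
Proof.
move=> x0 xH; rewrite -(ltn_exp2l _ _ (isT : 1 < 2)).
exact: leq_ltn_trans (trunc_logP _ x0) xH.
Qed.

Definition fix_up :=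
  While (Leq (Cst 2) (Var xJ))
    (Seq (Put xJ (Cst 0) (Div (Var xJ) (Cst 2)))
      (If (RLeq (RGet yT (Add (Var xJ) (Var xJ)))
                (RGet yT (Add (Add (Var xJ) (Var xJ)) (Cst 1))))
        (RPut yT (Var xJ) (RGet yT (Add (Var xJ) (Var xJ))))
        (RPut yT (Var xJ) (RGet yT (Add (Add (Var xJ) (Var xJ)) (Cst 1)))))).

Lemma fix_up_spec cap N H s : N + N <= cap -> N + N <= 2 ^ H ->
  0 < words s xJ 0 < N + N -> heap_but N (words s xJ 0) (weights s yT) ->
  twp cap fix_up s (5 * H).+1 (fun s' => heap N (weights s' yT) /\
    forall i, N <= i -> weights s' yT i = weights s yT i).
Proof.
move=> Ncap NH j0 h0.
(* The potential is proportional to the depth [trunc_log 2] of the current node, which drops by one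
   when the node is halved. *)
apply: (twp_while (I := fun s' => [/\ 0 < words s' xJ 0 < N + N,
    heap_but N (words s' xJ 0) (weights s' yT) &
    forall i, N <= i -> weights s' yT i = weights s yT i])
  (Phi := fun s' => 5 * trunc_log 2 (words s' xJ 0))) => //.
- move=> s1 [/andP[j1 jN] hb out] _ /= j2; exists 4; apply: twp_sput => //=.
    by lia.
  set s2 := wput _ _ _ _.
  have lgE : trunc_log 2 (words s1 xJ 0) = (trunc_log 2 (words s1 xJ 0 %/ 2)).+1.
    by rewrite trunc_log2S // divn2.
  set j := words s1 xJ 0 in j1 jN hb j2 s2 lgE *.
  have fin : forall v, v = min2 (weights s1 yT) (j %/ 2) ->
    let s3 := rput s2 yT (j %/ 2) v in
    [/\ 0 < words s3 xJ 0 < N + N, heap_but N (words s3 xJ 0) (weights s3 yT) &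
       forall i, N <= i -> weights s3 yT i = weights s yT i] /\
    4 + 5 * trunc_log 2 (words s3 xJ 0) < 5 * trunc_log 2 j.
    move=> v vE s3; rewrite /s3 /= /upd /=; split; last by rewrite lgE; lia.
    split; first by lia.
      move=> i iN; have [->|ij] := eqVneq i (j %/ 2).
        left; rewrite vE /min2.
        have /negbTE-> : j %/ 2 + j %/ 2 != j %/ 2 by lia.
        by have /negbTE-> : (j %/ 2 + j %/ 2).+1 != j %/ 2 by lia.
      have [e|[h e]] := hb i iN.
        have [e2|e2] : i = (j %/ 2) %/ 2 \/ i != (j %/ 2) %/ 2 by lia.
          by right; exists 0; rewrite expn1.
        left; rewrite e /min2.
        have /negbTE-> : i + i != j %/ 2 by lia.
        by have /negbTE-> : (i + i).+1 != j %/ 2 by lia.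
      right; case: h e => [|h] e; first by rewrite e expn1 eqxx in ij.
      by exists h; rewrite e expnS divnMA.
    move=> i Ni; have /negbTE-> : i != j %/ 2 by lia.
    exact: out.
  apply: twp_if => /= b; apply: twp_rput => //=; apply: fin.
    by rewrite addn1 in b; rewrite /min2 b.
  by rewrite addn1 in b *; rewrite /min2 (negbTE b).
- have : trunc_log 2 (words s xJ 0) < H by apply: trunc_log2_lt; lia.
  by lia.
- move=> s1 [j1 hb out] _ /= j2; split=> // i iN.
  have [//|[h e]] := hb i iN.
  have e1 : words s1 xJ 0 = 1 by lia.
  by move: e iN; rewrite e1 divn_small ?ltn_exp2l //; [lia|rewrite -{1}(exp1n h.+1) ltn_exp2r].
Qed.

Definition find_min :=
  Seq (Put xJ (Cst 0) (Cst 1))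
    (While (Leq (Add (Var xJ) (Cst 1)) (Var xN))
      (If (RLeq (RGet yT (Add (Var xJ) (Var xJ)))
                (RGet yT (Add (Add (Var xJ) (Var xJ)) (Cst 1))))
        (Put xJ (Cst 0) (Add (Var xJ) (Var xJ)))
        (Put xJ (Cst 0) (Add (Add (Var xJ) (Var xJ)) (Cst 1))))).

Lemma find_min_spec cap N H s : N + N <= cap -> N + N <= 2 ^ H -> 0 < N ->
  words s xN 0 = N -> heap N (weights s yT) ->
  twp cap find_min s (3 * H + 3) (fun s' =>
    N <= words s' xJ 0 < N + N /\
    weights s yT (words s' xJ 0) = weights s yT 1).
Proof.
move=> Ncap NH N0 sN hp.
have lgH x : 0 < x < N + N -> trunc_log 2 x < H.
  by move=> x0; apply: trunc_log2_lt; lia.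
apply: (@twp_seq _ _ _ _ _ 1 (3 * H).+1); last by lia.
apply: twp_put => //=; first by lia.
set s1 := wput _ _ _ _.
apply: (twp_while (I := fun s' => 0 < words s' xJ 0 < N + N /\
    weights s yT (words s' xJ 0) = weights s yT 1)
  (Phi := fun s' => 3 * (H - trunc_log 2 (words s' xJ 0)))).
- move=> s2 [j0 e] A; rewrite /= (A.1 12) //= sN => lt; exists 2.
  set j := words s2 xJ 0 in j0 e lt *.
  have lgE b : trunc_log 2 (j + j + b %% 2) = (trunc_log 2 j).+1.
    by rewrite trunc_log2S; [congr (trunc_log _ _).+1; rewrite -divn2; lia|lia].
  have lgj := lgH _ j0.
  have hj : 0 < j < N by lia.
  apply: twp_if => /= b; apply: twp_put => //=; rewrite -/j in b *; try by lia.
    have := lgE 0; rewrite mod0n addn0 => ->; split; last by lia.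
    split; first by lia.
    by rewrite -e [RHS]hp // /min2; move: b; rewrite addn1 !A.2 // => ->.
  have := lgE 1; rewrite modn_small // => ->; split; last by lia.
  split; first by lia.
  by rewrite -e [RHS]hp // /min2; move: b; rewrite addn1 !A.2 // => /negbTE->.
- by split=> //=; lia.
- by rewrite /=; lia.
- move=> s2 [j0 e] A; rewrite /= (A.1 12) //= sN => h; split=> //; lia.
Qed.

Definition push :=
  Seq (Put xJ (Cst 0) (Add (Var xN) (Var xTOP)))
  (Seq (Put xTOP (Cst 0) (Add (Var xTOP) (Cst 1)))
  (Seq (Put xIV (Var xJ) (Var xPX))
  (Seq (Put xIA (Var xJ) (Var xPA))
  (Seq (RPut yT (Var xJ) (RGet yPK (Cst 0)))
   fix_up)))).

(* Leaves of the tree are allocated from left to right and never reused; a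
   leaf of weight [+oo] is free or has been popped. *)
Record tree_ok N s top : Prop := TreeOk {
  tree_heap : heap N (weights s yT);
  tree_top : words s xTOP 0 = top;
  tree_free : forall i, N + top <= i < N + N -> weights s yT i = +oo%E;
  tree_real : forall i, N <= i < N + N -> weights s yT i <> -oo%E }.

Definition queued N s v a (d : R) := exists2 i, N <= i < N + N &
  [/\ words s xIV i = v, words s xIA i = a & weights s yT i = d%:E].

Definition num_queued N s := \sum_(N <= i < N + N) (weights s yT i != +oo%E : nat).

Lemma heap_but_upd N T j v : 0 < j -> N <= j -> heap N T ->
  heap_but N j (fun i => if i == j then v else T i).
Proof.
move=> j0 Nj hT i iN.
have /negbTE-> : i != j by lia.
have [e|ne] := eqVneq i (j %/ 2); first by right; exists 0; rewrite expn1.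
left; rewrite hT // /min2.
have /negbTE-> : i + i != j by lia.
by have /negbTE-> : (i + i).+1 != j by lia.
Qed.

(** Changing one term of a sum, written with additions on both sides to avoid truncated
    subtraction. *)
Lemma sum_upd1 (f g : nat -> nat) a b j : a <= j < b ->
  (forall i, a <= i < b -> i != j -> f i = g i) ->
  \sum_(a <= i < b) f i + g j = \sum_(a <= i < b) g i + f j.
Proof.
move=> /andP[aj jb] fg.
have sp h : \sum_(a <= i < b) h i =
    \sum_(a <= i < j) h i + (h j + \sum_(j.+1 <= i < b) h i).
  by rewrite (big_cat_nat (n := j)) //= 1?ltnW //; congr (_ + _); rewrite big_ltn.
rewrite !sp.
have -> : \sum_(a <= i < j) f i = \sum_(a <= i < j) g i.
  by apply: eq_big_nat => i ij; apply: fg; lia.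
have -> : \sum_(j.+1 <= i < b) f i = \sum_(j.+1 <= i < b) g i.
  by apply: eq_big_nat => i ij; apply: fg; lia.
lia.
Qed.

Lemma push_spec cap N H s top (d : R) : N + N <= cap -> N + N <= 2 ^ H ->
  words s xN 0 = N -> tree_ok N s top -> top < N -> weights s yPK 0 = d%:E ->
  words s xPX 0 <= cap -> words s xPA 0 <= cap ->
  twp cap push s (5 * H + 11) (fun s' => [/\ tree_ok N s' top.+1,
    num_queued N s' = (num_queued N s).+1 &
    forall v a k, queued N s' v a k <->
      queued N s v a k \/ [/\ v = words s xPX 0, a = words s xPA 0 & k = d]]).
Proof.
move=> Ncap NH sN [hp tp fr re] tN pk cx ca.
apply: twp_sput => /=; [by rewrite sN tp; lia|by lia|].
apply: twp_sput => /=; [by rewrite tp; lia|by lia|].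
apply: twp_sput => //=; first by lia.
apply: twp_sput => //=; first by lia.
apply: twp_srput => /=; first by lia.
rewrite sN tp addn1.
set s1 := rput _ _ _ _; set j := N + top in s1 *.
apply: (twp_wk (fix_up_spec Ncap NH _ _)); first by rewrite /=; lia.
- by apply: heap_but_upd => //=; lia.
- by lia.
move=> s' A [hp' out].
have sT i : N <= i -> weights s' yT i = if i == j then d%:E else weights s yT i.
  by move=> Ni; rewrite out //= pk.
have sV i : words s' xIV i = if i == j then words s xPX 0 else words s xIV i.
  by rewrite A.1.
have sA i : words s' xIA i = if i == j then words s xPA 0 else words s xIA i.
  by rewrite A.1.
have jN : N <= j < N + N by lia.
split.
- split=> //; first by rewrite A.1.
  + move=> i iN; rewrite sT; last by lia.
    have /negbTE-> : i != j by lia.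
    by rewrite fr //; lia.
  + move=> i iN; rewrite sT; last by lia.
    by case: ifP => // _; exact: re.
- have := @sum_upd1 (fun i => weights s' yT i != +oo%E : nat)
    (fun i => weights s yT i != +oo%E : nat) N (N + N) j jN.
  rewrite sT ?eqxx /=; last by lia.
  rewrite fr /=; last by lia.
  rewrite addn0 addn1; apply=> i iN /negbTE ne.
  by rewrite sT ?ne; last by lia.
move=> v a k; split.
  move=> [i iN]; rewrite sV sA sT; last by lia.
  have [ij|ij] := eqVneq i j; last by left; exists i.
  by move=> [<- <- [<-]]; right.
case=> [[i iN [h1 h2 h3]]|[-> -> ->]].
  have ij : i != j by apply/eqP => e; rewrite fr // in h3; lia.
  by exists i => //; rewrite sV sA sT ?(negbTE ij) //; lia.
by exists j => //; rewrite sV sA sT ?eqxx //; lia.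
Qed.

Definition pop :=
  Seq find_min
  (Seq (RPut yD (Cst 0) (RGet yT (Var xJ)))
  (Seq (Put xV (Cst 0) (Get xIV (Var xJ)))
  (Seq (Put xPA (Cst 0) (Get xIA (Var xJ)))
  (Seq (RPut yT (Var xJ) RInfty) fix_up)))).

Lemma pop_spec cap N H s top : N + N <= cap -> N + N <= 2 ^ H -> 0 < N ->
  bounded cap s -> words s xN 0 = N -> tree_ok N s top -> top <= N ->
  weights s yT 1 != +oo%E ->
  twp cap pop s (8 * H + 14) (fun s' => exists d, [/\ tree_ok N s' top,
    num_queued N s = (num_queued N s').+1,
    weights s' yD 0 = d%:E /\ queued N s (words s' xV 0) (words s' xPA 0) d,
    forall v a k, queued N s v a k -> (d <= k)%R &
    (forall v a k, queued N s' v a k -> queued N s v a k) /\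
    (forall v a k, queued N s v a k -> queued N s' v a k \/
       [/\ v = words s' xV 0, a = words s' xPA 0 & k = d])]).
Proof.
move=> Ncap NH N0 bs sN [hp tp fr re] tN T1.
apply: (@twp_seq _ _ _ _ _ (3 * H + 3) (5 * H + 9)); last by lia.
apply: (twp_wk (find_min_spec Ncap NH N0 sN hp)) => // s1 A1 [jN eT1].
apply: twp_srput => /=; first by lia.
apply: twp_sput => /=; [by rewrite A1.1|by lia|].
apply: twp_sput => /=; [by rewrite A1.1|by lia|].
apply: twp_srput => /=; first by lia.
set j := words s1 xJ 0 in jN eT1 *.
have [d dE] : exists d : R, weights s yT j = d%:E.
  move: (re j jN) T1; rewrite -eT1; case: (weights s yT j) => [d| |] // _ _.
  by exists d.
set s2 := rput _ _ _ _.
apply: (twp_wk (fix_up_spec Ncap NH _ _)); first by rewrite /= -/j; lia.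
- apply: heap_but_upd => //=; [by rewrite -/j; lia|by rewrite -/j; lia|].
  by move=> i iN; rewrite /min2 /= !A1.2 //; exact: hp.
- by lia.
move=> s' A [hp' out]; exists d.
have sT i : N <= i -> weights s' yT i = if i == j then +oo%E else weights s yT i.
  by move=> Ni; rewrite out //= -/j A1.2.
have sV i : words s' xIV i = words s xIV i by rewrite A.1 //= A1.1.
have sA i : words s' xIA i = words s xIA i by rewrite A.1 //= A1.1.
have sv : words s' xV 0 = words s xIV j by rewrite A.1 //= A1.1.
have sa : words s' xPA 0 = words s xIA j by rewrite A.1 //= A1.1.
split.
- split=> //; first by rewrite A.1 //= A1.1.
  + by move=> i iN; rewrite sT; [case: ifP => // _; exact: fr|lia].
  + by move=> i iN; rewrite sT; [case: ifP => // _; exact: re|lia].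
- have := @sum_upd1 (fun i => weights s yT i != +oo%E : nat)
    (fun i => weights s' yT i != +oo%E : nat) N (N + N) j jN.
  rewrite sT ?eqxx /=; last by lia.
  rewrite dE /= addn0 addn1; apply=> i iN /negbTE ne.
  by rewrite sT ?ne //; lia.
- by rewrite A.2 //= A1.2 // -/j dE sv sa; split=> //; exists j.
- move=> v a k [i iN [_ _ e]]; rewrite -lee_fin -dE -e eT1.
  by apply: heap_root hp _; lia.
split=> v a k [i iN]; rewrite ?sV ?sA ?sv ?sa.
  rewrite sT; last by lia.
  by case: ifP => [_ [_ _]|_ h] //; exists i.
move=> [h1 h2 h3]; have [ij|ij] := eqVneq i j.
  by right; rewrite -h1 -h2 ij; split=> //; move: h3; rewrite ij dE => -[->].
by left; exists i => //; rewrite sV sA sT ?(negbTE ij) //; lia.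
Qed.

Definition init_tree :=
  Seq (For xI (Add (Var xN) (Var xN)) (RPut yT (Var xI) RInfty)) (Put xTOP (Cst 0) (Cst 0)).

Lemma init_tree_spec cap N s : N + N <= cap -> words s xN 0 = N ->
  twp cap init_tree s (8 * N + 10) (fun s' => [/\ tree_ok N s' 0,
    num_queued N s' = 0 & forall v a k, ~ queued N s' v a k]).
Proof.
move=> Ncap sN; apply: (@twp_seq _ _ _ _ _ (8 * N + 3) 1); last by lia.
apply: (twp_for (N := N + N) (B := fun=> 1)
  (I := fun i s' => forall j, j < i -> weights s' yT j = +oo%E)) => //.
- by move=> s1 A /=; rewrite !A.1 // sN.
- move=> i s1 iN si A IH; apply: twp_rput => //= j; rewrite si ltnS leq_eqVlt.
  by case: eqP => //= _; exact: IH.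
- by rewrite sum_nat_const_nat; lia.
move=> s1 A _ fr; apply: twp_put => //=; split.
- split=> //=.
  + by move=> i iN; rewrite /min2 !fr ?if_same //; lia.
  + by move=> i iN; rewrite fr //; lia.
  + by move=> i iN; rewrite fr //; lia.
- rewrite /num_queued big_nat_cond big1 // => i /andP[/andP[_ iN] _] /=.
  by rewrite fr ?eqxx.
- by move=> v a k [i iN [_ _ /=]]; rewrite fr //; lia.
Qed.

End Tree.

(** * Memory layout of the lists and their inverses *)

Section Rows.
Variables (R : realType) (n : nat) (W : nat -> nat -> nat).
Implicit Types s : memory R.

(* Row [lev * n + v] belongs to vertex [v] at level [lev]. *)
Record rows := Rows {
  rlst : nat -> seq nat;
  rdist : nat -> nat -> R;
  rinv : nat -> seq nat }.

Record row_ok s (g : rows) r : Prop := RowOk {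
  row_cnt : words s xCNT r = size (rlst g r);
  row_lst : forall j, j < size (rlst g r) -> words s xLST (r * n + j) = nth 0 (rlst g r) j;
  row_mrk : forall a, a < n -> words s xMRK (r * n + a) = (a \in rlst g r);
  row_bud : words s xBUD r = wsum (W (r %/ n)) (rlst g r);
  row_dist : forall a, a \in rlst g r -> weights s yDIST (r * n + a) = (rdist g r a)%:E;
  row_icnt : words s xICNT r = size (rinv g r);
  row_inv : forall j, j < size (rinv g r) -> words s xINV (r * n + j) = nth 0 (rinv g r) j }.

(** Every row owns [n] cells; these bounds keep the cells [r * n + j] of distinct rows apart. *)
Definition rows_small (g : rows) := forall r,
  [/\ size (rlst g r) <= n, size (rinv g r) <= n & forall a, a \in rlst g r -> a < n].

Definition rep s g := rows_small g /\ forall r, row_ok s g r.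

Lemma rep_agree ws rs s s' g : agree ws rs s s' ->
  all (fun a => a \notin ws) [:: xCNT; xLST; xMRK; xBUD; xICNT; xINV] && (yDIST \notin rs) ->
  rep s g -> rep s' g.
Proof.
move=> [A B] /= /andP[/and5P[a1 a2 a3 a4 /and3P[a5 a6 _]] b1] [sm h]; split=> // r.
case: (h r) => h1 h2 h3 h4 h5 h6 h7.
by split=> *; rewrite ?(A _ _ a1, A _ _ a2, A _ _ a3, A _ _ a4, A _ _ a5, A _ _ a6, B _ _ b1) //;
  [exact: h2|exact: h3|exact: h5|exact: h7].
Qed.

Definition settle_row (g : rows) r ra v a (d : R) :=
  Rows (ins (rlst g) r a) (insD (rdist g) r a d) (ins (rinv g) ra v).

(** The truncated difference [1 - lev] is the indicator of level 0, which saves a branch. *)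
Definition row_weight := Add (Var xDEL) (Mul (Get xDEG (Var xPA)) (Defs.Sub (Cst 1) (Var xLEV))).

Definition cell (row col : wexp) := Add (Mul row (Var xHDR)) col.

Definition settle :=
  Seq (Put xMRK (cell (Var xROW) (Var xPA)) (Cst 1))
  (Seq (RPut yDIST (cell (Var xROW) (Var xPA)) (RGet yD (Cst 0)))
  (Seq (Put xLST (cell (Var xROW) (Get xCNT (Var xROW))) (Var xPA))
  (Seq (Put xCNT (Var xROW) (Add (Get xCNT (Var xROW)) (Cst 1)))
  (Seq (Put xBUD (Var xROW) (Add (Get xBUD (Var xROW)) row_weight))
  (Seq (Put xINV (cell (Add (Var xBASE) (Var xPA))
      (Get xICNT (Add (Var xBASE) (Var xPA)))) (Var xV))
   (Put xICNT (Add (Var xBASE) (Var xPA))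
      (Add (Get xICNT (Add (Var xBASE) (Var xPA))) (Cst 1)))))))).

Lemma cell_eq r r' a b : a < n -> b < n -> (r * n + a == r' * n + b) = (r == r') && (a == b).
Proof.
move=> an bn; apply/eqP/andP => [e|[/eqP-> /eqP->]//].
have n0 : 0 < n by lia.
have := congr1 (divn^~ n) e; rewrite !divnMDl // !divn_small // !addn0 => ->.
by have := congr1 (modn^~ n) e; rewrite !modnMDl !modn_small // => ->.
Qed.

Lemma settle_spec cap s g lev v a (d : R) : rep s g ->
  words s xHDR 0 = n -> words s xBASE 0 = lev * n -> words s xV 0 = v ->
  words s xROW 0 = lev * n + v -> words s xPA 0 = a -> weights s yD 0 = d%:E ->
  words s xDEL 0 + words s xDEG a * (1 - words s xLEV 0) = W lev a ->
  v < n -> a < n -> a \notin rlst g (lev * n + v) ->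
  size (rlst g (lev * n + v)) < n -> size (rinv g (lev * n + a)) < n ->
  n <= cap -> wsum (W lev) (rlst g (lev * n + v)) + W lev a <= cap ->
  twp cap settle s 14 (fun s' =>
    rep s' (settle_row g (lev * n + v) (lev * n + a) v a d)).
Proof.
move=> [sm h] sn sb sv sr sa sd sw vn an al szl szi ncap wcap.
have dv : (lev * n + v) %/ n = lev by rewrite divnMDl ?divn_small ?addn0 //; lia.
set r := lev * n + v in sr al szl wcap dv *; set ra := lev * n + a in szi *.
have hr := h r; have hra := h ra.
apply: twp_sput => //=; first by lia.
apply: twp_srput => //=.
apply: twp_sput => //=; first by rewrite sa; lia.
apply: twp_sput => //=; first by rewrite sr (row_cnt hr); lia.
apply: twp_sput => //=; first by rewrite sr (row_bud hr) sa sw dv.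
apply: twp_sput => //=; first by rewrite sv; lia.
apply: twp_put => //=; first by rewrite sb sa -/ra (row_icnt hra); lia.
rewrite sr sa sn sb sv sd -/ra (row_cnt hr) (row_bud hr) (row_icnt hra) sw dv !addn1.
split.
  move=> x; have [s1 s2 s3] := sm x; rewrite /settle_row /ins /=; split.
  - by case: eqP => // _; rewrite size_rcons.
  - by case: eqP => // _; rewrite size_rcons.
  - move=> b; case: eqP => [_|_ /s3//]; rewrite mem_rcons inE => /orP[/eqP->//|].
    by have [_ _] := sm r; exact.
move=> x; have [s1 s2 s3] := sm x; case: (h x) => h1 h2 h3 h4 h5 h6 h7.
split; rewrite /settle_row /ins /insD /=.
- by case: eqP => // _; rewrite size_rcons.
- move=> j; case: eqP => [->|xr] jl.
    rewrite size_rcons ltnS in jl.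
    rewrite nth_rcons eqn_add2l; case: (ltngtP j (size (rlst g r))) jl => // jl _.
    exact: row_lst.
  rewrite cell_eq; [|by lia|by lia].
  by case: (x =P r) => //= _; exact: h2.
- move=> b bn; rewrite cell_eq //; case: eqP => [->|_] /=; last exact: h3.
  by rewrite mem_rcons inE; case: eqP => //= _; exact: row_mrk.
- by case: eqP => // ->; rewrite wsum_rcons dv.
- move=> b; case: eqP => [->|xr] bl.
    rewrite eqn_add2l; case: eqP => //= ba; apply: row_dist => //.
    by move: bl; rewrite mem_rcons inE => /orP[/eqP|].
  have -> : (x * n + b == r * n + a) = false.
    by rewrite cell_eq ?(s3 _ bl) //; case: (x =P r).
  exact: h5.
- by case: eqP => // _; rewrite size_rcons.
- move=> j; case: eqP => [->|xr] jl.
    rewrite size_rcons ltnS in jl.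
    rewrite nth_rcons eqn_add2l; case: (ltngtP j (size (rinv g ra))) jl => // jl _.
    exact: row_inv.
  rewrite cell_eq; [|by lia|by lia].
  by case: (x =P ra) => //= _; exact: h7.
Qed.

End Rows.

(** * Parameters, relaxation of arcs and initial sources *)

Section Levels.
Variables (R : realType) (n m k L N H cap del : nat) (adjl : nat -> seq (nat * R)).
Implicit Types (s : memory R) (g : rows R).

(* Charging its degree to every settled vertex at level 0 bounds the time
   needed to scan the arcs that leave a list. *)
Definition src_weight lev a := del + size (adjl a) * (1 - lev).

(** [N] exceeds the number of insertions in one search: at most [n] sources, and for every arc at
    most one insertion per list entry of its origin, of which there are at most [L]. So the leaves
    of the tree suffice without reuse, and [H] bounds its height. [par_capW] leaves room for a list
    whose last entry, of weight at most [del + (m + m)], exceeds the budget. *)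
Record params : Prop := Params {
  par_und : undirected adjl n;
  par_n : 0 < n;
  par_del : 0 < del;
  par_arcs : \sum_(0 <= v < n) size (adjl v) = m + m;
  par_N : N = (n + (m + m) * L).+1;
  par_H : N + N <= 2 ^ H;
  par_capN : N + N <= cap;
  par_capW : del * L + (del + (m + m)) <= cap;
  par_capk : k.+1 * n <= cap }.

Record env s : Prop := Env {
  env_n : words s xHDR 0 = n;
  env_m : words s xHDR 1 = m;
  env_deg : forall v, v < n -> words s xDEG v = size (adjl v);
  env_adj : forall v j, v < n -> j < size (adjl v) ->
    words s xADJ (v * (m + m) + j) = (nth (0, 0%R) (adjl v) j).1;
  env_aw : forall v j, v < n -> j < size (adjl v) ->
    weights s yAW (v * (m + m) + j) = (nth (0, 0%R) (adjl v) j).2%:E;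
  env_del : words s xDEL 0 = del;
  env_L0 : words s xL0 0 = del * L;
  env_N : words s xN 0 = N }.

Lemma env_agree ws rs s s' : agree ws rs s s' ->
  all (fun a => a \notin ws) [:: xHDR; xDEG; xADJ; xDEL; xL0; xN] && (yAW \notin rs) ->
  env s -> env s'.
Proof.
move=> [A B] /= /andP[/and5P[a1 a2 a3 a4 /and3P[a5 a6 _]] b1] [h1 h2 h3 h4 h5 h6 h7 h8].
by split=> *; rewrite ?(A _ _ a1, A _ _ a2, A _ _ a3, A _ _ a4, A _ _ a5, A _ _ a6, B _ _ b1) //;
  [exact: h3|exact: h4|exact: h5].
Qed.

Hypothesis P : params.

Lemma deg_le v : v < n -> size (adjl v) <= m + m.
Proof.
by move=> vn; rewrite -(par_arcs P) (bigD1_seq v) ?mem_index_iota ?iota_uniq //= leq_addr.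
Qed.

Lemma par_cap_n : n <= cap.
Proof. by apply: leq_trans (par_capk P); rewrite leq_pmull. Qed.

Definition arc_cell (row col : wexp) :=
  Add (Mul row (Add (Get xHDR (Cst 1)) (Get xHDR (Cst 1)))) col.

Definition expand :=
  For xE (Get xDEG (Var xV))
    (Seq (Put xPX (Cst 0) (Get xADJ (arc_cell (Var xV) (Var xE))))
    (Seq (RPut yPK (Cst 0) (RAdd (RGet yD (Cst 0)) (RGet yAW (arc_cell (Var xV) (Var xE)))))
     push)).

Lemma expand_spec s top v a (d : R) : env s -> tree_ok N s top ->
  top + size (adjl v) <= N -> words s xV 0 = v -> words s xPA 0 = a ->
  weights s yD 0 = d%:E -> v < n -> a < n ->
  twp cap expand s ((5 * H + 18) * size (adjl v) + 3) (fun s' =>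
    [/\ tree_ok N s' (top + size (adjl v)),
      num_queued N s' = num_queued N s + size (adjl v) &
      forall x b e, queued N s' x b e <-> queued N s x b e \/
        b = a /\ exists2 w, (x, w) \in adjl v & e = (d + w)%R]).
Proof.
move=> E tr tN sv sa sd vn an.
have degc := deg_le vn; have capW := par_capW P.
apply: (twp_for (N := size (adjl v)) (B := fun=> 5 * H + 15)
  (I := fun i s' => [/\ tree_ok N s' (top + i),
      num_queued N s' = num_queued N s + i &
      forall x b e, queued N s' x b e <-> queued N s x b e \/
        b = a /\ exists2 w, (x, w) \in take i (adjl v) & e = (d + w)%R])).
- by [].
- by lia.
- by move=> s1 A /=; rewrite !A.1 // sv (env_deg E).
- by move=> i s1 x _ [[h1 h2 h3 h4] h5 h6].
- rewrite !addn0; split=> // x b e; split; first by left.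
  by case=> // -[_ [w]]; rewrite take0.
- move=> i s1 iv si A [tr1 nq1 q1].
  have E1 := env_agree A isT E.
  have [sv1 sa1 sd1] : [/\ words s1 xV 0 = v, words s1 xPA 0 = a & weights s1 yD 0 = d%:E].
    by rewrite !A.1 // A.2.
  have xn : (nth (0, 0%R) (adjl v) i).1 < n.
    have := mem_nth (0, 0%R) iv.
    by case: (nth _ _ _) => y w /(und_lt (par_und P))[].
  have ncap := par_cap_n.
  apply: twp_sput; [|by lia|].
    by rewrite /= sv1 si (env_m E1) (env_adj E1) //; exact: leq_trans (ltnW xn) ncap.
  apply: twp_srput; first by lia.
  rewrite /= sv1 si (env_m E1) (env_adj E1) // sd1 (env_aw E1) //.
  set s2 := rput _ _ _ _.
  have tr2 : tree_ok N s2 (top + i) by case: tr1 => t1 t2 t3 t4.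
  have s2N : words s2 xN 0 = N := env_N E1.
  have s2d : weights s2 yPK 0 = (d + (nth (0, 0%R) (adjl v) i).2)%:E by [].
  apply: (twp_wk (push_spec (par_capN P) (par_H P) s2N tr2 _ s2d _ _)) => /=.
  + by lia.
  + exact: leq_trans (ltnW xn) ncap.
  + by rewrite sa1; lia.
  + by lia.
  move=> s3 A3 [tr3 nq3 q3]; rewrite !addnS; split=> //.
    by rewrite nq3 -nq1.
  move=> x b e; rewrite q3 /= sa1.
  have -> : queued N s2 x b e <-> queued N s1 x b e by [].
  rewrite q1 (take_nth (0, 0%R)) //; split.
    case=> [[|[-> [w xw ->]]]|[-> -> ->]]; first by left.
      by right; split=> //; exists w => //; rewrite mem_rcons inE xw orbT.
    right; split=> //; exists (nth (0, 0%R) (adjl v) i).2 => //.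
    by rewrite mem_rcons inE -surjective_pairing eqxx.
  case=> [|[-> [w]]]; first by left; left.
  rewrite mem_rcons inE => /orP[/eqP xw ->|xw ->].
    by right; rewrite -xw.
  by left; right; split=> //; exists w.
- by rewrite sum_nat_const_nat; lia.
by move=> s1 A _ [h1 h2 h3]; split=> // x b e; rewrite h3 take_size.
Qed.

(** At level 0 the summand [1 - lev] makes every vertex a source, whatever the array holds. *)
Definition is_src s lev a := 0 < words s xINA (lev * n + a) + (1 - lev).

Definition init_src :=
  For xPA (Var xHDR)
    (If (Leq (Cst 1) (Add (Get xINA (Add (Var xBASE) (Var xPA))) (Defs.Sub (Cst 1) (Var xLEV))))
      (Seq (Put xPX (Cst 0) (Var xPA)) (Seq (RPut yPK (Cst 0) RZero) push)) Skip).

Lemma init_src_spec s lev : env s -> tree_ok N s 0 -> num_queued N s = 0 ->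
  (forall v a d, ~ queued N s v a d) -> words s xLEV 0 = lev ->
  words s xBASE 0 = lev * n ->
  twp cap init_src s ((5 * H + 20) * n + 3) (fun s' =>
    exists2 top, top <= n & [/\ tree_ok N s' top, num_queued N s' = top &
      forall v a (d : R), queued N s' v a d <-> [/\ v = a, a < n, is_src s lev a & d = 0%R]]).
Proof.
move=> E tr nq0 q0 sl sb.
have ncap := par_cap_n; have NE := par_N P.
apply: (twp_for (N := n) (B := fun=> 5 * H + 17)
  (I := fun i s' => exists2 top, top <= i & [/\ tree_ok N s' top, num_queued N s' = top &
      forall v a (d : R), queued N s' v a d <-> [/\ v = a, a < i, is_src s lev a & d = 0%R]])).
- by [].
- by nia.
- by move=> s1 A /=; rewrite !A.1 // (env_n E).
- by move=> i s1 x _ [top le [[h1 h2 h3 h4] h5 h6]]; exists top.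
- exists 0 => //; split=> // v a d; split=> [/q0//|[_]].
  by rewrite ltn0.
- move=> i s1 iN si A [top le [tr1 nq1 q1]].
  have E1 := env_agree A isT E.
  have srcE : words s1 xINA (words s1 xBASE 0 + words s1 xPA 0) + (1 - words s1 xLEV 0) =
    words s xINA (lev * n + i) + (1 - lev) by rewrite si !A.1 // sl sb.
  apply: twp_cond; [by lia| |]; rewrite /= srcE -/(is_src s lev i) => src.
    apply: twp_sput => /=; [by rewrite si; nia|by lia|].
    apply: twp_srput; first by lia.
    rewrite /= si; set s2 := rput _ _ _ _.
    have tr2 : tree_ok N s2 top by case: tr1 => t1 t2 t3 t4.
    have s2N : words s2 xN 0 = N := env_N E1.
    have s2d : weights s2 yPK 0 = 0%:E by [].
    apply: (twp_wk (push_spec (par_capN P) (par_H P) s2N tr2 _ s2d _ _)) => /=.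
    + by nia.
    + by nia.
    + by rewrite si; nia.
    + by lia.
    move=> s3 A3 [tr3 nq3 q3]; exists top.+1 => //; split=> //.
      by rewrite nq3 -nq1.
    move=> v a d; rewrite q3 /= si.
    have -> : queued N s2 v a d <-> queued N s1 v a d by [].
    rewrite q1; split.
      by case=> [[-> ai sa ->]|[-> -> ->]]; split=> //; lia.
    move=> [-> ai sa ->]; rewrite ltnS leq_eqVlt in ai.
    by case/orP: ai => [/eqP->|ai]; [right|left].
  apply: twp_skip; first by lia.
  exists top; first by lia.
  split=> // v a d; rewrite q1; split=> [[-> ai sa ->]|[-> ai sa ->]]; split=> //.
    by lia.
  rewrite ltnS leq_eqVlt in ai; case/orP: ai => // /eqP ai.
  by rewrite ai (negbTE src) in sa.
- by rewrite sum_nat_const_nat; nia.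
move=> s1 A _ [top le h]; by exists top.
Qed.

End Levels.

(** * The search of one level and its amortized cost *)

Section SearchLevel.
Variables (R : realType) (n m k L N H cap del : nat) (adjl : nat -> seq (nat * R)).
Implicit Types (s : memory R) (g : rows R).
Hypothesis P : params n m k L N H cap del adjl.

Local Notation wgt := (src_weight del adjl).
Local Notation env := (env n m L N del adjl).
Local Notation rep := (rep n wgt).

Definition level_lst g lev v := if v < n then rlst g (lev * n + v) else [::].
Definition level_dist g lev v a := rdist g (lev * n + v) a.

Definition inv_ok g lev := forall a, a < n -> uniq (rinv g (lev * n + a)) /\
  forall v, (v \in rinv g (lev * n + a)) = (v < n) && (a \in rlst g (lev * n + v)).

Definition same_outside lev g g' := forall r, ~~ (lev * n <= r < lev * n + n) ->
  [/\ rlst g' r = rlst g r, rdist g' r = rdist g r & rinv g' r = rinv g r].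

Definition search_step :=
  Seq pop
  (Seq (Put xROW (Cst 0) (Add (Var xBASE) (Var xV)))
    (If (And (Leq (Get xMRK (cell (Var xROW) (Var xPA))) (Cst 0))
             (Leq (Add (Get xBUD (Var xROW)) (Cst 1)) (Var xL0)))
       (Seq settle expand) Skip)).

Definition search_loop := While (Not (RLeq RInfty (RGet yT (Cst 1)))) search_step.

Lemma wsum_ge (V : nat -> nat) l : (forall a, del <= V a) -> del * size l <= wsum V l.
Proof.
move=> dV; elim: l => [|b l IH]; first by rewrite muln0.
by rewrite /wsum big_cons /= mulnS leq_add.
Qed.

(** The entries before the last weigh less than [del * L] together and at least [del] each, so they
    number less than [L]. *)
Lemma ordered_size V (f : nat -> R) l : (forall a, del <= V a) ->
  ordered V (del * L) f l -> size l <= L.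
Proof.
move=> dV; case/lastP: l => // l a ol; rewrite size_rcons.
have [lt _] := ol l a [::] (esym (cats1 l a)).
by rewrite -(ltn_pmul2l (par_del P)); exact: leq_ltn_trans (wsum_ge _ dV) lt.
Qed.

Lemma level_settle g lev v a d : v < n ->
  level_lst (settle_row g (lev * n + v) (lev * n + a) v a d) lev =
  ins (level_lst g lev) v a.
Proof.
move=> vn; apply/funext => x; rewrite /level_lst /settle_row /ins /= eqn_add2l.
by case: eqP => [->|//]; rewrite vn.
Qed.

Lemma level_dist_settle g lev v a d :
  level_dist (settle_row g (lev * n + v) (lev * n + a) v a d) lev =
  insD (level_dist g lev) v a d.
Proof.
by apply/funext => x; apply/funext => b; rewrite /level_dist /settle_row /insD /= eqn_add2l.
Qed.

Lemma same_outside_settle g0 g lev v a d : v < n -> a < n -> same_outside lev g0 g ->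
  same_outside lev g0 (settle_row g (lev * n + v) (lev * n + a) v a d).
Proof.
move=> vn an so r hr; have [h1 h2 h3] := so r hr.
have nv : r != lev * n + v by lia.
have na : r != lev * n + a by lia.
split; rewrite /settle_row /ins /insD /= ?(negbTE nv) ?(negbTE na) //.
Qed.

Lemma inv_ok_settle g lev v a d : v < n -> a < n -> a \notin rlst g (lev * n + v) ->
  inv_ok g lev -> inv_ok (settle_row g (lev * n + v) (lev * n + a) v a d) lev.
Proof.
move=> vn an al io b bn; have [ub mb] := io b bn.
rewrite /settle_row /ins /= eqn_add2l; split.
  case: eqP => [_|//]; have [ua ma] := io a an.
  by rewrite rcons_uniq ua ma (negbTE al) andbF.
move=> x; have [xv|xv] := eqVneq x v; have [ba|ba] := eqVneq b a.
- by rewrite xv ba eqxx !mem_rcons !inE !eqxx vn.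
- by rewrite xv eqxx mem_rcons inE (negbTE ba) /= mb.
- by rewrite eqn_add2l (negbTE xv) mem_rcons inE (negbTE xv) ba /=; have [_ ->] := io a an.
- by rewrite eqn_add2l (negbTE xv) mb.
Qed.

(** The number of relaxations made so far, since settling a pair at [v] relaxes all arcs of [v]. *)
Definition num_arcs g lev := \sum_(0 <= v < n) size (adjl v) * size (level_lst g lev v).

Lemma num_arcs_settle g lev v a d : v < n ->
  num_arcs (settle_row g (lev * n + v) (lev * n + a) v a d) lev =
  num_arcs g lev + size (adjl v).
Proof.
move=> vn; rewrite /num_arcs level_settle //.
have := @sum_upd1 (fun x => size (adjl x) * size (ins (level_lst g lev) v a x))
  (fun x => size (adjl x) * size (level_lst g lev x)) 0 n v vn.
rewrite /ins eqxx size_rcons mulnS => h.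
have : forall i, 0 <= i < n -> i != v ->
    size (adjl i) * size (if i == v then rcons (level_lst g lev v) a else level_lst g lev i) =
    size (adjl i) * size (level_lst g lev i) by move=> i _ /negbTE->.
move=> /h; lia.
Qed.

Definition search_inv (A : pred nat) lev g0 s := exists g top,
  [/\ tree_ok N s top, top <= n + num_arcs g lev, rep s g /\ same_outside lev g0 g,
      inv_ok g lev &
      sd_inv adjl n A (wgt lev) (del * L) (level_lst g lev) (level_dist g lev) (queued N s)].

Definition pop_cost := 8 * H + 60.
Definition arc_cost := 5 * H + 20.
(** A queued pair has prepaid its removal; a leaf not yet allocated has prepaid both its insertion
    and its removal. *)
Definition search_pot s :=
  pop_cost * num_queued N s + (pop_cost + arc_cost) * (N - words s xTOP 0).

Lemma twp_seq_iexec c1 c2 s s1 t1 T1 T (Q : memory R -> Prop) :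
  iexec cap c1 s s1 t1 -> t1 <= T1 -> T1 < T -> twp cap c2 s1 (T - T1).-1 Q ->
  twp cap (Seq c1 c2) s T Q.
Proof.
move=> e l lt q; apply: (@twp_seq _ _ _ _ _ T1 (T - T1).-1); last by lia.
by exists s1, t1.
Qed.

Lemma search_step_spec (A : pred nat) lev g0 s : lev < k ->
  env s -> words s xLEV 0 = lev -> words s xBASE 0 = lev * n -> bounded cap s ->
  weights s yT 1 != +oo%E -> search_inv A lev g0 s ->
  exists t, twp cap search_step s t (fun s' => search_inv A lev g0 s' /\
    t + search_pot s' < search_pot s).
Proof.
move=> levk E sl sb bs T1 [g [top [tr letop [rp so] io inv]]].
have NE := par_N P; have capN := par_capN P; have NH := par_H P.
have N0 : 0 < N by lia.
have wdel a : del <= wgt lev a by exact: leq_addr.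
have szL v : size (level_lst g lev v) <= L.
  exact: ordered_size wdel (sd_ord inv (v := v)).
have arcsL g' : (forall v, size (level_lst g' lev v) <= L) ->
    num_arcs g' lev <= (m + m) * L.
  move=> sz; rewrite -(par_arcs P) big_distrl /= /num_arcs; apply: leq_sum => v _.
  by rewrite leq_mul2l sz orbT.
have topN : top <= N by have := arcsL _ szL; lia.
have [s1 [t1 [e1 lt1 [d [tr1 nq1 [sd1 q1] min1 [sub1 sup1]]]]]] :=
  pop_spec capN NH N0 bs (env_N E) tr topN T1.
have ncap := par_cap_n P; have capk := par_capk P; have capW := par_capW P.
have A1 := iexec_agree e1.
have E1 := env_agree A1 isT E.
have rp1 := rep_agree A1 isT rp.
set v := words s1 xV 0 in q1 sup1; set a := words s1 xPA 0 in q1 sup1.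
have [vn an aA Wva] := sd_pend inv q1.
have [sl1 sb1] : words s1 xLEV 0 = lev /\ words s1 xBASE 0 = lev * n by rewrite !A1.1.
have lvE : level_lst g lev v = rlst g (lev * n + v) by rewrite /level_lst vn.
have rcap : lev * n + v <= cap by nia.
have [skip|acc] := boolP ((a \in level_lst g lev v) ||
    (del * L <= wsum (wgt lev) (level_lst g lev v))).
  exists (8 * H + 20); apply: (twp_seq_iexec e1 lt1); first by lia.
  apply: twp_sput; [by rewrite /= sb1|by lia|].
  rewrite /= sb1 -/v; set s2 := wput _ _ _ _.
  have dv : (lev * n + v) %/ n = lev by rewrite divnMDl ?divn_small ?addn0 //; lia.
  apply: twp_cond; first by lia.
    rewrite /= (env_n E1) -/a (row_mrk (rp1.2 _)) // (row_bud (rp1.2 _)) dv (env_L0 E1) -lvE addn1.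
    by move: skip => /orP[->//|h] /andP[_]; rewrite ltnNge h.
  move=> _; apply: twp_skip; first by lia.
  split; last first.
    have -> : search_pot s2 = search_pot s1 by [].
    by rewrite /search_pot nq1 (tree_top tr) (tree_top tr1) /pop_cost; lia.
  exists g, top; split=> //; first by case: tr1 => *; split.
    by split=> //; apply: rep_agree rp1; first exact: agree_wput.
  exact: (sd_skip inv q1 (orP skip) sub1 sup1).
move: acc; rewrite negb_or -ltnNge => /andP[al lt].
pose g' := settle_row g (lev * n + v) (lev * n + a) v a d.
have szlv : size (level_lst g lev v) < L.
  by rewrite -(ltn_pmul2l (par_del P)); exact: leq_ltn_trans (wsum_ge _ wdel) lt.
have narcs' : num_arcs g' lev <= (m + m) * L.
  apply: arcsL => x; rewrite level_settle // /ins; case: eqP => // _.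
  by rewrite size_rcons.
have narcsE := num_arcs_settle g lev a d vn.
rewrite -/g' in narcsE.
(* The bound on [num_arcs] is applied to the state after settling: it counts the insertions that are
   about to happen, so there are free leaves for all of them. *)
have topd : top + size (adjl v) < N by lia.
have szl : size (rlst g (lev * n + v)) < n.
  rewrite -lvE -(size_iota 0 n) -[X in X < _]/(size (level_lst g lev v)).
  have : size (a :: level_lst g lev v) <= size (iota 0 n).
    apply: uniq_leq_size; first by rewrite /= al (sd_uniq inv).
    move=> b; rewrite mem_iota /= inE => /orP[/eqP->//|/(sd_lst inv)[]//].
  by [].
have szi : size (rinv g (lev * n + a)) < n.
  have [ua ma] := io a an.
  have : size (v :: rinv g (lev * n + a)) <= size (iota 0 n).
    apply: uniq_leq_size; first by rewrite /= ua ma -lvE (negbTE al) andbF.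
    by move=> x; rewrite mem_iota /= inE => /orP[/eqP->//|]; rewrite ma => /andP[].
  by rewrite size_iota.
have wle b : b < n -> wgt lev b <= del + (m + m).
  move=> bn; rewrite leq_add2l; apply: leq_trans (deg_le P bn).
  by rewrite -[leqRHS]muln1 leq_mul2l leq_subr orbT.
exists (8 * H + 40 + (5 * H + 18) * size (adjl v)).
apply: (twp_seq_iexec e1 lt1); first by lia.
apply: twp_sput; [by rewrite /= sb1|by lia|].
rewrite /= sb1 -/v; set s2 := wput _ _ _ _.
have dv : (lev * n + v) %/ n = lev by rewrite divnMDl ?divn_small ?addn0 //; lia.
have rp2 : rep s2 g by apply: rep_agree rp1; first exact: agree_wput.
have E2 : env s2 by apply: env_agree E1; first exact: agree_wput.
apply: twp_cond; first by lia.
  move=> _; apply: (@twp_seq _ _ _ _ _ 14 ((5 * H + 18) * size (adjl v) + 3)); last by lia.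
  have swE : words s2 xDEL 0 + words s2 xDEG a * (1 - words s2 xLEV 0) = wgt lev a.
    by rewrite /= (env_del E1) (env_deg E1) // sl1.
  have wcap : wsum (wgt lev) (rlst g (lev * n + v)) + wgt lev a <= cap.
    by rewrite -lvE; have := wle a an; lia.
  rewrite lvE in al.
  apply: (twp_wk (settle_spec (d := d) rp2 (env_n E2) sb1 (erefl v) (erefl _) (erefl a) sd1 swE
    vn an al szl szi ncap wcap)) => // s3 A3 rp3.
  have E3 := env_agree A3 isT E2.
  have tr3 : tree_ok N s3 top.
    case: tr1 => h1 h2 h3 h4; split.
    + by move=> i iN; rewrite /min2 !A3.2 //; exact: h1.
    + by rewrite A3.1.
    + by move=> i iN; rewrite A3.2 //; exact: h3.
    + by move=> i iN; rewrite A3.2 //; exact: h4.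
  have q3E x b e : queued N s3 x b e <-> queued N s1 x b e.
    by split=> -[i iN [h1 h2 h3]]; exists i => //; move: h1 h2 h3; rewrite !A3.1 // A3.2.
  have nq3 : num_queued N s3 = num_queued N s1.
    by apply: eq_bigr => i _; rewrite A3.2.
  have [sv3 sa3 sd3] : [/\ words s3 xV 0 = v, words s3 xPA 0 = a & weights s3 yD 0 = d%:E].
    by rewrite !A3.1 // A3.2.
  apply: (twp_wk (expand_spec P E3 tr3 (ltnW topd) sv3 sa3 sd3 vn an)) => // s4 A4 [tr4 nq4 q4].
  split; last first.
    rewrite /search_pot nq4 nq3 nq1 (tree_top tr) (tree_top tr4) /pop_cost /arc_cost.
    have -> : N - top = N - (top + size (adjl v)) + size (adjl v) by lia.
    by lia.
  exists g', (top + size (adjl v)); split=> //.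
  - by lia.
  - split; first exact: rep_agree A4 _ rp3.
    exact: same_outside_settle.
  - exact: inv_ok_settle.
  rewrite /g' level_settle // level_dist_settle.
  rewrite -lvE in al.
  apply: (sd_accept (par_und P) inv q1 min1 al lt).
  - move=> x b e /q4[/q3E/sub1|]; first by left.
    by right.
  - move=> x b e /sup1[h|h]; [left; apply/q4; left; exact/q3E|by right].
  - by move=> x w xw; apply/q4; right; split=> //; exists w.
move=> /negP[]; rewrite /= (env_n E1) -/a (row_mrk (rp1.2 _)) // (row_bud (rp1.2 _)) dv.
by rewrite (env_L0 E1) -lvE addn1 (negbTE al) lt.
Qed.

Lemma search_loop_spec (A : pred nat) lev g0 s : lev < k ->
  env s -> words s xLEV 0 = lev -> words s xBASE 0 = lev * n -> bounded cap s ->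
  search_inv A lev g0 s ->
  twp cap search_loop s (search_pot s).+1 (fun s' => exists g,
    [/\ rep s' g, same_outside lev g0 g, inv_ok g lev &
      sd_inv adjl n A (wgt lev) (del * L) (level_lst g lev) (level_dist g lev) (@no_pend R)]).
Proof.
move=> levk E sl sb bs I.
apply: (twp_while (I := fun s' => bounded cap s' /\ search_inv A lev g0 s')
  (Phi := search_pot)) => //.
- move=> s1 [bs1 I1] A1 /= T1.
  have [] := search_step_spec levk (env_agree A1 isT E) _ _ bs1 _ I1.
  + by rewrite A1.1.
  + by rewrite A1.1.
  + by apply: contra T1 => /eqP->.
  by move=> t /(twp_bounded bs1) h; exists t; apply: twp_wk h _ _ => // s2 _ [? []].
move=> s1 [bs1 [g [top [tr letop [rp so] io inv]]]] A1 /=; rewrite negbK => T1.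
(* The root is a lower bound of all leaves; once it is [+oo] nothing is pending, and every
   alternative of the invariant that speaks of pending pairs disappears. *)
have noq v a (d : R) : ~ queued N s1 v a d.
  move=> [i iN [_ _ e]]; have := heap_root (tree_heap tr) (j := i).
  have T1E : weights s1 yT 1 = +oo%E by apply/eqP; rewrite -leye_eq.
  by rewrite e T1E leye_eq => /(_ ltac:(lia)).
exists g; split=> //; case: inv => i1 i2 i3 i4 i5 i6 i7; split=> //.
- by move=> v a x w av vx; have [|[d /noq]] := i6 v a x w av vx; [left|].
- by move=> a an aA; have [|[d /noq]] := i7 a an aA; [left|].
Qed.

Definition search := Seq init_tree (Seq init_src search_loop).

Lemma search_spec lev g0 s : lev < k ->
  env s -> words s xLEV 0 = lev -> words s xBASE 0 = lev * n -> bounded cap s ->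
  rep s g0 -> (forall r, lev * n <= r < lev * n + n -> rlst g0 r = [::] /\ rinv g0 r = [::]) ->
  twp cap search s ((60 * H + 200) * N) (fun s' => exists g,
    [/\ rep s' g, same_outside lev g0 g, inv_ok g lev &
      sd_inv adjl n (is_src n s lev) (wgt lev) (del * L) (level_lst g lev)
        (level_dist g lev) (@no_pend R)]).
Proof.
move=> levk E sl sb bs rp emp.
have NE := par_N P; have capN := par_capN P; have NH := par_H P.
apply: (@twp_seq _ _ _ _ _ (8 * N + 10) ((60 * H + 200) * N - (8 * N + 11))); last by nia.
apply: (twp_wk (twp_bounded bs (init_tree_spec capN (env_N E)))) => // s1 A1 [bs1 [tr1 nq1 q1]].
have E1 := env_agree A1 isT E.
have sl1 : words s1 xLEV 0 = lev by rewrite A1.1.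
have sb1 : words s1 xBASE 0 = lev * n by rewrite A1.1.
apply: (@twp_seq _ _ _ _ _ ((5 * H + 20) * n + 3) ((13 * H + 80) * N).+1); last first.
  by nia.
apply: (twp_wk (twp_bounded bs1 (init_src_spec P E1 tr1 nq1 q1 sl1 sb1))) => //.
move=> s2 A2 [bs2 [top le [tr2 nq2 q2]]].
have E2 := env_agree A2 isT E1.
(* Queued pairs and unallocated leaves number [N] together, each worth at most
   [pop_cost + arc_cost = 13 * H + 80]. *)
apply: (@twp_mono _ _ _ _ (search_pot s2).+1); last first.
  rewrite /search_pot nq2 (tree_top tr2) /pop_cost /arc_cost ltnS.
  have -> : N = top + (N - top) by lia.
  by nia.
have src1 a : is_src n s1 lev a = is_src n s lev a by rewrite /is_src A1.1.
apply: search_loop_spec => //; [by rewrite A2.1|by rewrite A2.1|].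
have rp2 := rep_agree A2 isT (rep_agree A1 isT rp).
have lst0 v : level_lst g0 lev v = [::].
  rewrite /level_lst; case: ifP => // vn.
  by have [->] := emp (lev * n + v) ltac:(lia).
exists g0, top; split=> //.
- by lia.
- move=> a an; have [_ ->] := emp (lev * n + a) ltac:(lia); split=> // v.
  by rewrite in_nil; case: ltnP => // vn; have [->] := emp (lev * n + v) ltac:(lia).
split.
- by move=> v a; rewrite lst0.
- by move=> v; rewrite lst0.
- by move=> v l1 z l2; rewrite lst0 => /(congr1 size); rewrite size_cat /= addnS.
- move=> v a d /q2[-> an sa ->]; split=> //; first by rewrite -src1.
  exact: walk_nil.
- by move=> v a d u b _; rewrite lst0.
- by move=> v a x w; rewrite lst0.
- move=> a an aA; right; exists 0%R => //; apply/q2; split=> //.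
  by rewrite src1.
Qed.

End SearchLevel.

(** * The greedy hitting set of one level *)

Lemma leq_in_count (p q : pred nat) l : {in l, forall x, p x -> q x} ->
  count p l <= count q l.
Proof.
elim: l => //= x l IH h; apply: leq_add; last by apply: IH => y yl; apply: h; rewrite inE yl orbT.
by have := h x; rewrite inE eqxx; case: (p x) => // /(_ isT isT) ->.
Qed.

Lemma count_add1 (p q : pred nat) a l : uniq l ->
  (forall b, q b -> p b || (b == a)) -> count q l <= (count p l).+1.
Proof.
move=> ul pq; rewrite -addn1.
apply: (@leq_trans (count p l + count_mem a l)); last first.
  by rewrite leq_add2l count_uniq_mem //; case: (a \in l).
by rewrite -count_predUI (leq_trans _ (leq_addr _ _)) //; apply: sub_count => b /pq.
Qed.

(** The bit length of [x], that is, the number of positive terms in [x], [x %/ 2], [x %/ 4] and so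
    on. *)
Definition halvings x := if x == 0 then 0 else (trunc_log 2 x).+1.

Lemma halvings_half x : 0 < x -> halvings x = (halvings (x %/ 2)).+1.
Proof.
rewrite /halvings; case: x => // -[|x] _; first by rewrite divn_small // trunc_log1.
have -> : (x.+2 %/ 2 == 0) = false by lia.
by rewrite trunc_log2S // divn2.
Qed.

Lemma halvings_le x y : x <= y -> halvings x <= halvings y.
Proof.
rewrite /halvings; case: x y => [|x] [|y] //= xy.
by rewrite ltnS leq_trunc_log.
Qed.

Section HitLevel.
Variables (R : realType) (n m k L N H cap del : nat) (adjl : nat -> seq (nat * R)).
Implicit Types (s : memory R).
Hypothesis P : params n m k L N H cap del adjl.
Hypothesis L_gt0 : 0 < L.

Local Notation wgt := (src_weight del adjl).
Local Notation env := (env n m L N del adjl).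
Local Notation rep := (rep n wgt).

Variables (lev : nat) (g : rows R) (A : pred nat).
Hypothesis lev_lt : lev < k.
Hypothesis io : inv_ok n g lev.
Hypothesis inv : sd_inv adjl n A (wgt lev) (del * L) (level_lst n g lev)
  (level_dist n g lev) (@no_pend R).

Local Notation lst := (level_lst n g lev).
Definition sources_of a := rinv g (lev * n + a).
Local Notation iv := sources_of.
Definition is_hit s v := 0 < words s xHIT (lev * n + v).
Local Notation missed s := (unhit lst (wgt lev) (del * L) (is_hit s)).
Local Notation num_missed s := (num_unhit n lst (wgt lev) (del * L) (is_hit s)).
Definition is_new s a := 0 < words s xINA (lev.+1 * n + a).
Definition num_new s := count (is_new s) (iota 0 n).

Let lst_uniq v : v < n -> uniq (lst v). Proof. by move=> _; exact: (sd_uniq inv). Qed.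
Let iv_uniq a : a < n -> uniq (iv a). Proof. by move=> an; have [] := io an. Qed.
Let lst_lt v a : v < n -> a \in lst v -> a < n.
Proof. by move=> _ /(sd_lst inv)[]. Qed.
Let iv_mem v a : a < n -> (v \in iv a) = (v < n) && (a \in lst v).
Proof.
move=> an; have [_ ->] := io an; rewrite /level_lst.
by case: ltnP.
Qed.
Let lst_A v a : v < n -> a \in lst v -> A a.
Proof. by move=> _ /(sd_lst inv)[]. Qed.

Lemma size_lst v : size (lst v) <= L.
Proof.
have wdel a : del <= wgt lev a by exact: leq_addr.
exact: (ordered_size P wdel (sd_ord inv (v := v))).
Qed.

Definition inv_cell := cell (Add (Var xBASE) (Var xPA)) (Var xE).

Definition count_missed :=
  For xE (Get xICNT (Add (Var xBASE) (Var xPA)))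
    (Seq (Put xROW (Cst 0) (Add (Var xBASE) (Get xINV inv_cell)))
      (If (And (Leq (Var xL0) (Get xBUD (Var xROW))) (Leq (Get xHIT (Var xROW)) (Cst 0)))
        (Put xC (Cst 0) (Add (Var xC) (Cst 1))) Skip)).

Definition mark_hit :=
  For xE (Get xICNT (Add (Var xBASE) (Var xPA)))
    (Put xHIT (Add (Var xBASE) (Get xINV inv_cell)) (Cst 1)).

Lemma size_sources a : a < n -> size (iv a) <= n.
Proof.
move=> an; rewrite -[leqRHS](size_iota 0 n); apply: uniq_leq_size; first exact: iv_uniq.
by move=> v; rewrite iv_mem // mem_iota => /andP[].
Qed.

Lemma nth_sources a i : a < n -> i < size (iv a) -> nth 0 (iv a) i < n.
Proof. by move=> an /(mem_nth 0); rewrite iv_mem // => /andP[]. Qed.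

Lemma count_missed_spec s a : env s -> rep s g -> words s xBASE 0 = lev * n ->
  words s xPA 0 = a -> a < n -> words s xC 0 = 0 ->
  twp cap count_missed s (7 * size (iv a) + 3) (fun s' =>
    words s' xC 0 = count (missed s) (iv a)).
Proof.
move=> E rp sb sa an sc; have ncap := par_cap_n P; have capk := par_capk P.
have sz := size_sources an.
apply: (twp_for (N := size (iv a)) (B := fun=> 4)
  (I := fun i s' => words s' xC 0 = count (missed s) (take i (iv a)))) => //.
- by lia.
- by move=> s1 A1 /=; rewrite !A1.1 // sb sa (row_icnt (rp.2 _)).
- by rewrite take0.
- move=> i s1 iN si A1 sc1.
  have E1 := env_agree A1 isT E; have rp1 := rep_agree A1 isT rp.
  have [sb1 sa1] : words s1 xBASE 0 = lev * n /\ words s1 xPA 0 = a by rewrite !A1.1.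
  have vn := nth_sources an iN.
  have vE : words s1 xINV ((lev * n + a) * n + i) = nth 0 (iv a) i by rewrite (row_inv (rp1.2 _)).
  have c1 : count (missed s) (take i.+1 (iv a)) =
      count (missed s) (take i (iv a)) + missed s (nth 0 (iv a) i).
    by rewrite (take_nth 0) // -cats1 count_cat /= addn0.
  have rowE : lev * n + nth 0 (iv a) i <= cap by nia.
  have cle : count (missed s) (take i.+1 (iv a)) <= cap.
    apply: leq_trans (count_size _ _) _; rewrite size_takel //; lia.
  set v := nth 0 (iv a) i in vn vE c1 rowE.
  have bE : (del * L <= words s1 xBUD (lev * n + v)) &&
      (words s1 xHIT (lev * n + v) <= 0) = missed s v.
    rewrite (row_bud (rp1.2 _)) divnMDl ?divn_small ?addn0 //; last by lia.
    rewrite /unhit /full /is_hit /level_lst vn A1.1 // lt0n negbK.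
    by rewrite leqn0.
  apply: twp_sput => //=; rewrite ?(env_n E1) ?sb1 ?sa1 ?si ?vE //.
  apply: twp_cond => //=; rewrite (env_L0 E1) bE => b.
    by apply: twp_put => //=; rewrite sc1; move: cle; rewrite c1 b.
  by apply: twp_skip => //=; rewrite sc1 c1 (negbTE b) addn0.
- by rewrite sum_nat_const_nat; lia.
by move=> s1 A1 _ ->; rewrite take_size.
Qed.

Lemma mark_hit_spec s a : env s -> rep s g -> words s xBASE 0 = lev * n ->
  words s xPA 0 = a -> a < n ->
  twp cap mark_hit s (4 * size (iv a) + 3) (fun s' =>
    (forall v, v < n -> is_hit s' v = (v \in iv a) || is_hit s v) /\
    forall r, ~~ (lev * n <= r < lev * n + n) -> words s' xHIT r = words s xHIT r).
Proof.
move=> E rp sb sa an; have ncap := par_cap_n P; have capk := par_capk P.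
have sz := size_sources an.
apply: (twp_for (N := size (iv a)) (B := fun=> 1) (I := fun i s' =>
    (forall v, v < n -> is_hit s' v = (v \in take i (iv a)) || is_hit s v) /\
    forall r, ~~ (lev * n <= r < lev * n + n) -> words s' xHIT r = words s xHIT r)) => //.
- by lia.
- by move=> s1 A1 /=; rewrite !A1.1 // sb sa (row_icnt (rp.2 _)).
- by split=> // v _; rewrite take0.
- move=> i s1 iN si A1 [h1 h2].
  have E1 := env_agree A1 isT E; have rp1 := rep_agree A1 isT rp.
  have [sb1 sa1] : words s1 xBASE 0 = lev * n /\ words s1 xPA 0 = a by rewrite !A1.1.
  have vn := nth_sources an iN.
  have vE : words s1 xINV ((lev * n + a) * n + i) = nth 0 (iv a) i by rewrite (row_inv (rp1.2 _)).
  apply: twp_put => //=; first by lia.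
  rewrite (env_n E1) sb1 sa1 si vE; split.
    move=> v vn'; rewrite /is_hit /= eqn_add2l (take_nth 0) // mem_rcons inE.
    by case: eqP => //= _; exact: h1.
  by move=> r hr; rewrite /=; case: eqP => [e|_]; [lia|exact: h2].
- by rewrite sum_nat_const_nat; lia.
by move=> s1 A1 _ [h1 h2]; split=> // v vn; rewrite h1 // take_size.
Qed.

Definition hit_source :=
  Seq (Put xC (Cst 0) (Cst 0))
  (Seq count_missed
    (If (Leq (Var xTH) (Var xC))
      (Seq (Put xINA (Add (Add (Var xBASE) (Var xHDR)) (Var xPA)) (Cst 1)) mark_hit)
      Skip)).

Definition covered s := forall v, v < n -> is_hit s v -> exists2 a, a \in lst v & is_new s a.

Definition same_sets s s' :=
  (forall r, ~~ (lev * n <= r < lev * n + n) -> words s' xHIT r = words s xHIT r) /\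
  (forall r, ~~ (lev.+1 * n <= r < lev.+1 * n + n) -> words s' xINA r = words s xINA r).

Lemma same_sets_trans s1 s2 s3 : same_sets s1 s2 -> same_sets s2 s3 -> same_sets s1 s3.
Proof.
by move=> [h1 h2] [h3 h4]; split=> r hr; rewrite ?h3 ?h4 // ?h1 ?h2.
Qed.

(* Every vertex added to the next level hits at least [theta] new lists. *)
Lemma hit_source_spec s a th : env s -> rep s g -> words s xBASE 0 = lev * n ->
  words s xPA 0 = a -> a < n -> words s xTH 0 = th -> covered s ->
  twp cap hit_source s (11 * size (iv a) + 20) (fun s' =>
    [/\ covered s', same_sets s s',
      th * num_new s' + num_missed s' <= th * num_new s + num_missed s,
      forall b, b < n -> count (missed s') (iv b) <= count (missed s) (iv b) &
      0 < th -> count (missed s') (iv a) < th]).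
Proof.
move=> E rp sb sa an st cov; have ncap := par_cap_n P; have capk := par_capk P.
have N1 := par_N P; have capN := par_capN P.
apply: twp_sput => //=; first by lia.
set s1 := wput _ _ _ _.
have A1 : agree [:: xC] [::] s s1 by exact: agree_wput.
have E1 := env_agree A1 isT E; have rp1 := rep_agree A1 isT rp.
apply: (@twp_seq _ _ _ _ _ (7 * size (iv a) + 3) (4 * size (iv a) + 8)); last by lia.
apply: (twp_wk (count_missed_spec E1 rp1 sb sa an (erefl _))) => // s2 A2 c2.
have E2 := env_agree A2 isT E1; have rp2 := rep_agree A2 isT rp1.
have [sb2 sa2 st2] : [/\ words s2 xBASE 0 = lev * n, words s2 xPA 0 = a & words s2 xTH 0 = th].
  by rewrite !A2.1.
have hit2 : is_hit s2 = is_hit s by apply/funext => v; rewrite /is_hit A2.1.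
have new2 : is_new s2 = is_new s by apply/funext => v; rewrite /is_new A2.1.
have miss1 : is_hit s1 = is_hit s by [].
rewrite miss1 in c2.
have num2 : num_new s2 = num_new s by rewrite /num_new new2.
apply: twp_cond => //=; first by lia.
  rewrite st2 c2 => thc; apply: twp_sput => //=; [by lia|by lia|].
  rewrite sb2 sa2 (env_n E2); set s3 := wput _ _ _ _.
  have A3 : agree [:: xINA] [::] s2 s3 by exact: agree_wput.
  have E3 := env_agree A3 isT E2; have rp3 := rep_agree A3 isT rp2.
  apply: (twp_wk (mark_hit_spec E3 rp3 sb2 sa2 an)); first by lia.
  move=> s4 A4 [h4 out4].
  have new4 b : is_new s4 b = (b == a) || is_new s b.
    rewrite -new2 /is_new A4.1 //= mulSn [n + _]addnC eqn_add2l.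
    by case: eqP.
  have h4' v : v < n -> is_hit s4 v = (v \in iv a) || is_hit s v.
    by move=> vn; rewrite h4 // -hit2.
  have adde := num_unhit_add (wgt lev) (del * L) iv_uniq iv_mem an h4'.
  split.
  - move=> v vn; rewrite h4' // iv_mem // vn => /orP[/= av|/(cov v vn)[b bv nb]].
      by exists a => //; rewrite new4 eqxx.
    by exists b => //; rewrite new4 nb orbT.
  - split=> r hr; first by rewrite out4 //= A2.1.
    rewrite A4.1 //= A2.1 //; case: eqP => // e.
    by move: hr; rewrite e mulSn; lia.
  - have num4 : num_new s4 <= (num_new s).+1.
      by apply: (@count_add1 _ _ a); [exact: iota_uniq|move=> b; rewrite new4 orbC].
    rewrite adde; apply: (@leq_trans (th * (num_new s).+1 + num_missed s4)).
      by rewrite leq_add2r leq_mul2l num4 orbT.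
    by rewrite mulnS; lia.
  - move=> b bn; apply: leq_in_count => v; rewrite iv_mem // => /andP[vn _].
    by rewrite /unhit h4' // negb_or => /and3P[-> _ ->].
  move=> th0; apply: leq_ltn_trans th0; rewrite leqn0 -leqn0 leqNgt -has_count.
  apply/hasPn => v vi; rewrite /unhit h4' ?vi ?andbF //.
  by move: vi; rewrite iv_mem // => /andP[].
rewrite st2 c2 -ltnNge => cth; apply: twp_skip; first by lia.
rewrite hit2 num2; split=> //.
- by move=> v vn; rewrite hit2 new2; exact: cov.
- by split=> r hr; rewrite A2.1.
Qed.

Definition hit :=
  Seq (Put xTH (Cst 0) (Var xHDR))
    (While (Leq (Cst 1) (Var xTH))
      (Seq (For xPA (Var xHDR) hit_source) (Put xTH (Cst 0) (Div (Var xTH) (Cst 2))))).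

Local Notation weight_total := (total n (wgt lev) A).

(** When the pass with threshold [th] begins, every source is in at most [2 * th] missed lists, so
    by averaging the number of missed lists times [del * L] is at most [2 * th] times the total
    weight. Each chosen source hits at least [th] of them; dividing by [th], every pass contributes
    the same amount to the bound, and there are [halvings n] passes. *)
Lemma hit_spec s : env s -> rep s g -> words s xBASE 0 = lev * n ->
  (forall v, v < n -> words s xHIT (lev * n + v) = 0) ->
  (forall a, a < n -> words s xINA (lev.+1 * n + a) = 0) ->
  twp cap hit s (halvings n * (11 * (n * L) + 30 * n) + 3) (fun s' =>
    [/\ same_sets s s',
      forall v, v < n -> del * L <= wsum (wgt lev) (lst v) ->
        exists2 a, a \in lst v & is_new s' a &
      num_new s' * (del * L) <= 2 * weight_total * halvings n]).
Proof.
move=> E rp sb hit0 new0; have ncap := par_cap_n P; have n0 := par_n P.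
apply: twp_sput => /=; [by rewrite (env_n E)|by lia|].
rewrite (env_n E); set s1 := wput _ _ _ _.
have dL0 : 0 < del * L by rewrite muln_gt0 (par_del P).
pose I s' := [/\ words s' xTH 0 <= n, covered s', same_sets s s',
  forall b, b < n -> count (missed s') (iv b) <= 2 * words s' xTH 0 &
  num_new s' * (del * L) <= 2 * weight_total * (halvings n - halvings (words s' xTH 0))].
pose B := 11 * (n * L) + 30 * n.
apply: (twp_while (I := I) (Phi := fun s' => halvings (words s' xTH 0) * B)).
- move=> s2 [thn cov ss cnt num] A2 /= th1; set th := words s2 xTH 0 in thn cnt num th1 *.
  have E2 : env s2 by apply: env_agree A2 isT _; apply: env_agree (agree_wput _ _ _ _) _ E.
  have rp2 : rep s2 g by apply: rep_agree A2 isT _; apply: rep_agree (agree_wput _ _ _ _) _ rp.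
  have sb2 : words s2 xBASE 0 = lev * n by rewrite A2.1.
  pose J i s' := [/\ covered s', same_sets s2 s',
    th * num_new s' + num_missed s' <= th * num_new s2 + num_missed s2,
    forall b, b < n -> count (missed s') (iv b) <= count (missed s2) (iv b) &
    forall b, b < i -> b < n -> count (missed s') (iv b) < th].
  exists B.-1; apply: (@twp_seq _ _ _ _ _ (11 * (n * L) + 23 * n + 3) 1); last first.
    by rewrite /B; lia.
  apply: (twp_for (N := n) (B := fun a => 11 * size (iv a) + 20) (I := J)) => //.
  + by move=> s3 A3 /=; rewrite A3.1 // (env_n E2).
  + move=> a s3 an sa A3 [cov3 ss3 num3 cnt3 lt3].
    have E3 := env_agree A3 isT E2; have rp3 := rep_agree A3 isT rp2.
    have [sb3 st3] : words s3 xBASE 0 = lev * n /\ words s3 xTH 0 = th by rewrite !A3.1.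
    apply: (twp_wk (hit_source_spec E3 rp3 sb3 sa an st3 cov3)) => // s4 _.
    move=> [cov4 ss4 num4 cnt4 lt4]; split=> //.
    * exact: same_sets_trans ss3 ss4.
    * exact: leq_trans num4 num3.
    * by move=> b bn; exact: leq_trans (cnt4 b bn) (cnt3 b bn).
    move=> b; rewrite ltnS leq_eqVlt => /orP[/eqP->|ba] bn; first exact: lt4.
    by apply: leq_ltn_trans (cnt4 b bn) _; exact: lt3.
  (* A pass reads every inverse list; their total length is that of the lists themselves, at most
     [n * L]. *)
  + rewrite big_split /= big_split /= !sum_nat_const_nat -big_distrr /=.
    rewrite (sum_size_iv lst_uniq iv_uniq lst_lt iv_mem).
    have : \sum_(0 <= v < n) size (lst v) <= n * L.
      rewrite -[n in n * L]subn0 -sum_nat_const_nat; apply: leq_sum => v _; exact: size_lst.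
    by lia.
  move=> s3 A3 _ [cov3 ss3 num3 cnt3 lt3].
  have th3 : words s3 xTH 0 = th by rewrite A3.1.
  apply: twp_put => //=; rewrite th3; first by lia.
  have hv := halvings_half th1.
  split; last by rewrite /= hv /B; have := n0; lia.
  have [hn hle] : halvings th <= halvings n /\ 0 < halvings th.
    by rewrite {2}hv; split=> //; exact: halvings_le.
  split=> /=.
  + by lia.
  + exact: cov3.
  + exact: same_sets_trans ss ss3.
  (* A count below [th] is at most [2 * (th %/ 2)], also for odd [th]; this restores the invariant
     for the next threshold. *)
  + move=> b bn; suff h : count (missed s3) (iv b) <= 2 * (th %/ 2) by exact: h.
    by have := lt3 b bn bn; lia.
  have nun := num_unhit_le (W := wgt lev) (L0 := del * L) (H := is_hit s2)
    lst_uniq iv_uniq lst_lt iv_mem lst_A cnt.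
  have num3' : th * num_new s3 <= th * num_new s2 + num_missed s2.
    by apply: leq_trans num3; exact: leq_addr.
  have num3'' : th * (num_new s3 * (del * L)) <= th * (num_new s2 * (del * L) + 2 * weight_total).
    rewrite mulnA; apply: leq_trans (leq_mul num3' (leqnn _)) _.
    rewrite mulnDl mulnDr -mulnA leq_add2l; apply: leq_trans nun _.
    by rewrite -mulnA mulnCA.
  move: num3''; rewrite leq_pmul2l // => num3''.
  apply: leq_trans num3'' _.
  have -> : halvings n - halvings (th %/ 2) = (halvings n - halvings th).+1 by lia.
  by rewrite mulnS addnC leq_add2l.
- split=> //=.
  + by move=> v vn; rewrite /is_hit /= hit0.
  + move=> b bn; apply: leq_trans (count_size _ _) _.
    by have := size_sources bn; lia.
  + rewrite /num_new (@eq_in_count _ _ pred0) ?count_pred0 //.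
    by move=> a; rewrite mem_iota /= add0n /is_new /= => an; rewrite new0.
- by rewrite /= /B; lia.
move=> s2 [thn cov ss cnt num] A2 /=; rewrite -eqn0Ngt => /eqP th0; split=> //.
  move=> v vn fv; apply: cov => //.
  (* A full list is not empty because [del * L] is positive. With threshold 0 its entry [a] is in no
     missed list, so this list has been hit. *)
  have [a av] : exists a, a \in lst v.
    case: (lst v) fv => [|a l _]; first by rewrite /wsum big_nil; lia.
    by exists a; rewrite inE eqxx.
  have an := lst_lt vn av; have := cnt a an; rewrite th0 muln0 leqNgt -has_count.
  move=> /hasPn/(_ v); rewrite iv_mem // vn av => /(_ isT).
  by rewrite /unhit /full fv /= negbK.
by apply: leq_trans num _; rewrite leq_mul2l leq_subr orbT.
Qed.

End HitLevel.

(** * The hierarchy of levels *)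

Section AllLevels.
Variables (R : realType) (n m k rho H N cap del : nat) (adjl : nat -> seq (nat * R)).
Implicit Types (s : memory R) (g : rows R).
Local Notation lam := (halvings n).
Local Notation L := (6 * lam * rho).
Hypothesis P : params n m k L N H cap del adjl.
Hypotheses (k2 : 2 <= k) (rho_gt0 : 0 < rho) (rho_k : n <= rho ^ k) (m_del : m <= n * del).

Local Notation wgt := (src_weight del adjl).
Local Notation env := (env n m L N del adjl).
Local Notation rep := (rep n wgt).
Local Notation src s lev := (is_src n s lev).
Local Notation lst := (level_lst n).
Local Notation dst := (level_dist n).

Lemma lam_gt0 : 0 < lam.
Proof. by rewrite /halvings -(prednK (par_n P)). Qed.

Lemma L_gt0 : 0 < L.
Proof. by rewrite !muln_gt0 lam_gt0. Qed.

Lemma sd_inv_ext A A' V L0 (l : nat -> seq nat) (D D' : nat -> nat -> R) :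
  sd_inv adjl n A V L0 l D (@no_pend R) -> (forall a, a < n -> A a = A' a) ->
  (forall v, v < n -> D v = D' v) -> sd_inv adjl n A' V L0 l D' (@no_pend R).
Proof.
move=> I AA DD; case: (I) => i1 i2 i3 i4 i5 i6 i7.
have lE v a : a \in l v -> D' v a = D v a by case/i1 => vn _ _ _; rewrite DD.
have gE v a d : good V L0 l D v a d -> good V L0 l D' v a d.
  by case=> [[h1 h2]|[h1 h2]]; [left; rewrite lE|right; split=> // b bl; rewrite lE // h2].
split=> //.
- by move=> v a av; have [vn an aA W] := i1 v a av; rewrite -AA // lE.
- by move=> v; apply: ordered_ext (i3 v) => a av; rewrite lE.
- by move=> v a x w av vx; have [/gE|[? []]] := i6 v a x w av vx; rewrite lE //; left.
- by move=> a an; rewrite -AA // => aA; have [/gE|[? []]] := i7 a an aA; left.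
Qed.

Definition num_src s lev := count (src s lev) (iota 0 n).

Definition build_level := Seq (Put xBASE (Cst 0) (Mul (Var xLEV) (Var xHDR))) (Seq search hit).

(** Each level works in rows of its own, so nothing is ever cleared: [li_empty], [li_hit0] and
    [li_ina0] say that the rows still to come are blank. *)
Record levels_inv i s g : Prop := LevelsInv {
  li_rep : rep s g;
  li_empty : forall r, i * n <= r -> rlst g r = [::] /\ rinv g r = [::];
  li_sd : forall lev, lev < i -> sd_inv adjl n (src s lev) (wgt lev) (del * L)
    (lst g lev) (dst g lev) (@no_pend R);
  li_hit : forall lev v, lev < i -> v < n -> del * L <= wsum (wgt lev) (lst g lev v) ->
    exists2 a, a \in lst g lev v & src s lev.+1 a;
  li_num : forall lev, lev <= i -> num_src s lev * rho ^ lev <= n;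
  li_hit0 : forall r, i * n <= r -> words s xHIT r = 0;
  li_ina0 : forall r, i.+1 * n <= r -> words s xINA r = 0 }.

Definition level_cost := (60 * H + 200) * N + lam * (11 * (n * L) + 30 * n) + 10.

(** At level 0 the total weight is [n * del + 2 * m], at most [3 * n * del] by [m_del]; with the
    greedy factor 2 this is exactly absorbed by the 6 in [L], and [lam] by its own factor. At higher
    levels a member weighs [del], so a factor 3 is to spare. *)
Lemma num_src_step s lev (A : pred nat) c : (forall a, a < n -> A a = src s lev a) ->
  c * (del * L) <= 2 * total n (wgt lev) A * lam ->
  num_src s lev * rho ^ lev <= n -> c * rho ^ lev.+1 <= n.
Proof.
move=> AE hc hn.
have tE : total n (wgt lev) A <= if lev == 0 then 3 * n * del else del * num_src s lev.
  case: eqP => [->|lev0].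
    apply: (@leq_trans (\sum_(0 <= a < n) wgt 0 a)).
      by rewrite /total big_mkcond /=; apply: leq_sum => a _; case: ifP.
    rewrite /src_weight big_split /= sum_nat_const_nat.
    under eq_bigr do rewrite muln1.
    by rewrite (par_arcs P); lia.
  rewrite /total /num_src -iter_addn_0 -big_const_seq /index_iota subn0.
  rewrite big_seq_cond [leqRHS]big_seq_cond; apply: eq_leq; apply: eq_big => [a|a _].
    by rewrite mem_iota; case: ltnP => //= an; rewrite AE.
  by rewrite /src_weight (_ : 1 - lev = 0) ?muln0 ?addn0 //; lia.
have lam0 := lam_gt0; have del0 := par_del P.
have hc2 := leq_trans hc (leq_mul (leq_mul (leqnn 2) tE) (leqnn lam)).
have [e|e] := eqVneq lev 0.
  move: hc2; rewrite e /= expn1 => hc2.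
  rewrite -(@leq_pmul2r (6 * del * lam)); last by rewrite !muln_gt0 del0.
  by apply: leq_trans (leq_trans hc2 _); apply: eq_leq; ring.
move: hc2; rewrite (negbTE e) => hc2.
have h : c * rho <= num_src s lev.
  apply: (@leq_trans (3 * (c * rho))); first by rewrite leq_pmull.
  rewrite -(@leq_pmul2r (2 * del * lam)); last by rewrite !muln_gt0 del0.
  by apply: leq_trans (leq_trans hc2 _); apply: eq_leq; ring.
by apply: leq_trans hn; rewrite expnS mulnA leq_mul2r h orbT.
Qed.

Lemma is_srcS s lev a : src s lev.+1 a = is_new n lev s a.
Proof. by rewrite /is_src /is_new subSS sub0n addn0. Qed.

Lemma build_level_spec i s g : i < k -> env s -> words s xLEV 0 = i -> bounded cap s ->
  levels_inv i s g ->
  twp cap build_level s level_cost (fun s' => exists g', levels_inv i.+1 s' g').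
Proof.
move=> ik E sl bs [rp emp sd ht nm h0 a0].
have capk := par_capk P; have n0 := par_n P.
apply: twp_sput => /=; [by rewrite sl (env_n E); nia|by rewrite /level_cost; lia|].
rewrite sl (env_n E); set s1 := wput _ _ _ _.
have A1 : agree [:: xBASE] [::] s s1 by exact: agree_wput.
have E1 := env_agree A1 isT E; have rp1 := rep_agree A1 isT rp.
have bs1 : bounded cap s1.
  move=> a j; rewrite /s1 /wput /= /upd; case: ifP => _; last exact: bs.
  by nia.
have emp1 r : i * n <= r < i * n + n -> rlst g r = [::] /\ rinv g r = [::].
  by move=> /andP[/emp].
apply: (@twp_seq _ _ _ _ _ ((60 * H + 200) * N) (lam * (11 * (n * L) + 30 * n) + 3)); last first.
  by rewrite /level_cost; lia.
apply: (twp_wk (search_spec P ik E1 sl erefl bs1 rp1 emp1)) => // s2 A2 [g' [rp2 so io I2]].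
have E2 := env_agree A2 isT E1.
have sb2 : words s2 xBASE 0 = i * n by rewrite A2.1.
have hit2 v : v < n -> words s2 xHIT (i * n + v) = 0.
  by move=> vn; rewrite A2.1 //= h0 //; lia.
have new2 a : a < n -> words s2 xINA (i.+1 * n + a) = 0.
  by move=> an; rewrite A2.1 //= a0 //; lia.
apply: (twp_wk (hit_spec P L_gt0 ik io I2 E2 rp2 sb2 hit2 new2)) => // s3 A3.
move=> [[sh sn] hits num].
have out lev v : lev < i -> v < n -> ~~ (i * n <= lev * n + v < i * n + n).
  move=> li vn; apply/negP => /andP[h _].
  by have : lev.+1 * n <= i * n by [rewrite leq_mul2r li orbT]; lia.
have srcE lev a : lev <= i -> a < n -> src s3 lev a = src s lev a.
  move=> li an; rewrite /is_src sn ?A2.1 //.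
  apply/negP => /andP[h _].
  by have : lev.+1 * n <= i.+1 * n by [rewrite leq_mul2r ltnS li orbT]; lia.
have lstE lev : lev < i -> lst g' lev = lst g lev.
  move=> li; apply/funext => v; rewrite /level_lst; case: ifP => // vn.
  by have [] := so _ (out _ _ li vn).
exists g'; split.
- exact: rep_agree A3 isT rp2.
- move=> r hr; have [|-> _ ->] := so r; first by lia.
  by apply: emp; lia.
- move=> lev; rewrite ltnS leq_eqVlt => /orP[/eqP->|li].
    apply: sd_inv_ext I2 _ _ => // a an; rewrite srcE //.
  rewrite lstE //; apply: sd_inv_ext (sd _ li) _ _ => [a an|v vn].
    by rewrite srcE // ltnW.
  by apply/funext => a; rewrite /level_dist; have [_ ->] := so _ (out _ _ li vn).
- move=> lev v; rewrite ltnS leq_eqVlt => /orP[/eqP->|li] vn fv.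
    by have [a av na] := hits v vn fv; exists a => //; rewrite is_srcS.
  rewrite lstE // in fv *; have [a av na] := ht _ _ li vn fv; exists a => //.
  by rewrite srcE //; have [_ ->] := sd_lst (sd _ li) av.
- have numE lev : lev <= i -> num_src s3 lev = num_src s lev.
    by move=> li; apply: eq_in_count => a; rewrite mem_iota => /andP[_ an]; rewrite srcE.
  move=> lev; rewrite leq_eqVlt => /orP[/eqP->|li]; last by rewrite numE //; exact: nm.
  have -> : num_src s3 i.+1 = num_new n i s3.
    by apply: eq_count => a; rewrite is_srcS.
  apply: (num_src_step (s := s) _ num); last exact: nm.
  by move=> a an; rewrite /is_src.
- by move=> r hr; rewrite sh ?A2.1 //= ?h0 //; lia.
- by move=> r hr; rewrite sn ?A2.1 //= ?a0 //; lia.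
Qed.

Definition build_levels := For xLEV (Cst k) build_level.

Record oracle s g : Prop := Oracle {
  or_rep : rep s g;
  or_sd : forall lev, lev < k -> sd_inv adjl n (src s lev) (wgt lev) (del * L)
    (lst g lev) (dst g lev) (@no_pend R);
  or_hit : forall lev v, lev.+1 < k -> v < n -> del * L <= wsum (wgt lev) (lst g lev v) ->
    exists2 a, a \in lst g lev v & src s lev.+1 a;
  or_last : forall v, wsum (wgt k.-1) (lst g k.-1 v) < del * L }.

(** By [li_num] and [n <= rho ^ k] at most [rho] members are left at level [k.-1]. As [k >= 2], this
    is not level 0 and each weighs [del], so a list weighs at most [del * rho], which is less than
    [del * L]. *)
Lemma levels_inv_oracle s g : levels_inv k s g -> oracle s g.
Proof.
move=> [rp emp sd ht nm h0 a0]; split=> //.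
  by move=> lev v lk; apply: ht; exact: ltnW.
move=> v; have kk : k.-1 < k by lia.
have I := sd _ kk.
have szl : size (lst g k.-1 v) <= num_src s k.-1.
  rewrite /num_src -size_filter; apply: uniq_leq_size; first exact: (sd_uniq I).
  by move=> a /(sd_lst I)[_ an aA _]; rewrite mem_filter aA mem_iota.
have szr : num_src s k.-1 <= rho.
  have h := nm k.-1 (ltnW kk); rewrite -(@leq_pmul2r (rho ^ k.-1)) ?expn_gt0 ?rho_gt0 //.
  by apply: leq_trans h _; rewrite -expnS prednK //; lia.
have -> : wsum (wgt k.-1) (lst g k.-1 v) = del * size (lst g k.-1 v).
  rewrite /wsum /src_weight (_ : 1 - k.-1 = 0); last by lia.
  under eq_bigr do rewrite muln0 addn0.
  by rewrite big_const_seq count_predT iter_addn_0.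
rewrite ltn_pmul2l ?(par_del P) //; apply: leq_ltn_trans (leq_trans szl szr) _.
by have := lam_gt0; nia.
Qed.

Lemma build_levels_spec s : env s -> bounded cap s ->
  (forall a, a \in [:: xCNT; xMRK; xBUD; xICNT; xHIT; xINA] -> forall r, words s a r = 0) ->
  twp cap build_levels s (k * (level_cost + 3) + 3) (fun s' => exists g, oracle s' g).
Proof.
move=> E bs z; have capk := par_capk P; have n0 := par_n P.
pose g0 : rows R := Rows (fun=> [::]) (fun _ _ => 0%R) (fun=> [::]).
apply: (twp_for_bounded (N := k) (B := fun=> level_cost)
  (I := fun i s' => exists g, levels_inv i s' g)) => //.
- by apply: leq_trans capk; nia.
- move=> i s1 v _ [g [rp emp sd ht nm h0 a0]]; exists g; split=> //.
  by apply: rep_agree rp; first exact: agree_wput.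
- exists g0; split=> //.
  + split=> r; first by split.
    have [z1 z2 z3 z4] : [/\ words s xCNT r = 0, words s xBUD r = 0, words s xICNT r = 0 &
        forall j, words s xMRK j = 0] by split=> *; apply: z.
    by split=> //= *; rewrite ?z4 // z2 /wsum big_nil.
  + move=> lev; rewrite leqn0 => /eqP->; rewrite expn0 muln1 /num_src.
    by apply: leq_trans (count_size _ _) _; rewrite size_iota.
  + by move=> r _; apply: z.
  + by move=> r _; apply: z.
- move=> i s1 ik si A1 bs1 [g I].
  exact: (build_level_spec ik (env_agree A1 isT E) si bs1 I).
- by rewrite sum_nat_const_nat; lia.
by move=> s1 _ _ [g /levels_inv_oracle h]; exists g.
Qed.

End AllLevels.

(** * Answering one query *)

Section Answers.
Variables (R : realType) (n m k rho H N cap del : nat) (adjl : nat -> seq (nat * R)).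
Implicit Types (s : memory R) (g : rows R).
Local Notation lam := (halvings n).
Local Notation L := (6 * lam * rho).
Hypothesis P : params n m k L N H cap del adjl.
Hypothesis k2 : 2 <= k.

Local Notation wgt := (src_weight del adjl).
Local Notation env := (env n m L N del adjl).
Local Notation rep := (rep n wgt).
Local Notation src s lev := (is_src n s lev).
Local Notation lst := (level_lst n).
Local Notation dst := (level_dist n).
Local Notation oracle := (oracle n k rho del adjl).

Lemma oracle_agree ws rs s s' g : agree ws rs s s' ->
  all (fun a => a \notin ws) [:: xCNT; xLST; xMRK; xBUD; xICNT; xINV; xINA] && (yDIST \notin rs) ->
  oracle s g -> oracle s' g.
Proof.
move=> A h [rp sd ht la].
have ina : xINA \notin ws by move: h => /= /andP[/and5P[_ _ _ _ /and4P[]]].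
have srcE lev : src s' lev = src s lev by apply/funext => a; rewrite /is_src A.1.
split=> //.
- by apply: rep_agree A _ rp; move: h => /= /andP[/and5P[-> -> -> -> /and4P[-> ->]]].
- by move=> lev lk; rewrite srcE; exact: sd.
by move=> lev v lk vn fv; have [a] := ht lev v lk vn fv; exists a; rewrite ?srcE.
Qed.

Variables (i x y : nat) (xn : x < n) (yn : y < n).

Definition est s := weights s yEST i.

(* [C] is the set of candidate values considered so far. *)
Record est_inv (s0 : memory R) (C : R -> Prop) s : Prop := EstInv {
  ei_walk : est s = +oo%E \/ exists2 d : R, est s = d%:E & walk adjl x y d;
  ei_le : forall d, C d -> (est s <= d%:E)%E;
  ei_out : forall j, j != i -> weights s yEST j = weights s0 yEST j }.

Lemma est_inv_sub s0 (C C' : R -> Prop) s : est_inv s0 C s ->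
  (forall d, C' d -> C d) -> est_inv s0 C' s.
Proof. by move=> [h1 h2 h3] sub; split=> // d /sub; exact: h2. Qed.

Lemma est_inv_agree ws rs s0 C s s' : agree ws rs s s' -> yEST \notin rs ->
  est_inv s0 C s -> est_inv s0 C s'.
Proof.
move=> A h [h1 h2 h3].
have e j : weights s' yEST j = weights s yEST j by rewrite A.2.
by split; rewrite /est ?e // => j ji; rewrite e h3.
Qed.

Definition improve (e : rexp) :=
  If (RLeq e (RGet yEST (Var xI))) (RPut yEST (Var xI) e) Skip.

Lemma improve_spec s0 C s e (d : R) : words s xI 0 = i -> est_inv s0 C s ->
  ireval s e = d%:E -> walk adjl x y d ->
  twp cap (improve e) s 2 (est_inv s0 (fun d' => C d' \/ d' = d)).
Proof.
move=> si [h1 h2 h3] ed Wd.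
apply: twp_cond => //=; rewrite si ed => le.
  apply: twp_rput => //=; rewrite si ed.
  split; rewrite /est /= ?eqxx; first by right; exists d.
    by move=> d' [/h2 le'|->] //; exact: le_trans le le'.
  by move=> j ji; rewrite (negbTE ji) h3.
apply: twp_skip => //; split=> // d' [/h2//|->].
by move: le; rewrite -ltNge; exact: ltW.
Qed.

Definition try_common :=
  Seq (Put xV (Cst 0) (Get xLST (cell (Add (Var xBASE) (Var xPX)) (Var xE))))
    (If (Leq (Cst 1) (Get xMRK (cell (Add (Var xBASE) (Var xPA)) (Var xV))))
      (improve (RAdd (RGet yDIST (cell (Add (Var xBASE) (Var xPX)) (Var xV)))
                     (RGet yDIST (cell (Add (Var xBASE) (Var xPA)) (Var xV)))))
      Skip).

Definition try_level :=
  Seq (Put xBASE (Cst 0) (Mul (Var xLEV) (Var xHDR)))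
    (For xE (Get xCNT (Add (Var xBASE) (Var xPX))) try_common).

Definition common g lev d := exists a, [/\ a \in lst g lev x, a \in lst g lev y &
  d = (dst g lev x a + dst g lev y a)%R].

Lemma try_level_spec s0 C s g lev : lev < k -> env s -> oracle s g -> words s xI 0 = i ->
  words s xPX 0 = x -> words s xPA 0 = y -> words s xLEV 0 = lev -> est_inv s0 C s ->
  twp cap try_level s (8 * L + 5) (est_inv s0 (fun d => C d \/ common g lev d)).
Proof.
move=> lk E O si sx sy sl ei; have capk := par_capk P; have n0 := par_n P; have ncap := par_cap_n P.
apply: twp_sput => /=; [by rewrite sl (env_n E); nia|by lia|].
rewrite sl (env_n E); set s1 := wput _ _ _ _.
have A1 : agree [:: xBASE] [::] s s1 by exact: agree_wput.
have E1 := env_agree A1 isT E; have O1 := oracle_agree A1 isT O.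
have ei1 := est_inv_agree A1 isT ei.
have lxE : lst g lev x = rlst g (lev * n + x) by rewrite /level_lst xn.
have lyE : lst g lev y = rlst g (lev * n + y) by rewrite /level_lst yn.
have sd := or_sd O lk.
have szL : size (rlst g (lev * n + x)) <= L.
  have wdel a : del <= wgt lev a by exact: leq_addr.
  by rewrite -lxE; exact: (ordered_size P wdel (sd_ord sd (v := x))).
have szn := (or_rep O1).1 (lev * n + x).
apply: (twp_for (N := size (rlst g (lev * n + x))) (B := fun=> 5)
  (I := fun j s' => est_inv s0 (fun d => C d \/ exists a,
    [/\ a \in take j (rlst g (lev * n + x)), a \in rlst g (lev * n + y) &
     d = (dst g lev x a + dst g lev y a)%R]) s')) => //.
- by have [h _ _] := szn; lia.
- by move=> s2 A2 /=; rewrite !A2.1 //= sx (row_cnt ((or_rep O).2 _)).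
- by move=> j s2 v _; apply: est_inv_agree (agree_wput _ _ _ _) _.
- by apply: est_inv_sub ei1 _ => d [//|[a []]]; rewrite take0.
- move=> j s2 jl sj A2 ei2.
  have E2 := env_agree A2 isT E1; have O2 := oracle_agree A2 isT O1.
  have [si2 sx2 sy2 sb2] : [/\ words s2 xI 0 = i, words s2 xPX 0 = x,
      words s2 xPA 0 = y & words s2 xBASE 0 = lev * n] by rewrite !A2.1.
  have [_ _ szl] := szn.
  have al := mem_nth 0 jl.
  have an := szl _ al.
  have aE : words s2 xLST ((lev * n + x) * n + j) = nth 0 (rlst g (lev * n + x)) j.
    by rewrite (row_lst ((or_rep O2).2 _)).
  apply: twp_sput => /=; rewrite ?sb2 ?sx2 ?(env_n E2) ?sj ?aE;
    [exact: leq_trans (ltnW an) ncap|by []|].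
  set a := nth _ _ _ in al an aE *; set s3 := wput _ _ _ _.
  have A3 : agree [:: xV] [::] s2 s3 by exact: agree_wput.
  have ei3 := est_inv_agree A3 isT ei2; have O3 := oracle_agree A3 isT O2.
  have E3 := env_agree A3 isT E2.
  apply: twp_cond => //=; rewrite sb2 sy2 (env_n E2) (row_mrk ((or_rep O2).2 _)) // => am.
    have ay : a \in rlst g (lev * n + y) by move: am; case: (a \in _).
    have [_ _ _ Wx] : [/\ x < n, a < n, src s lev a & walk adjl x a (dst g lev x a)].
      by apply: (sd_lst sd); rewrite lxE.
    have [_ _ _ Wy] : [/\ y < n, a < n, src s lev a & walk adjl y a (dst g lev y a)].
      by apply: (sd_lst sd); rewrite lyE.
    apply: (twp_wk (improve_spec (d := (dst g lev x a + dst g lev y a)%R)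
      (si2 : words s3 xI 0 = i) ei3 _ _)) => //.
    + rewrite /= sb2 sx2 sy2 (env_n E2).
      by rewrite (row_dist ((or_rep O2).2 _)) // (row_dist ((or_rep O2).2 _)).
    + exact: walk_cat Wx (walk_rev (par_und P) Wy).
    move=> s4 _ ei4; apply: est_inv_sub ei4 _ => d [Cd|[b [bt b2 ->]]]; first by left; left.
    move: bt; rewrite (take_nth 0) // mem_rcons inE => /orP[/eqP->|bt]; first by right.
    by left; right; exists b.
  apply: twp_skip => //; apply: est_inv_sub ei3 _ => d [Cd|[b [bt b2 ->]]]; first by left.
  move: bt; rewrite (take_nth 0) // mem_rcons inE => /orP[/eqP ba|bt].
    by move: am; rewrite -/a in ba; rewrite -ba b2.
  by right; exists b.
- by rewrite sum_nat_const_nat; lia.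
move=> s2 A2 _ ei2; apply: est_inv_sub ei2 _ => d [Cd|[a]]; first by left.
by rewrite lxE lyE => h; right; exists a; rewrite take_size.
Qed.

Definition try_arc :=
  Seq (Put xROW (Cst 0) (Get xADJ (arc_cell (Var xV) (Var xC))))
    (If (Leq (Cst 1) (Get xMRK (cell (Var xPA) (Var xROW))))
      (improve (RAdd (RAdd (RGet yDIST (cell (Var xPX) (Var xV)))
                           (RGet yAW (arc_cell (Var xV) (Var xC))))
                     (RGet yDIST (cell (Var xPA) (Var xROW)))))
      Skip).

(** A vertex of weight at least [L0] is passed over: its edges might exceed the budget, and the
    stretch bound does without them, because such a vertex fills the list by itself. *)
Definition try_vertex :=
  Seq (Put xV (Cst 0) (Get xLST (cell (Var xPX) (Var xE))))
    (If (Leq (Add (Add (Var xDEL) (Get xDEG (Var xV))) (Cst 1)) (Var xL0))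
      (For xC (Get xDEG (Var xV)) try_arc) Skip).

Definition try_edges := For xE (Get xCNT (Var xPX)) try_vertex.

Definition crossing g u d := exists v w, [/\ (v, w) \in adjl u, v \in lst g 0 y &
  d = (dst g 0 x u + w + dst g 0 y v)%R].

Lemma wgt0 u : wgt 0 u = del + size (adjl u).
Proof. by rewrite /src_weight muln1. Qed.

Lemma try_vertex_spec s0 C s g j : env s -> oracle s g -> words s xI 0 = i ->
  words s xPX 0 = x -> words s xPA 0 = y -> words s xE 0 = j ->
  j < size (lst g 0 x) -> est_inv s0 C s ->
  let u := nth 0 (lst g 0 x) j in
  twp cap try_vertex s (if wgt 0 u < del * L then 8 * size (adjl u) + 8 else 8)
    (est_inv s0 (fun d => C d \/ wgt 0 u < del * L /\ crossing g u d)).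
Proof.
move=> E O si sx sy sj jl ei u; have n0 := par_n P; have ncap := par_cap_n P.
have k0 : 0 < k by lia.
have sd := or_sd O k0.
have lxE : lst g 0 x = rlst g x by rewrite /level_lst xn mul0n.
have lyE : lst g 0 y = rlst g y by rewrite /level_lst yn mul0n.
have ul : u \in lst g 0 x by exact: mem_nth.
have [_ un _ Wu] := sd_lst sd ul.
have uE : words s xLST (x * n + j) = u.
  by rewrite (row_lst ((or_rep O).2 _)) -lxE.
have T8 : 8 <= (if wgt 0 u < del * L then 8 * size (adjl u) + 8 else 8) by case: ifP; lia.
apply: twp_sput => /=; rewrite ?sx ?(env_n E) ?sj ?uE; first exact: leq_trans (ltnW un) ncap.
  by have := T8; lia.
set s1 := wput _ _ _ _.
have A1 : agree [:: xV] [::] s s1 by exact: agree_wput.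
have E1 := env_agree A1 isT E; have O1 := oracle_agree A1 isT O.
have ei1 := est_inv_agree A1 isT ei.
apply: twp_cond => /=; rewrite ?(env_del E) ?(env_deg E) ?(env_L0 E) // ?addn1 -?wgt0.
- by have := T8; lia.
- move=> light; rewrite light.
  have deg := deg_le P un; have capW := par_capW P.
  apply: (twp_for (N := size (adjl u)) (B := fun=> 5)
    (I := fun e s' => est_inv s0 (fun d => C d \/ exists v w,
      [/\ (v, w) \in take e (adjl u), v \in lst g 0 y &
       d = (dst g 0 x u + w + dst g 0 y v)%R]) s')) => //.
  + by lia.
  + by move=> s2 A2 /=; rewrite !A2.1 //= (env_deg E).
  + by move=> e s2 v _; apply: est_inv_agree (agree_wput _ _ _ _) _.
  + by apply: est_inv_sub ei1 _ => d [//|[v [w []]]]; rewrite take0.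
  + move=> e s2 el se A2 ei2.
    have E2 := env_agree A2 isT E1; have O2 := oracle_agree A2 isT O1.
    have [si2 sx2 sy2 su2] : [/\ words s2 xI 0 = i, words s2 xPX 0 = x,
        words s2 xPA 0 = y & words s2 xV 0 = u] by rewrite !A2.1.
    have := mem_nth (0, 0%R) el.
    have aE : words s2 xADJ (u * (m + m) + e) = (nth (0, 0%R) (adjl u) e).1.
      by rewrite (env_adj E2).
    have wE : weights s2 yAW (u * (m + m) + e) = (nth (0, 0%R) (adjl u) e).2%:E.
      by rewrite (env_aw E2).
    have tE : take e.+1 (adjl u) = rcons (take e (adjl u)) (nth (0, 0%R) (adjl u) e).
      by rewrite (take_nth (0, 0%R)).
    move: aE wE tE; case: (nth _ _ _) => v w /= aE wE tE uv.
    have [_ vn] := und_lt (par_und P) uv.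
    apply: twp_sput => /=; rewrite ?su2 ?(env_m E2) ?se ?aE;
      [exact: leq_trans (ltnW vn) ncap|by []|].
    set s3 := wput _ _ _ _.
    have A3 : agree [:: xROW] [::] s2 s3 by exact: agree_wput.
    have ei3 := est_inv_agree A3 isT ei2.
    apply: twp_cond => //=; rewrite sy2 (env_n E2) (row_mrk ((or_rep O2).2 _)) // => vm.
      have vy : v \in rlst g y by move: vm; case: (v \in _).
      have [_ _ _ Wv] : [/\ y < n, v < n, src s 0 v & walk adjl y v (dst g 0 y v)].
        by apply: (sd_lst sd); rewrite lyE.
      apply: (twp_wk (improve_spec (d := (dst g 0 x u + w + dst g 0 y v)%R)
        (si2 : words s3 xI 0 = i) ei3 _ _)) => //.
      * rewrite /= sx2 sy2 su2 se (env_n E2) (env_m E2) wE.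
        rewrite (row_dist ((or_rep O2).2 _)) -?lxE // (row_dist ((or_rep O2).2 _)) //.
      * apply: walk_cat (walk_rev (par_und P) Wv); exact: walk_cat Wu (walk1 uv).
      move=> s4 _ ei4; apply: est_inv_sub ei4 _ => d [Cd|[v' [w' [bt b2 ->]]]].
        by left; left.
      move: bt; rewrite tE mem_rcons inE => /orP[/eqP[-> ->]|bt]; first by right.
      by left; right; exists v', w'.
    apply: twp_skip => //; apply: est_inv_sub ei3 _ => d [Cd|[v' [w' [bt b2 ->]]]].
      by left.
    move: bt; rewrite tE mem_rcons inE => /orP[/eqP[ev ew]|bt].
      by move: vm; rewrite -ev -lyE b2.
    by right; exists v', w'.
  + by rewrite sum_nat_const_nat; lia.
  move=> s2 A2 _ ei2; apply: est_inv_sub ei2 _ => d [Cd|[_ [v [w h]]]]; first by left.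
  by right; exists v, w; rewrite take_size.
move=> heavy; rewrite (negbTE heavy); apply: twp_skip => //.
by apply: est_inv_sub ei1 _ => d [//|[]].
Qed.

Lemma try_edges_spec s0 C s g : env s -> oracle s g -> words s xI 0 = i ->
  words s xPX 0 = x -> words s xPA 0 = y -> est_inv s0 C s ->
  twp cap try_edges s (11 * L + 16 * (del * L) + 3)
    (est_inv s0 (fun d => C d \/ exists u,
      [/\ u \in lst g 0 x, wgt 0 u < del * L & crossing g u d])).
Proof.
move=> E O si sx sy ei; have n0 := par_n P; have ncap := par_cap_n P.
have k0 : 0 < k by lia.
have sd := or_sd O k0.
have lxE : lst g 0 x = rlst g x by rewrite /level_lst xn mul0n.
have [szn _ _] := (or_rep O).1 x.
have wdel a : del <= wgt 0 a by exact: leq_addr.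
have szL : size (lst g 0 x) <= L by exact: (ordered_size P wdel (sd_ord sd (v := x))).
(* [W0] charges nothing for a heavy vertex, whose edges are not scanned. All entries but the last
   weigh less than [del * L] together, and the last counts only if it is light; hence the factor
   2. *)
set W0 := fun u => if wgt 0 u < del * L then wgt 0 u else 0.
have W0le : \sum_(u <- lst g 0 x) W0 u <= 2 * (del * L).
  have := sd_ord sd (v := x); case/lastP: (lst g 0 x) => [|l z] ol; first by rewrite big_nil.
  have [lt _] := ol l z [::] (esym (cats1 l z)).
  rewrite -cats1 big_cat big_seq1 /=.
  have : \sum_(u <- l) W0 u <= wsum (wgt 0) l.
    by apply: leq_sum => u _; rewrite /W0; case: ifP.
  have : W0 z <= del * L by rewrite /W0; case: ifP => // /ltnW.
  by lia.
apply: (twp_for (N := size (lst g 0 x))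
  (B := fun j => 8 + 8 * W0 (nth 0 (lst g 0 x) j))
  (I := fun j s' => est_inv s0 (fun d => C d \/ exists u,
    [/\ u \in take j (lst g 0 x), wgt 0 u < del * L & crossing g u d]) s')) => //.
- by rewrite lxE; lia.
- by move=> s2 A2 /=; rewrite !A2.1 //= sx (row_cnt ((or_rep O).2 _)) lxE.
- by move=> j s2 v _; apply: est_inv_agree (agree_wput _ _ _ _) _.
- by apply: est_inv_sub ei _ => d [//|[a []]]; rewrite take0.
- move=> j s2 jl sj A2 ei2.
  have E2 := env_agree A2 isT E; have O2 := oracle_agree A2 isT O.
  have [si2 sx2 sy2] : [/\ words s2 xI 0 = i, words s2 xPX 0 = x &
      words s2 xPA 0 = y] by rewrite !A2.1.
  apply: (twp_wk (try_vertex_spec E2 O2 si2 sx2 sy2 sj jl ei2)).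
    by rewrite /W0; case: ifP => //; rewrite wgt0; lia.
  move=> s3 _ ei3; apply: est_inv_sub ei3 _ => d [Cd|[u [ut lt cr]]]; first by left; left.
  move: ut; rewrite (take_nth 0) // mem_rcons inE => /orP[/eqP e|ut].
    by right; rewrite -e.
  by left; right; exists u.
- have -> : \sum_(0 <= j < size (lst g 0 x)) (8 + 8 * W0 (nth 0 (lst g 0 x) j) + 3) =
      11 * size (lst g 0 x) + 8 * \sum_(u <- lst g 0 x) W0 u.
    rewrite [\sum_(u <- lst g 0 x) W0 u](big_nth 0) [8 * _]big_distrr /=.
    by rewrite big_split big_split /= !sum_nat_const_nat; lia.
  by lia.
move=> s2 A2 _ ei2; apply: est_inv_sub ei2 _ => d [Cd|[u h]]; first by left.
by right; exists u; rewrite take_size.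
Qed.

Definition answer :=
  Seq (Put xPX (Cst 0) (Get xQ1 (Var xI)))
  (Seq (Put xPA (Cst 0) (Get xQ2 (Var xI)))
  (Seq (RPut yEST (Var xI) RInfty)
  (Seq (For xLEV (Cst k) try_level) try_edges))).

Definition answer_cost := k * (8 * L + 8) + 11 * L + 16 * (del * L) + 20.

Lemma answer_spec s g : env s -> oracle s g -> words s xI 0 = i ->
  words s xQ1 i = x -> words s xQ2 i = y -> k <= cap ->
  twp cap answer s answer_cost (fun s' =>
    [/\ est s' = +oo%E \/ (exists2 d : R, est s' = d%:E & walk adjl x y d),
      forall om, walk adjl x y om -> (est s' <= ((2 * k%:R - 2) * om)%:E)%E &
      forall j, j != i -> weights s' yEST j = weights s yEST j]).
Proof.
move=> E O si sx sy kcap; have ncap := par_cap_n P.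
have xcap := leq_trans (ltnW xn) ncap; have ycap := leq_trans (ltnW yn) ncap.
apply: twp_sput => /=; rewrite ?si ?sx //; first by rewrite /answer_cost; lia.
apply: twp_sput => /=; rewrite ?si ?sy //; first by rewrite /answer_cost; lia.
apply: twp_srput => /=; first by rewrite /answer_cost; lia.
rewrite si; set s1 := rput _ _ _ _.
have A1 : agree [:: xPX; xPA] [:: yEST] s s1.
  split=> a j /=; rewrite !inE ?negb_or /=; last by move=> /negbTE->.
  by move=> /andP[/negbTE-> /negbTE->].
have E1 := env_agree A1 isT E; have O1 := oracle_agree A1 isT O.
have ei1 : est_inv s (fun=> False) s1.
  split=> //; first by left; rewrite /est /= eqxx.
  by move=> j ji; rewrite /= (negbTE ji).
apply: (@twp_seq _ _ _ _ _ (k * (8 * L + 8) + 3) (11 * L + 16 * (del * L) + 3)); last first.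
  by rewrite /answer_cost; lia.
apply: (twp_for (N := k) (B := fun=> 8 * L + 5) (I := fun lev s' => est_inv s
  (fun d => exists2 lev', lev' < lev & common g lev' d) s')) => //.
- by move=> j s2 v _; apply: est_inv_agree (agree_wput _ _ _ _) _.
- by apply: est_inv_sub ei1 _ => d [].
- move=> lev s2 lk sl A2 ei2.
  have E2 := env_agree A2 isT E1; have O2 := oracle_agree A2 isT O1.
  have [si2 sx2 sy2] : [/\ words s2 xI 0 = i, words s2 xPX 0 = x &
      words s2 xPA 0 = y] by rewrite !A2.1.
  apply: (twp_wk (try_level_spec lk E2 O2 si2 sx2 sy2 sl ei2)) => // s3 _ ei3.
  apply: est_inv_sub ei3 _ => d [lev']; rewrite ltnS leq_eqVlt => /orP[/eqP->|h] c; first by right.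
  by left; exists lev'.
- by rewrite sum_nat_const_nat; lia.
move=> s2 A2 _ ei2.
have E2 := env_agree A2 isT E1; have O2 := oracle_agree A2 isT O1.
have [si2 sx2 sy2] : [/\ words s2 xI 0 = i, words s2 xPX 0 = x &
    words s2 xPA 0 = y] by rewrite !A2.1.
apply: (twp_wk (try_edges_spec E2 O2 si2 sx2 sy2 ei2)) => // s3 _ [h1 h2 h3].
split=> // om Wom.
apply: (est_le (par_und P) k2 (or_sd O) _ (or_hit O) (or_last O) xn _ Wom).
- by move=> a _; rewrite /is_src addn1.
- by move=> lev a lk ax ay; apply: h2; left; exists lev => //; exists a.
- by move=> u v w ux light uv vy; apply: h2; right; exists u; split=> //; exists v, w.
Qed.

End Answers.

(** * Reading the graph, computing the parameters, and the whole program *)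

Section Program.
Variables (R : realType) (n m k cap : nat) (el : seq (nat * nat * R)).
Implicit Types (s : memory R).

Definition arcs_of (e : nat * nat * R) v :=
  (if e.1.1 == v then [:: (e.1.2, e.2)] else [::]) ++
  (if e.1.2 == v then [:: (e.1.1, e.2)] else [::]).

Definition adj_of (l : seq (nat * nat * R)) v := flatten [seq arcs_of e v | e <- l].

Lemma size_arcs_of e v : size (arcs_of e v) = (e.1.1 == v) + (e.1.2 == v).
Proof. by rewrite /arcs_of size_cat; case: eqP; case: eqP. Qed.

Lemma size_adj_of l v : size (adj_of l v) <= size l + size l.
Proof.
elim: l => //= e l IH; rewrite /adj_of /= size_cat size_arcs_of -/(adj_of l v).
by case: eqP; case: eqP => _ _; lia.
Qed.

Lemma sum_adj_of l : (forall e, e \in l -> e.1.1 < n /\ e.1.2 < n) ->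
  \sum_(0 <= v < n) size (adj_of l v) = size l + size l.
Proof.
have one x : x < n -> \sum_(0 <= v < n) (x == v : nat) = 1.
  move=> xn; rewrite (bigD1_seq x) ?mem_index_iota ?iota_uniq //= eqxx big1 // => v.
  by rewrite eq_sym => /negbTE->.
elim: l => [|e l IH] ln; first by rewrite big1.
have [e1 e2] : e.1.1 < n /\ e.1.2 < n by apply: ln; rewrite inE eqxx.
have {}IH := IH (fun x xl => ln x (mem_behead (s := e :: l) xl)).
under eq_bigr => v _ do rewrite /adj_of /= size_cat size_arcs_of -/(adj_of l v).
by rewrite big_split big_split /= IH !one // [in RHS]addSn [in RHS]addnS.
Qed.

Definition adj_ok s (f : nat -> seq (nat * R)) :=
  (forall v, v < n -> words s xDEG v = size (f v)) /\
  forall v j, v < n -> j < size (f v) ->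
    words s xADJ (v * (m + m) + j) = (nth (0, 0%R) (f v) j).1 /\
    weights s yAW (v * (m + m) + j) = (nth (0, 0%R) (f v) j).2%:E.

Definition add_arc a b :=
  Seq (Put xADJ (arc_cell (Var a) (Get xDEG (Var a))) (Var b))
  (Seq (RPut yAW (arc_cell (Var a) (Get xDEG (Var a))) (RGet yEW (Var xI)))
    (Put xDEG (Var a) (Add (Get xDEG (Var a)) (Cst 1)))).

Definition push_arc (f : nat -> seq (nat * R)) u p : nat -> seq (nat * R) :=
  fun x => if x == u then rcons (f u) p else f x.

Lemma add_arc_spec s f (a b : nat) u v w : adj_ok s f ->
  (forall x, x < n -> size (f x) <= m + m) -> words s xHDR 1 = m ->
  a \notin [:: xADJ; xDEG] -> b \notin [:: xADJ; xDEG] ->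
  words s a 0 = u -> words s b 0 = v -> weights s yEW (words s xI 0) = w%:E ->
  u < n -> v < n -> size (f u) < m + m -> n <= cap -> m + m <= cap ->
  twp cap (add_arc a b) s 5 (fun s' => adj_ok s' (push_arc f u (v, w))).
Proof.
rewrite !inE !negb_or => -[h1 h2] sz sm /andP[a1 a2] /andP[b1 b2] su sv sw un vn szu nc mc.
apply: twp_sput => //=; first by rewrite sv; lia.
apply: twp_srput => //=.
rewrite (negbTE a1).
apply: twp_put => //=; rewrite (negbTE a1) su h1 //; first by lia.
rewrite sm sv sw; split=> [x xn|x j xn]; rewrite /= /push_arc.
  by case: eqP => [_|_]; rewrite ?size_rcons ?addn1 // h1.
have szx := sz x xn.
case: (x =P u) => [->|xu] jl.
  rewrite size_rcons ltnS in jl; rewrite nth_rcons eqn_add2l.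
  by case: (ltngtP j (size (f u))) jl => // jl _; exact: h2.
have -> : (x * (m + m) + j == u * (m + m) + size (f u)) = false.
  by rewrite cell_eq //; [case: eqP|lia].
exact: h2.
Qed.

Lemma push_arcs f e x :
  push_arc (push_arc f e.1.1 (e.1.2, e.2)) e.1.2 (e.1.1, e.2) x = f x ++ arcs_of e x.
Proof.
case: e => [[u v] w]; rewrite /push_arc /arcs_of /= [u == x]eq_sym [v == x]eq_sym.
have [->|_] := eqVneq x v; last by case: eqP => [->|_]; rewrite ?cats0 ?cats1.
by case: eqP => [->|_]; rewrite -?cats1 -?catA.
Qed.

Definition add_edges :=
  For xI (Get xHDR (Cst 1))
    (Seq (Put xPX (Cst 0) (Get xE1 (Var xI)))
    (Seq (Put xPA (Cst 0) (Get xE2 (Var xI)))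
    (Seq (add_arc xPX xPA) (add_arc xPA xPX)))).

Hypothesis n_gt0 : 0 < n.
Hypothesis el_lt : forall e, e \in el -> e.1.1 < n /\ e.1.2 < n.
Hypothesis el_size : size el = m.

Definition input_ok q (xs ys : nat -> nat) s :=
  [/\ words s xHDR 0 = n, words s xHDR 1 = m, words s xHDR 2 = q,
    forall e, e < m -> let x := nth (0, 0, 0%R) el e in
      [/\ words s xE1 e = x.1.1, words s xE2 e = x.1.2 & weights s yEW e = x.2%:E] &
    forall i, i < q -> words s xQ1 i = xs i /\ words s xQ2 i = ys i].

Lemma input_ok_agree ws rs q xs ys s s' : agree ws rs s s' ->
  all (fun a => a \notin ws) [:: xHDR; xE1; xE2; xQ1; xQ2] && (yEW \notin rs) ->
  input_ok q xs ys s -> input_ok q xs ys s'.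
Proof.
move=> [A B] /= /andP[/and5P[a1 a2 a3 a4 /andP[a5 _]] b1] [h1 h2 h3 h4 h5].
by split=> *; rewrite ?(A _ _ a1, A _ _ a2, A _ _ a3, A _ _ a4, A _ _ a5, B _ _ b1) //;
  [exact: h4|exact: h5].
Qed.

Lemma add_edges_spec q xs ys s : input_ok q xs ys s -> (forall v, words s xDEG v = 0) ->
  n <= cap -> m + m <= cap ->
  twp cap add_edges s (18 * m + 3) (fun s' => adj_ok s' (adj_of el)).
Proof.
move=> I z nc mc.
apply: (twp_for (N := m) (B := fun=> 15)
  (I := fun i s' => adj_ok s' (adj_of (take i el)))) => //.
- by lia.
- by move=> s1 A1 /=; case: I => _ h _ _ _; rewrite A1.1.
- by rewrite take0; split=> // v vn; rewrite z.
- move=> i s1 im si A1 ok1.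
  have I1 := input_ok_agree A1 isT I; case: (I1) => n1 m1 _ e1 _.
  have := e1 i im; set x := nth _ _ _ => -[x1 x2 xw].
  have xl : x \in el by apply: mem_nth; rewrite el_size.
  have [ux vx] := el_lt xl.
  have szi v : size (adj_of (take i el) v) <= i + i.
    by have := size_adj_of (take i el) v; rewrite size_takel // el_size ltnW.
  apply: twp_sput => /=; rewrite ?si ?x1 //; first exact: leq_trans (ltnW ux) nc.
  apply: twp_sput => /=; rewrite ?si ?x2 //; first exact: leq_trans (ltnW vx) nc.
  set s2 := wput _ _ _ _.
  have ok2 : adj_ok s2 (adj_of (take i el)) by case: ok1.
  apply: (@twp_seq _ _ _ _ _ 5 5) => //.
  apply: (twp_wk (add_arc_spec (a := xPX) (b := xPA) (u := x.1.1) (v := x.1.2) (w := x.2)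
    ok2 _ m1 _ _ _ _ _ _ _ _ nc mc)) => //.
  + by move=> v _; have := szi v; lia.
  + by rewrite /= si.
  + by have := szi x.1.1; lia.
  move=> s3 A3 ok3.
  have m3 : words s3 xHDR 1 = m by rewrite A3.1.
  apply: (twp_wk (add_arc_spec (a := xPA) (b := xPX) (u := x.1.2) (v := x.1.1) (w := x.2)
    ok3 _ m3 _ _ _ _ _ _ _ _ nc mc)) => //.
  + move=> v _; rewrite /push_arc; have := szi v; have := szi x.1.1.
    by case: ifP => _; rewrite ?size_rcons; lia.
  + by rewrite A3.1.
  + by rewrite A3.1.
  + by rewrite A3.1 //= A3.2 //= si.
  + rewrite /push_arc; have := szi x.1.2; have := szi x.1.1.
    by case: ifP => _; rewrite ?size_rcons; lia.
  move=> s4 _; congr adj_ok; apply/funext => v.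
  by rewrite push_arcs (take_nth (0, 0, 0%R)) ?el_size // -/x /adj_of map_rcons flatten_rcons.
- by rewrite sum_nat_const_nat; lia.
by move=> s1 _ _; rewrite take_oversize ?el_size.
Qed.

(** [k] is a constant of the program, so a [k]-th power is a single expression. It is only compared,
    never stored, and need not respect the cap. *)
Fixpoint wpow (e : wexp) j := if j is j'.+1 then Mul e (wpow e j') else Cst 1.

Lemma ieval_wpow s e j : ieval s (wpow e j) = ieval s e ^ j.
Proof. by elim: j => //= j ->; rewrite expnS. Qed.

Variables (rho H : nat).
Local Notation lam := (halvings n).
Local Notation L := (6 * lam * rho).
Local Notation del := (m %/ n).+1.
Local Notation N := (n + (m + m) * L).+1.
Hypothesis P : params n m k L N H cap del (adj_of el).
Hypotheses (k2 : 2 <= k) (kcap : k <= cap) (rho_gt0 : 0 < rho) (rho_k : n <= rho ^ k).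
Hypothesis rho_min : rho = 1 \/ rho.-1 ^ k < n.

(** Linear search is affordable here: its [rho] turns are within the time bound. *)
Definition compute_root :=
  Seq (Put xRHO (Cst 0) (Cst 1))
    (While (Not (Leq (Var xHDR) (wpow (Var xRHO) k)))
      (Put xRHO (Cst 0) (Add (Var xRHO) (Cst 1)))).

Lemma lam_pos : 0 < lam.
Proof. by rewrite /halvings -(prednK n_gt0). Qed.

Lemma cap_rho : rho <= cap /\ lam <= cap.
Proof.
have LD : L <= del * L by rewrite leq_pmull.
have Lcap : L <= cap := leq_trans (leq_trans LD (leq_addr _ _)) (par_capW P).
have lp := lam_pos; have r0 := rho_gt0.
by split; apply: leq_trans Lcap; nia.
Qed.

Lemma compute_root_spec s : words s xHDR 0 = n ->
  twp cap compute_root s (2 * rho + 3) (fun s' => words s' xRHO 0 = rho).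
Proof.
move=> sn; have [rc _] := cap_rho.
apply: twp_sput => //=; [by lia|by lia|].
apply: (twp_while (I := fun s' => 0 < words s' xRHO 0 <= rho)
  (Phi := fun s' => 2 * (rho - words s' xRHO 0))) => //=.
- move=> s1 /andP[r0 rle] A1; rewrite ieval_wpow A1.1 //= sn -ltnNge => lt.
  have lt1 : words s1 xRHO 0 < rho.
    rewrite ltn_neqAle rle andbT; apply/eqP => e.
    by move: lt; rewrite e ltnNge rho_k.
  exists 1; apply: twp_put => //=; first by lia.
  by split; lia.
- by lia.
move=> s1 /andP[r0 rle] A1; rewrite negbK ieval_wpow A1.1 //= sn => ge.
case: rho_min => [e|lt]; first by lia.
apply/eqP; rewrite eqn_leq rle leqNgt; apply/negP => lt1.
have : words s1 xRHO 0 ^ k <= rho.-1 ^ k by rewrite leq_exp2r; lia.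
by lia.
Qed.

Definition compute_log :=
  Seq (Put xTH (Cst 0) (Var xHDR))
  (Seq (Put xLAM (Cst 0) (Cst 0))
    (While (Leq (Cst 1) (Var xTH))
      (Seq (Put xTH (Cst 0) (Div (Var xTH) (Cst 2)))
           (Put xLAM (Cst 0) (Add (Var xLAM) (Cst 1)))))).

Lemma compute_log_spec s : words s xHDR 0 = n ->
  twp cap compute_log s (4 * lam + 5) (fun s' => words s' xLAM 0 = lam).
Proof.
move=> sn; have [_ lc] := cap_rho; have ncap := par_cap_n P.
apply: twp_sput => /=; [by rewrite sn|by lia|].
apply: twp_sput => /=; [by []|by lia|].
rewrite sn; apply: (twp_while (I := fun s' => words s' xTH 0 <= n /\
    words s' xLAM 0 + halvings (words s' xTH 0) = lam)
  (Phi := fun s' => 4 * halvings (words s' xTH 0))) => //=.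
- move=> s1 [tn e] A1 t0; have hh := halvings_half t0.
  exists 3; apply: twp_sput => //=; first by lia.
  by apply: twp_put => //=; [lia|split; [split; lia|lia]].
- by lia.
move=> s1 [tn e] A1; rewrite -eqn0Ngt => /eqP t0.
by move: e; rewrite t0 /halvings /= addn0.
Qed.

Definition compute_params :=
  Seq compute_root
  (Seq compute_log
  (Seq (Put xDEL (Cst 0) (Add (Div (Get xHDR (Cst 1)) (Var xHDR)) (Cst 1)))
  (Seq (Put xL (Cst 0) (Mul (Mul (Cst 6) (Var xLAM)) (Var xRHO)))
  (Seq (Put xL0 (Cst 0) (Mul (Var xDEL) (Var xL)))
    (Put xN (Cst 0) (Add (Add (Var xHDR)
      (Mul (Add (Get xHDR (Cst 1)) (Get xHDR (Cst 1))) (Var xL))) (Cst 1))))))).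

Lemma compute_params_spec s : words s xHDR 0 = n -> words s xHDR 1 = m ->
  adj_ok s (adj_of el) ->
  twp cap compute_params s (2 * rho + 4 * lam + 20) (fun s' => env n m L N del (adj_of el) s').
Proof.
move=> sn sm ok; have capW := par_capW P; have capN := par_capN P.
have Dcap : del * L <= cap := leq_trans (leq_addr _ _) capW.
have Lcap : L <= cap by apply: leq_trans Dcap; rewrite leq_pmull.
have Ncap : N <= cap := leq_trans (leq_addr _ _) capN.
have delcap : del <= cap := leq_trans (leq_trans (leq_addr _ _) (leq_addl _ _)) capW.
apply: (@twp_seq _ _ _ _ _ (2 * rho + 3) (4 * lam + 15)); last by lia.
apply: (twp_wk (compute_root_spec sn)) => // s1 A1 r1.
have n1 : words s1 xHDR 0 = n by rewrite A1.1.
apply: (@twp_seq _ _ _ _ _ (4 * lam + 5) 9); last by lia.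
apply: (twp_wk (compute_log_spec n1)) => // s2 A2 l2.
have n2 : words s2 xHDR 0 = n by rewrite A2.1.
have m2 : words s2 xHDR 1 = m by rewrite A2.1 // A1.1.
have r2 : words s2 xRHO 0 = rho by rewrite A2.1.
have ok2 : adj_ok s2 (adj_of el).
  case: ok => h1 h2; split=> [v vn|v j vn jl]; first by rewrite A2.1 // A1.1 // h1.
  by have [<- <-] := h2 v j vn jl; rewrite A2.1 // A2.2 // A1.1 // A1.2.
apply: twp_sput => //=; rewrite n2 m2 ?addn1; first exact: delcap.
apply: twp_sput => //=; rewrite l2 r2; first exact: Lcap.
apply: twp_sput => //=.
apply: twp_put => //=; rewrite n2 m2 addn1; first exact: Ncap.
case: ok2 => h1 h2; split=> //=.
  by move=> v j vn jl; have [] := h2 v j vn jl.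
by move=> v j vn jl; have [] := h2 v j vn jl.
Qed.

Definition queries := For xI (Get xHDR (Cst 2)) (answer k).

(** Phrased with walks: [dist] is an infimum, equal to [+oo] when there is no walk, and only the
    last translation has to deal with it. *)
Definition answered x y (e : \bar R) :=
  (e = +oo%E \/ exists2 d : R, e = d%:E & walk (adj_of el) x y d) /\
  forall om, walk (adj_of el) x y om -> (e <= ((2 * k%:R - 2) * om)%:E)%E.

Lemma queries_spec q xs ys s g : input_ok q xs ys s -> q <= cap ->
  (forall i, i < q -> xs i < n /\ ys i < n) ->
  env n m L N del (adj_of el) s -> oracle n k rho del (adj_of el) s g ->
  twp cap queries s (q * (answer_cost n k rho del + 3) + 3) (fun s' =>
    forall i, i < q -> answered (xs i) (ys i) (weights s' yEST i)).
Proof.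
move=> I qcap xyn E O.
apply: (twp_for (N := q) (B := fun=> answer_cost n k rho del)
  (I := fun i s' => forall j, j < i -> answered (xs j) (ys j) (weights s' yEST j))) => //.
- by move=> s1 A1 /=; case: I => _ _ h _ _; rewrite A1.1.
- move=> i s1 iq si A1 IH.
  have I1 := input_ok_agree A1 isT I; case: (I1) => _ _ _ _ xy1.
  have [x1 y1] := xy1 i iq; have [xn yn] := xyn i iq.
  apply: (twp_wk (answer_spec P k2 xn yn (env_agree A1 isT E) (oracle_agree A1 isT O)
    si x1 y1 kcap)) => // s2 _ [h1 h2 h3] j.
  rewrite ltnS leq_eqVlt => /orP[/eqP->|ji]; first by split.
  by rewrite h3; [exact: IH|lia].
by rewrite sum_nat_const_nat; lia.
Qed.

Definition program :=
  Seq add_edges (Seq compute_params (Seq (build_levels k) queries)).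

Definition total_cost q := 18 * m + 2 * rho + 4 * lam + k * (level_cost n rho H N + 3) +
  q * (answer_cost n k rho del + 3) + 40.

Lemma program_spec q xs ys s : bounded cap s -> input_ok q xs ys s -> q <= cap ->
  (forall i, i < q -> xs i < n /\ ys i < n) ->
  (forall a r, a \in [:: xDEG; xCNT; xMRK; xBUD; xICNT; xHIT; xINA] -> words s a r = 0) ->
  twp cap program s (total_cost q) (fun s' =>
    forall i, i < q -> answered (xs i) (ys i) (weights s' yEST i)).
Proof.
move=> bs I qcap xyn z; have ncap := par_cap_n P; have capW := par_capW P.
have mcap : m + m <= cap := leq_trans (leq_trans (leq_addl _ _) (leq_addl _ _)) capW.
have m_del : m <= n * del by rewrite mulnC ltnW // ltn_ceil.
have z0 v : words s xDEG v = 0 by apply: z.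
case: (I) => sn sm _ _ _.
apply: (@twp_seq _ _ _ _ _ (18 * m + 3) (total_cost q - (18 * m + 4))); last first.
  by rewrite /total_cost; lia.
apply: (twp_wk (twp_bounded bs (add_edges_spec I z0 ncap mcap))) => // s1 A1 [bs1 ok1].
have n1 : words s1 xHDR 0 = n by rewrite A1.1.
have m1 : words s1 xHDR 1 = m by rewrite A1.1.
apply: (@twp_seq _ _ _ _ _ (2 * rho + 4 * lam + 20)
  (k * (level_cost n rho H N + 3) + q * (answer_cost n k rho del + 3) + 7)); last first.
  by rewrite /total_cost; lia.
apply: (twp_wk (twp_bounded bs1 (compute_params_spec n1 m1 ok1))) => // s2 A2 [bs2 E2].
apply: (@twp_seq _ _ _ _ _ (k * (level_cost n rho H N + 3) + 3)
  (q * (answer_cost n k rho del + 3) + 3)); last by lia.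
have z2 a : a \in [:: xCNT; xMRK; xBUD; xICNT; xHIT; xINA] -> forall r, words s2 a r = 0.
  move=> ai r; rewrite A2.1 ?A1.1 ?z //; first by rewrite inE ai orbT.
    by move: ai; rewrite !inE => /or4P[|||/or3P[]] /eqP->.
  by move: ai; rewrite !inE => /or4P[|||/or3P[]] /eqP->.
apply: (twp_wk (build_levels_spec P k2 rho_gt0 rho_k m_del E2 bs2 z2)) => // s3 A3 [g O3].
have I3 : input_ok q xs ys s3.
  apply: input_ok_agree A3 isT _; apply: input_ok_agree A2 isT _.
  exact: input_ok_agree A1 isT I.
exact: (queries_spec I3 qcap xyn (env_agree A3 isT E2) O3).
Qed.

End Program.

(** * From the program to the theorem *)

Section GraphInput.
Variables (R : realType) (n : nat) (G : wgraph R n) (l : seq ('I_n * 'I_n)).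
Hypothesis l_edges : edge_list G l.

Definition weighted_edges : seq (nat * nat * R) :=
  [seq (val e.1, val e.2, wt G e.1 e.2) | e <- l].

Lemma size_edge_list : size l = #|edges G|.
Proof. by rewrite -(size_map (fun e => [set e.1; e.2]%SET)) (perm_size l_edges) cardE. Qed.

Lemma edge_list_adj e : e \in l -> adj G e.1 e.2.
Proof.
move=> el; have : [set e.1; e.2]%SET \in enum (edges G).
  by rewrite -(perm_mem l_edges); apply: map_f.
rewrite mem_enum inE => /existsP[x /existsP[y /andP[xy /eqP e12]]].
have : x \in [set e.1; e.2]%SET by rewrite e12 !inE eqxx.
have : y \in [set e.1; e.2]%SET by rewrite e12 !inE eqxx orbT.
rewrite !inE => /orP[]/eqP yE /orP[]/eqP xE; move: xy; rewrite xE yE ?adj_irr //.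
by rewrite adj_sym.
Qed.

Lemma adj_edge_list x y : adj G x y -> ((x, y) \in l) || ((y, x) \in l).
Proof.
move=> xy; have : [set x; y]%SET \in edges G.
  by rewrite inE; apply/existsP; exists x; apply/existsP; exists y; rewrite xy eqxx.
rewrite -mem_enum -(perm_mem l_edges) => /mapP[[u v] uv /= e].
have : x != y by apply/eqP => h; move: xy; rewrite h adj_irr.
have : x \in [set u; v]%SET by rewrite -e !inE eqxx.
have : y \in [set u; v]%SET by rewrite -e !inE eqxx orbT.
by rewrite !inE => /orP[]/eqP-> /orP[]/eqP->; rewrite ?eqxx // uv ?orbT.
Qed.

Lemma mem_adj_of (x : nat) y w : (y, w) \in adj_of weighted_edges x <->
  exists u v : 'I_n, [/\ x = u, y = v, adj G u v & w = wt G u v].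
Proof.
rewrite /adj_of /weighted_edges -map_comp; split.
  case/flattenP => s /mapP[[u v] uv ->]; have uvG := edge_list_adj uv.
  rewrite /arcs_of /= mem_cat => /orP[]; case: eqP => // <-; rewrite inE => /eqP[-> ->].
    by exists u, v.
  by exists v, u; split=> //; [rewrite adj_sym|rewrite wt_sym].
case=> u [v [-> -> uv ->]]; case/orP: (adj_edge_list uv) => h.
  apply/flattenP; exists (arcs_of (val u, val v, wt G u v) u).
    by apply/mapP; exists (u, v).
  by rewrite /arcs_of /= eqxx mem_cat inE eqxx.
apply/flattenP; exists (arcs_of (val v, val u, wt G v u) u).
  by apply/mapP; exists (v, u).
by rewrite /arcs_of /= eqxx mem_cat [X in _ || X]inE wt_sym ?eqxx ?orbT.
Qed.

Lemma undirected_edges : undirected (adj_of weighted_edges) n.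
Proof.
split=> x y w /mem_adj_of[u [v [xu yv uv wE]]].
- by rewrite xu yv.
- by rewrite wE; exact: wt_ge0.
apply/mem_adj_of; exists v, u; split=> //; first by rewrite adj_sym.
by rewrite wE (wt_sym uv).
Qed.

Lemma weighted_edges_lt e : e \in weighted_edges -> e.1.1 < n /\ e.1.2 < n.
Proof. by case/mapP => -[u v] _ -> /=; split; exact: ltn_ord. Qed.

Lemma path_walk (x : 'I_n) p : path (adj G) x p ->
  walk (adj_of weighted_edges) x (last x p) (walk_weight G x p).
Proof.
elim: p x => [|y p IH] x /=.
  by move=> _; rewrite /walk_weight big_nil; exact: walk_nil.
case/andP => xy yp; rewrite /walk_weight /= big_cons; apply: walk_cons (IH _ yp).
by apply/mem_adj_of; exists x, y.
Qed.

Lemma walk_path x z om : walk (adj_of weighted_edges) x z om -> forall u v : 'I_n,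
  x = u -> z = v -> exists p, [/\ path (adj G) u p, last u p = v & walk_weight G u p = om].
Proof.
elim=> {x z om} [x u v -> /val_inj ->|x y z w om /mem_adj_of[a [b [-> -> ab ->]]] _ IH u v ua zv].
  by exists [::]; rewrite /walk_weight big_nil.
have [p [bp lp wp]] := IH b v erefl zv.
exists (b :: p); rewrite /= -(val_inj ua) ab bp; split=> //.
by rewrite /walk_weight /= big_cons -/(walk_weight G b p) wp.
Qed.

Lemma dist_le_walk (x y : 'I_n) om : walk (adj_of weighted_edges) x y om ->
  (dist G x y <= om%:E)%E.
Proof.
move=> W; have [p [xp lp <-]] := walk_path W erefl erefl.
by apply: ereal_inf_lbound; exists p.
Qed.

Lemma dist_lb (x y : 'I_n) (e : \bar R) :
  (forall om, walk (adj_of weighted_edges) x y om -> (e <= om%:E)%E) ->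
  (e <= dist G x y)%E.
Proof.
move=> h; apply/ereal_infP => _ [p [xp lp] <-]; apply: h.
by rewrite -lp; exact: path_walk.
Qed.

(** Dividing by [2 * k - 2] turns the bound for each walk into a lower bound of the infimum, and
    [2 * ceil (r / 2) >= r] turns [(2 * k - 2) * r] into the stretch. *)
Lemma answered_stretch k (x y : 'I_n) (e : \bar R) : 2 <= k ->
  answered k weighted_edges x y e ->
  (dist G x y <= e)%E /\ (e <= stretch k (dist G x y))%E.
Proof.
move=> k2 [hw hle]; split.
  by case: hw => [->|[d -> /dist_le_walk//]]; exact: leey.
have k0 : (0 < 2 * k%:R - 2 :> R)%R.
  by have : (2 <= k%:R :> R)%R by [rewrite ler_nat]; lra.
(* At [+oo] the upper bound is trivial; [-oo] is excluded by non-negative weights. *)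
case dE : (dist G x y) => [r| |]; rewrite /stretch ?leey //; last first.
  have : (0 <= dist G x y)%E.
    by apply: dist_lb => om /(walk_ge0 undirected_edges); rewrite lee_fin.
  by rewrite dE.
(* An infinite [e] would be a lower bound of all walk lengths, contradicting a finite distance. *)
have [d ed] : exists d : R, e = d%:E.
  case: hw => [e_oo|[d -> _]]; last by exists d.
  have : (+oo <= dist G x y)%E by apply: dist_lb => om /hle; rewrite e_oo.
  by rewrite dE.
have : ((d / (2 * k%:R - 2))%:E <= dist G x y)%E.
  by apply: dist_lb => om /hle; rewrite ed !lee_fin ler_pdivrMr // mulrC.
rewrite dE ed !lee_fin ler_pdivrMr // => h.
have := ceil_ge (r / 2); lra.
Qed.

Lemma edges_le : #|edges G| <= n * n.
Proof.
apply: (@leq_trans #|[set [set e.1; e.2]%SET | e in [set: 'I_n * 'I_n]]%SET|).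
  apply: subset_leq_card; apply/fintype.subsetP => a.
  rewrite inE => /existsP[x /existsP[y /andP[_ /eqP->]]].
  by apply/imsetP; exists (x, y).
by apply: leq_trans (leq_imset_card _ _) _; rewrite cardsT card_prod card_ord.
Qed.

End GraphInput.

Lemma halvings_lt n : n < 2 ^ halvings n.
Proof.
by rewrite /halvings; case: eqP => [->|_] //; exact: trunc_log_ltn.
Qed.

Lemma halvings_le_id n : halvings n <= n.
Proof.
rewrite /halvings; case: n => //= n.
have h := trunc_logP (isT : 1 < 2) (isT : 0 < n.+1).
exact: leq_trans (ltn_expl _ (isT : 1 < 2)) h.
Qed.

Lemma ceil_root_ex n k : 0 < n -> 0 < k -> exists2 r, 0 < r <= n &
  n <= r ^ k /\ (r = 1 \/ r.-1 ^ k < n).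
Proof.
move=> n0 k0.
have ex : exists r, (0 < r) && (n <= r ^ k).
  by exists n; rewrite n0 -{1}(expn1 n) leq_pexp2l.
case: (ex_minnP ex) => r /andP[r0 nr] rmin; exists r.
  by rewrite r0 /=; apply: rmin; rewrite n0 -{1}(expn1 n) leq_pexp2l.
split=> //; have [->|r1] := eqVneq r 1; [by left|right].
rewrite ltnNge; apply/negP => h.
by have := rmin r.-1; rewrite h andbT; lia.
Qed.

(** * Arithmetic of the word length and the running time *)

Section Bounds.
Variables (n m k q rho : nat).
Local Notation lam := (halvings n).
Local Notation L := (6 * lam * rho).
Local Notation del := (m %/ n).+1.
Local Notation N := (n + (m + m) * L).+1.
Hypotheses (n_gt0 : 0 < n) (m_le : m <= n * n) (rho_le : 0 < rho <= n).

Let lam_n : lam <= n. Proof. exact: halvings_le_id. Qed.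
Let lam0 : 0 < lam. Proof. by rewrite /halvings -(prednK n_gt0). Qed.

(** [N + N] is at most [2 ^ 5 * n ^ 4] and [n < 2 ^ lam], so the height is at most
    [(5 + 4) * lam]. *)
Lemma leaves_le : N + N <= 2 ^ (9 * lam).
Proof.
have L6 : L <= 6 * (n * n) by rewrite -mulnA leq_mul2l leq_mul; case/andP: rho_le.
have h : N + N <= 2 ^ 5 * n ^ 4.
  have n1 : 1 <= n * n by rewrite muln_gt0 n_gt0.
  have n2 : n <= (n * n) * (n * n) by nia.
  have h1 : (m + m) * L <= 2 * (n * n) * (6 * (n * n)) by apply: leq_mul => //; lia.
  have -> : n ^ 4 = (n * n) * (n * n) by rewrite !expnS expn0; lia.
  have n3 : 1 <= (n * n) * (n * n) by rewrite muln_gt0 n1.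
  move: h1 n2 n3; rewrite mulnACA; set X := (m + m) * L; set Y := _ * (n * n).
  by change (2 ^ 5) with 32; lia.
apply: leq_trans h _; have -> : 9 * lam = 5 * lam + lam * 4 by lia.
rewrite expnD leq_mul //; first by rewrite leq_exp2l // leq_pmulr.
by rewrite expnM leq_exp2r // ltnW // halvings_lt.
Qed.

(** The sum of all quantities that the cap has to dominate, so that each bound is immediate. *)
Definition word_cap := k + q + k.+1 * n + (N + N) + (del * L + (del + (m + m))).

(** Every summand is at most a constant times [2 ^ k * S ^ 3], the constants adding up to less than
    [2 ^ 9]; since [S >= 2], powers of 2 become powers of [S], and [k + 12 = 9 + k + 3]. *)
Lemma word_cap_le : word_cap.+2 <= (n + m + q).+1 ^ (k + 12).
Proof.
set S := (n + m + q).+1.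
have S2 : 2 <= S by rewrite /S; lia.
have Sn : n <= S by rewrite /S; lia.
have Sm : m.+1 <= S by rewrite /S; lia.
have Sq : q <= S by rewrite /S; lia.
have dS : del <= S by apply: leq_trans Sm; rewrite ltnS leq_div.
have L6 : L <= 6 * (S * S).
  rewrite -mulnA leq_mul2l leq_mul //; first exact: leq_trans lam_n Sn.
  by case/andP: rho_le => _ h; exact: leq_trans h Sn.
have dL : del * L <= S * (6 * (S * S)) by exact: leq_mul.
have mL : (m + m) * L <= (2 * S) * (6 * (S * S)) by apply: leq_mul => //; lia.
have kS : k.+1 * n <= 2 ^ k * S by apply: leq_mul => //; exact: ltn_expl.
have k2 : k <= 2 ^ k by rewrite ltnW // ltn_expl.
have e1 : S * (6 * (S * S)) = 6 * S ^ 3 by rewrite !expnS expn0; lia.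
have e2 : (2 * S) * (6 * (S * S)) = 12 * S ^ 3 by rewrite !expnS expn0; lia.
have S3 : S <= S ^ 3 by rewrite -{1}(expn1 S) leq_pexp2l // ltnW.
have P1 : 0 < 2 ^ k by rewrite expn_gt0.
have P2 : 2 ^ k <= S ^ k by case: (k) => // k'; rewrite leq_exp2r.
apply: (@leq_trans (2 ^ 9 * (2 ^ k * S ^ 3))).
  rewrite /word_cap; move: dL mL; rewrite e1 e2.
  have : S ^ 3 <= 2 ^ k * S ^ 3 by rewrite leq_pmull.
  have : 2 ^ k * S <= 2 ^ k * S ^ 3 by rewrite leq_mul2l S3 orbT.
  have : 2 ^ k <= 2 ^ k * S ^ 3 by rewrite leq_pmulr // expn_gt0.
  change (2 ^ 9) with 512.
  move: (2 ^ k) (S ^ 3) kS k2 S3 P1 => K X kS k2 S3 P1.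
  set A := (m + m) * _; set B := _ * L; set KX := K * X; set KS := K * S in kS *.
  move: dS Sm Sn Sq; move: (m %/ n) => D; lia.
have -> : k + 12 = 9 + (k + 3) by lia.
by rewrite !expnD leq_mul // ?leq_mul // leq_exp2r.
Qed.

(** Everything is measured in [Z = lam * ((m + n) * L)], which equals [6 * (m + n) * rho * lam ^ 2].
    A level costs about [H * N] with [H = 9 * lam] and [N <= 4 * ((m + n) * L)]. *)
Lemma total_cost_le A : q <= A * n ->
  total_cost n m k rho (9 * lam) q <=
  (6 * (3100 * k + A * (16 * k + 60) + 64)) * ((m + n) * rho * lam ^ 2).
Proof.
move=> qA; set Y := m + n.
have r0 : 0 < rho by case/andP: rho_le.
have L0 : 0 < L by rewrite !muln_gt0 lam0.
have Y0 : 0 < Y by rewrite /Y; lia.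
(* This makes the edge scans of all queries fit: at most [A * n] queries cost [O(del * L)] each. *)
have ndel : n * del <= Y by rewrite mulnS /Y addnC leq_add2r mulnC leq_divM.
have rL : rho <= L by nia.
have lL : lam <= L by nia.
have NY : N <= 4 * (Y * L).
  have : n <= n * L by rewrite leq_pmulr.
  rewrite /Y mulnDl mulnDl; move: (m * L) (n * L) => a b; lia.
have YL : 0 < Y * L by rewrite muln_gt0 Y0.
have h2 : n * L <= Y * L by rewrite leq_mul2r /Y leq_addl orbT.
have h3 : n <= Y * L by apply: leq_trans h2; rewrite leq_pmulr.
pose Z := lam * (Y * L).
have YZ : Y * L <= Z by rewrite leq_pmull.
have lev : level_cost n rho (9 * lam) N <= 3090 * Z.
  rewrite /level_cost.
  have h1 : (60 * (9 * lam) + 200) * N <= 2960 * Z.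
    have -> : 2960 * Z = (740 * lam) * (4 * (Y * L)) by rewrite /Z; ring.
    by apply: leq_mul => //; lia.
  have h4 : lam * (11 * (n * L) + 30 * n) <= 41 * Z.
    have -> : 41 * Z = lam * (41 * (Y * L)) by rewrite /Z; ring.
    by rewrite leq_mul2l; apply/orP; right; lia.
  by lia.
have ans : q * (answer_cost n k rho del + 3) <= A * (16 * k + 60) * Z.
  apply: (@leq_trans (A * n * (answer_cost n k rho del + 3))); first by rewrite leq_mul2r qA orbT.
  rewrite -!mulnA leq_mul2l; apply/orP; right; rewrite /answer_cost.
  have nd : n * (del * L) <= Y * L by rewrite mulnA leq_mul2r ndel orbT.
  have -> : n * (k * (8 * L + 8) + 11 * L + 16 * (del * L) + 20 + 3) =
      8 * k * (n * L) + 8 * k * n + 11 * (n * L) + 16 * (n * (del * L)) + 23 * n by ring.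
  apply: (@leq_trans ((16 * k + 60) * (Y * L))); last by rewrite leq_mul2l YZ orbT.
  have k1 : 8 * k * (n * L) <= 8 * k * (Y * L) by rewrite leq_mul2l h2 orbT.
  have k3 : 8 * k * n <= 8 * k * (Y * L) by rewrite leq_mul2l h3 orbT.
  move: k1 k3 nd h2 h3; rewrite mulnDl -[16 * k * _]mulnA -![8 * k * _]mulnA.
  by move: (k * (n * L)) (k * (Y * L)) (k * n) (n * (del * L)) (n * L) (Y * L); lia.
have rest : 18 * m + 2 * rho + 4 * lam + 40 <= 64 * Z.
  have mY : m <= Y * L by apply: leq_trans (leq_pmulr _ L0); rewrite /Y leq_addr.
  have rY : rho <= Y * L by apply: leq_trans rL _; rewrite leq_pmull.
  have lY : lam <= Y * L by apply: leq_trans lL _; rewrite leq_pmull.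
  by lia.
have -> : (6 * (3100 * k + A * (16 * k + 60) + 64)) * (Y * rho * lam ^ 2) =
    3100 * (k * Z) + A * (16 * k + 60) * Z + 64 * Z.
  by rewrite /Z !expnS expn0; ring.
rewrite /total_cost.
have levk : k * (level_cost n rho (9 * lam) N + 3) <= 3100 * (k * Z).
  have -> : 3100 * (k * Z) = k * (3100 * Z) by ring.
  by rewrite leq_mul2l; apply/orP; right; lia.
by lia.
Qed.

End Bounds.

Section Reals.
Variable R : realType.
Local Open Scope ring_scope.

(** Rounding up adds at most 1, and the root of a positive integer is at least 1. *)
Lemma ceil_root_le (n k r : nat) : (0 < n)%N -> (0 < k)%N -> (0 < r)%N ->
  (r = 1 \/ r.-1 ^ k < n)%N -> r%:R <= 2 * (n%:R `^ k%:R^-1) :> R.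
Proof.
move=> n0 k0 r0 [->|lt].
  have : 1 `^ k%:R^-1 <= n%:R `^ k%:R^-1 :> R.
    by apply: ge0_ler_powR; rewrite ?invr_ge0 ?ler0n ?nnegrE ?ler1n.
  by rewrite powR1; lra.
have h : r.-1%:R <= n%:R `^ k%:R^-1 :> R.
  have -> : r.-1%:R = (r.-1%:R ^+ k) `^ k%:R^-1 :> R.
    by rewrite -powR_mulrn ?ler0n // -powRrM mulfV ?pnatr_eq0 -?lt0n // powRr1 ?ler0n.
  apply: ge0_ler_powR; rewrite ?invr_ge0 ?ler0n ?nnegrE ?exprn_ge0 ?ler0n //.
  by rewrite -natrX ler_nat ltnW.
have h1 : 1 <= n%:R `^ k%:R^-1 :> R.
  have : 1 `^ k%:R^-1 <= n%:R `^ k%:R^-1 :> R.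
    by apply: ge0_ler_powR; rewrite ?invr_ge0 ?ler0n ?nnegrE ?ler1n.
  by rewrite powR1.
have -> : r%:R = r.-1%:R + 1 :> R by rewrite natr1 prednK.
lra.
Qed.

Lemma halvings_ln n : (0 < n)%N -> (halvings n)%:R <= 2 * (1 + ln n%:R) :> R.
Proof.
move=> n0.
(* From [ln (1 + x) <= x] at [x = - 1 / 2]. *)
have l2 : 1 / 2 <= ln 2 :> R.
  have h := @le_ln1Dx R (- (1 / 2)).
  have e : 1 - 1 / 2 = 2^-1 :> R by lra.
  by move: h; rewrite e lnV ?posrE // => /(_ ltac:(lra)); lra.
have : ln ((2 ^ trunc_log 2 n)%N%:R) <= ln n%:R :> R.
  by rewrite ler_ln ?posrE ?ltr0n ?expn_gt0 // ler_nat trunc_logP.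
rewrite natrX lnXn // -[ln 2 *+ _]mulr_natr => h.
have -> : halvings n = (trunc_log 2 n).+1 by rewrite /halvings -(prednK n0).
have t0 : 0 <= (trunc_log 2 n)%:R :> R by exact: ler0n.
have := ler_wpM2r t0 l2; rewrite -[(trunc_log 2 n).+1%:R]natr1; lra.
Qed.

End Reals.

(** * The initial memory *)

Section InputMemory.
Variables (R : realType) (n : nat) (G : wgraph R n) (l : seq ('I_n * 'I_n)).
Variables (q : nat) (st : q.-tuple ('I_n * 'I_n)).
Hypothesis l_edges : edge_list G l.
Local Notation m := #|edges G|.

Definition query_src i := nth 0 [seq val e.1 | e <- st] i.
Definition query_dst i := nth 0 [seq val e.2 | e <- st] i.

Lemma query_srcE (i : 'I_q) : query_src i = (tnth st i).1.
Proof.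
rewrite /query_src (tnth_nth (tnth st i)) (nth_map (tnth st i)) ?size_tuple //.
Qed.

Lemma query_dstE (i : 'I_q) : query_dst i = (tnth st i).2.
Proof.
rewrite /query_dst (tnth_nth (tnth st i)) (nth_map (tnth st i)) ?size_tuple //.
Qed.

Lemma input_input_ok :
  input_ok n m (weighted_edges G l) q query_src query_dst (input G l st).
Proof.
have sl := size_edge_list l_edges.
split=> //=; first by rewrite size_tuple.
move=> e em; have el : e < size l by rewrite sl.
have x0 : 'I_n * 'I_n by case: (l) el => // p.
by rewrite /weighted_edges !(nth_map x0).
Qed.

Lemma input_bounded cap : n <= cap -> m <= cap -> q <= cap -> bounded cap (input G l st).
Proof.
move=> nc mc qc a i; rewrite /input /=.
have vals (f : 'I_n * 'I_n -> 'I_n) (s : seq ('I_n * 'I_n)) j :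
    nth 0 [seq val (f e) | e <- s] j <= cap.
  have [js|js] := ltnP j (size s); last by rewrite nth_default ?size_map.
  have x0 : 'I_n * 'I_n by case: (s) js => // p.
  by rewrite (nth_map x0) // ltnW // (leq_trans (ltn_ord _)).
case: a => [|[|[|[|[|a]]]]] /=; try exact: vals; last by rewrite !nth_nil.
by case: i => [|[|[|i]]] //=; rewrite ?nth_nil ?size_tuple // (size_edge_list l_edges).
Qed.

End InputMemory.

Local Open Scope ring_scope.

Theorem theorem15 (R : realType) (k : nat) (hk : (2 <= k)%N) (c : nat) :
  exists (P : cmd) (b e : nat),
  forall A : nat, exists C : nat,
  forall (n : nat) (G : wgraph R n) (l : seq ('I_n * 'I_n))
         (q : nat) (st : q.-tuple ('I_n * 'I_n)),
    (0 < n)%N -> edge_list G l -> (q <= A * n)%N ->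
    let m := #|edges G| in
    let w := word_length b (n + m + q) in
    (forall coins : seq bool,
        halted (run w P (input G l st) coins) ->
        forall i : 'I_q,
          let d := dist G (tnth st i).1 (tnth st i).2 in
          let d' := estimate (run w P (input G l st) coins) i in
          (d <= d')%E /\ (d' <= stretch k d)%E) /\
    (exists T : nat,
        T%:R <= C%:R * (m + n)%:R * (n%:R `^ k%:R^-1) * (1 + ln n%:R) ^+ e :> R /\
        1 - (n%:R ^+ c)^-1 <= halt_prob w P (input G l st) T).
Proof.
pose D := (k + 12)%N.
(* With [S = (n + m + q).+1], [word_cap_le] bounds [cap.+2] by [S ^ D], and values inside
   expressions are below [cap.+2 ^ csize (program k)]; this fixes [b]. The exponent 2 is that of
   [lam] in the cost. Only [C] depends on [A]. *)
exists (program k), (D * csize (program k))%N, 2 => A.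
(* The 8 comes from [rho <= 2 * n ^ (1 / k)] and from [lam <= 2 * (1 + ln n)], which is squared. *)
pose C1 := (6 * (3100 * k + A * (16 * k + 60) + 64))%N; exists (8 * C1)%N.
move=> n G l q st n0 le qA m w.
have k0 : (0 < k)%N := ltnW hk.
have mn : (m <= n * n)%N := edges_le G.
have [rho rn [nrk rmin]] := ceil_root_ex n0 k0.
have [r0 _] := andP rn.
pose cap := word_cap n m k q rho.
have sz : size (weighted_edges G l) = m by rewrite size_map (size_edge_list le).
have P : params n m k (6 * halvings n * rho) (n + (m + m) * (6 * halvings n * rho)).+1
    (9 * halvings n) cap (m %/ n).+1 (adj_of (weighted_edges G l)).
  split=> //.
  - exact: undirected_edges.
  - by rewrite sum_adj_of ?sz //; exact: weighted_edges_lt.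
  - exact: leaves_le.
  - exact: leq_trans (leq_addl _ _) (leq_addr _ _).
  - exact: leq_addl.
  - exact: leq_trans (leq_addl _ _) (leq_trans (leq_addr _ _) (leq_addr _ _)).
have kc : (k <= cap)%N by rewrite /cap /word_cap -!addnA leq_addr.
have qc : (q <= cap)%N by rewrite /cap /word_cap -!addnA addnCA leq_addr.
have nc := par_cap_n P.
have mc : (m <= cap)%N.
  by rewrite /cap /word_cap !addnA leq_addl.
have bs := @input_bounded R n G l q st le cap nc mc qc.
have xy i : (i < q)%N -> (query_src st i < n /\ query_dst st i < n)%N.
  by move=> iq; rewrite (query_srcE st (Ordinal iq)) (query_dstE st (Ordinal iq)).
(* These are [xDEG], [xCNT], [xMRK], [xBUD], [xICNT], [xHIT] and [xINA], the arrays that the program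
   expects to be blank. *)
have z (a r : nat) : a \in [:: 5; 24; 26; 27; 28; 31; 30]%N ->
    words (input G l st) a r = 0%N.
  by rewrite !inE => /or4P[|||/or4P[]] /eqP-> /=; rewrite nth_nil.
have [s' [t [ex tT ans]]] := program_spec n0 (@weighted_edges_lt R n G l) sz P hk kc r0 nrk
  rmin bs (input_input_ok st le) qc xy z.
have wide : (cap.+2 ^ csize (program k) <= 2 ^ w)%N.
  have capS : (cap.+2 <= (n + m + q).+1 ^ D)%N by apply: word_cap_le.
  rewrite /w /word_length; move: (csize (program k)) => cs.
  have Slog : ((n + m + q).+1 <= 2 ^ (trunc_log 2 (n + m + q)).+1)%N by exact: trunc_log_ltn.
  apply: (@leq_trans ((n + m + q).+1 ^ (D * cs))).
    by rewrite expnM; case: cs => // cs; rewrite leq_exp2r.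
  apply: (@leq_trans ((n + m + q).+1 ^ (D * cs).+1)); first by rewrite leq_pexp2l.
  by rewrite [X in (_ <= 2 ^ X)%N]mulnC expnM leq_exp2r.
split.
  move=> coins hlt i d d'.
  have e := iexec_halted ex bs wide hlt.
  have := answered_stretch le hk (x := (tnth st i).1) (y := (tnth st i).2) (e := d').
  apply; rewrite /d' /estimate e /= -query_srcE -query_dstE.
  exact: ans.
exists t; split; last first.
  by rewrite (iexec_halt_prob ex bs wide (leqnn t)) lerBlDr lerDl invr_ge0 exprn_ge0.
have cost := total_cost_le k n0 mn rn qA.
have tC : t%:R <= (C1 * ((m + n) * rho * halvings n ^ 2))%N%:R :> R.
  by rewrite ler_nat; apply: leq_trans tT cost.
apply: le_trans tC _.
have rle := @ceil_root_le R n k rho n0 k0 r0 rmin.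
have lle := @halvings_ln R n n0.
have prod : rho%:R * (halvings n)%:R ^+ 2 <=
    2 * (n%:R `^ k%:R^-1) * (2 * (1 + ln n%:R)) ^+ 2 :> R.
  apply: ler_pM; rewrite ?exprn_ge0 ?ler0n // lerXn2r ?nnegrE ?ler0n //.
  exact: le_trans lle.
have -> : (C1 * ((m + n) * rho * halvings n ^ 2))%:R =
    C1%:R * (m + n)%:R * (rho%:R * (halvings n)%:R ^+ 2) :> R.
  by rewrite natrM natrM natrM natrX !mulrA.
have -> : (8 * C1)%:R * (m + n)%:R * (n%:R `^ k%:R^-1) * (1 + ln n%:R) ^+ 2 =
    C1%:R * (m + n)%:R * (2 * (n%:R `^ k%:R^-1) * (2 * (1 + ln n%:R)) ^+ 2) :> R.
  by rewrite natrM; ring.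
by rewrite ler_wpM2l // mulr_ge0.
Qed.
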